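(* Let $s\in(0,1)$ and let $N\ge 1$ be an integer with $N>2s$. Let $f\colon\mathbb{R}\to\mathbb{R}$, put $F(t)=\int_0^t f(\sigma)\,d\sigma$ and $\tilde F(t)=f(t)t-2F(t)$, and assume that: (1) $f$ is odd and continuous; (2) $\lim_{t\to 0} f(t)/|t|^{1+4s/N}=0$; (3) $\lim_{t\to+\infty} f(t)/|t|^{(N+2s)/(N-2s)}=0$; (4) $\lim_{t\to+\infty} F(t)/|t|^{2+4s/N}=+\infty$; (5) the function $t\mapsto \tilde F(t)/|t|^{2+4s/N}$ is strictly decreasing on $(-\infty,0)$ and strictly increasing on $(0,+\infty)$; (6) $f(t)t<\frac{2N}{N-2s}F(t)$ for all $t\in\mathbb{R}\setminus\{0\}$; (7) $\lim_{t\to 0} tf(t)/|t|^{2N/(N-2s)}=+\infty$. Then the function $m\mapsto E_m$, $m\in(0,\infty)$, is positive, continuous and strictly decreasing. Furthermore $\lim_{m\to0^+}E_m=+\infty$ and $\lim_{m\to\infty}E_m=0$.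
   Context: All functions are real valued. $H^s(\mathbb{R}^N)=\{u\in L^2(\mathbb{R}^N): [u]_{H^s(\mathbb{R}^N)}<\infty\}$, where $[u]_{H^s(\mathbb{R}^N)}^2=\int_{\mathbb{R}^N\times\mathbb{R}^N}\frac{|u(x)-u(y)|^2}{|x-y|^{N+2s}}\,dx\,dy$. For $m>0$: $S_m=\{u\in H^s(\mathbb{R}^N):\int_{\mathbb{R}^N}|u|^2dx=m\}$. The energy is $I(u)=\frac12[u]_{H^s(\mathbb{R}^N)}^2-\int_{\mathbb{R}^N}F(u)\,dx$. The Pohozaev functional is $P(u)=[u]_{H^s(\mathbb{R}^N)}^2-\frac{N}{2s}\int_{\mathbb{R}^N}\tilde F(u)\,dx$, the Pohozaev manifold is $\mathcal{P}_m=\{u\in S_m: P(u)=0\}$, and $E_m=\inf_{u\in\mathcal{P}_m}I(u)$. *)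

(* Defs.v *)
From HB Require Import structures.
From mathcomp Require Import all_boot all_order all_algebra.
From mathcomp Require Import all_classical all_reals all_analysis.

Set Implicit Arguments.
Unset Strict Implicit.
Unset Printing Implicit Defensive.

Import Order.TTheory GRing.Theory Num.Theory.
Import numFieldNormedType.Exports.

Local Open Scope classical_set_scope.
Local Open Scope ring_scope.

(* R^N, with the product of the Borel sigma-algebras of R. *)
Notation Rn R N := (N.-tuple (measurableTypeR R)).

(* The Lebesgue measure of R^N, by induction on N: that of R^(n+1) is the image
   of the product of those of R and R^n under (x, t) |-> x :: t. *)
Section lebesgueN.
Context {R : realType}.

Definition tcons n (p : measurableTypeR R * Rn R n) : Rn R n.+1 :=
  [tuple of p.1 :: p.2].

Definition tuncons n (t : Rn R n.+1) : measurableTypeR R * Rn R n :=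
  (thead t, [tuple of behead t]).

Lemma tunconsK n : cancel (@tuncons n) (@tcons n).
Proof. by move=> t; rewrite [RHS]tuple_eta; apply: val_inj. Qed.

Lemma tconsK n : cancel (@tcons n) (@tuncons n).
Proof. by case=> x t; congr pair; apply: val_inj. Qed.

Lemma measurable_tcons n : measurable_fun setT (@tcons n).
Proof. exact: measurable_cons. Qed.

Lemma measurable_tuncons n : measurable_fun setT (@tuncons n).
Proof.
apply: measurable_fun_pair; [exact: measurable_tnth|exact: measurable_behead].
Qed.

Section step.
Variables (n : nat) (m : {sigma_finite_measure set (Rn R n) -> \bar R}).
Local Open Scope ereal_scope.

Definition lebesgue_cons : set (Rn R n.+1) -> \bar R :=
  pushforward (@lebesgue_measure R \x m) (@tcons n).

Let lc0 : lebesgue_cons set0 = 0.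
Proof. by rewrite /lebesgue_cons /pushforward preimage_set0 measure0. Qed.

Let lc_ge0 A : 0 <= lebesgue_cons A.
Proof.
apply: (@measure_ge0 _ _ _ (pushforward _ _)).
exact: measurable_tcons.
Qed.

Let lc_sigma_additive : semi_sigma_additive lebesgue_cons.
Proof.
apply: (@measure_semi_sigma_additive _ _ _ (pushforward _ _)).
exact: measurable_tcons.
Qed.

HB.instance Definition _ :=
  isMeasure.Build _ _ _ lebesgue_cons lc0 lc_ge0 lc_sigma_additive.

Let lc_sigma_finite : sigma_finite setT lebesgue_cons.
Proof.
have /sigma_finiteP[F [TF ndF Foo]] := sigma_finiteT (@lebesgue_measure R).
have /sigma_finiteP[G [TG ndG Goo]] := sigma_finiteT m.
exists (fun k => @tuncons n @^-1` (F k `*` G k)).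
  rewrite -preimage_bigcup (_ : \bigcup_k (F k `*` G k) = setT) ?preimage_setT//.
  rewrite -subTset => -[x t] _.
  have [i _ Fx] : (\bigcup_k F k) x by rewrite -TF.
  have [j _ Gt] : (\bigcup_k G k) t by rewrite -TG.
  exists (maxn i j) => //; split.
  - by move: x Fx; exact/subsetPset/ndF/leq_maxl.
  - by move: t Gt; exact/subsetPset/ndG/leq_maxr.
move=> k; have [mF Fk] := Foo k; have [mG Gk] := Goo k; split.
  rewrite -[X in measurable X]setTI; apply: measurable_tuncons => //.
  exact: measurableX.
rewrite /lebesgue_cons /pushforward.
suff -> : @tcons n @^-1` (@tuncons n @^-1` (F k `*` G k)) = F k `*` G k.
  by rewrite product_measure1E// lte_mul_pinfty// ge0_fin_numE.
rewrite -comp_preimage (_ : @tuncons n \o @tcons n = id)//.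
by apply: funext => p; exact: tconsK.
Qed.

HB.instance Definition _ :=
  Measure_isSigmaFinite.Build _ _ _ lebesgue_cons lc_sigma_finite.

End step.

Fixpoint lebesgueN n : {sigma_finite_measure set (Rn R n) -> \bar R} :=
  match n with
  | 0 => dirac ([tuple] : Rn R 0)
  | k.+1 => lebesgue_cons (lebesgueN k)
  end.

Lemma lebesgueN_box n (A : 'I_n -> set (measurableTypeR R)) :
  (forall i, measurable (A i)) ->
  lebesgueN n [set x | forall i, A i (tnth x i)] =
  (\prod_(i < n) lebesgue_measure (A i))%E.
Proof.
elim: n A => [|n IH] A mA.
  by rewrite big_ord0 /= diracE mem_set//= => -[].
rewrite big_ord_recl -IH//= /lebesgue_cons /pushforward.
rewrite -product_measure1E//.
  congr (_ _); apply/seteqP; split=> -[x t] /=.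
    move=> At; split; first exact: (At ord0).
    by move=> i; have := At (lift ord0 i); rewrite tnthS.
  by move=> [Ax At] i; have [j|] := unliftP ord0 i => ->//; rewrite tnthS.
have -> : [set t : Rn R n | forall i, A (lift ord0 i) (tnth t i)] =
    \bigcap_i ((fun t : Rn R n => tnth t i) @^-1` A (lift ord0 i)).
  by apply/seteqP; split=> t /= At i => [_|]; exact: At.
apply: fin_bigcap_measurable => // i _; rewrite -[X in measurable X]setTI.
exact: measurable_tnth.
Qed.

End lebesgueN.

Section fractional_energy.
Context {R : realType}.
Variable N : nat.

Local Notation mu := (@lebesgueN R N).

Definition eucl_dist (x y : Rn R N) : R :=
  Num.sqrt (\sum_(i < N) ((tnth x i : R) - (tnth y i : R)) ^+ 2).

(* [u]^2_{H^s}, possibly +oo.  On the null set x = y the integrand is 0. *)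
Definition gagliardo2 (s : R) (u : Rn R N -> R) : \bar R :=
  (\int[mu \x mu]_z
    (`|u z.1 - u z.2| ^+ 2 / eucl_dist z.1 z.2 `^ (N%:R + 2 * s))%:E)%E.

(* Functions are Borel representatives: they are not identified when they are
   equal almost everywhere, but all the functionals below only depend on the
   class of u. *)
Definition Hs (s : R) : set (Rn R N -> R) :=
  [set u | u \in Lfun mu 2%:E /\ (gagliardo2 s u < +oo)%E].

Definition mass_sphere (s m : R) : set (Rn R N -> R) :=
  [set u | Hs s u /\ (\int[mu]_x (`|u x| ^+ 2)%:E)%E = m%:E].

(* The oriented integral of f from 0 to t. *)
Definition primitive (f : R -> R) (t : R) : R :=
  if 0 <= t then \int[lebesgue_measure]_(x in `[0, t]) f x
  else - \int[lebesgue_measure]_(x in `[t, 0]) f x.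

Definition Ftilde (f : R -> R) (t : R) : R := f t * t - 2 * primitive f t.

(* Extended-real valued: these are real numbers as soon as gagliardo2 s u is
   finite and F(u), resp. Ftilde(u), is integrable. *)
Definition energy (s : R) (f : R -> R) (u : Rn R N -> R) : \bar R :=
  ((2^-1)%:E * gagliardo2 s u - \int[mu]_x (primitive f (u x))%:E)%E.

Definition pohozaev (s : R) (f : R -> R) (u : Rn R N -> R) : \bar R :=
  (gagliardo2 s u
    - (N%:R / (2 * s))%:E * \int[mu]_x (Ftilde f (u x))%:E)%E.

Definition pohozaev_manifold (s : R) (f : R -> R) (m : R) :
    set (Rn R N -> R) :=
  [set u | mass_sphere s m u /\ pohozaev s f u = 0%E].

(* Valued in \bar R so that no junk value arises from an empty or unbounded
   set; E_m is a real number when 0 < least_energy N s f m < +oo. *)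
Definition least_energy (s : R) (f : R -> R) (m : R) : \bar R :=
  ereal_inf [set energy s f u | u in pohozaev_manifold s f m].

End fractional_energy.

(* Main.v *)
Require Import Defs.
From HB Require Import structures.
From mathcomp Require Import all_boot all_order all_algebra.
From mathcomp Require Import all_classical all_reals all_analysis.
From mathcomp Require Import measurable_realfun ring lra.
Set Implicit Arguments.
Unset Strict Implicit.
Unset Printing Implicit Defensive.
Import Order.TTheory GRing.Theory Num.Theory.
Import numFieldNormedType.Exports.
Local Open Scope classical_set_scope.
Local Open Scope ring_scope.

(* Write u_c(x) = c u(c^(2/N) x) for the mass-preserving rescalings of u.  As
   F(r) / r^2 is a convex function of r^(4s/N), the energy I(u_c) is a concave
   function of c^(4s/N), whose derivative at c = 1 is P(u) / 2.  Hence every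
   fiber c |-> u_c meets the Pohozaev manifold, at a maximum of I on the fiber,
   and E_m is the infimum over S_m of these maxima; no minimizer is needed.

   Strict monotonicity: if k^2 r^(N-2s) = 1 and k > 1, passing from v to
   x |-> k v(x/r) keeps the seminorm, lowers the mass and raises the energy,
   since F(t) / |t|^(2N/(N-2s)) is strictly decreasing in |t|.  The gain is
   bounded below on the part of the manifold where the energy is bounded: the
   seminorm is bounded there, so a small gain would force the integral of
   Ftilde(v), hence [v]^2, to be small, whereas [v]^2 >= 2 I(v) is bounded below.

   Continuity follows from the dilations x |-> v(x/r) and the uniform
   superlinearity of F along the fibers, the limit at 0 from the
   Gagliardo-Nirenberg and Sobolev inequalities, and the limit at infinity from
   the rescalings of one test function together with hypothesis (7).

   Both inequalities come from one pointwise bound: in a cube around x whose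
   measure is twice what Chebyshev's inequality allows for |u| >= |u(x)|/2, the
   difference |u(x) - u(y)| is at least |u(x)|/2 for at least half of the y. *)

(** * Lebesgue measure on R^N under homotheties *)

Section lebesgue_scaling.
Context {R : realType}.
Implicit Types (r : R) (n : nat).

(** The functionals are invariant under translations and a bounded sequence may also spread out and
    vanish, so strong convergence is out of reach. Compactness is used for scalar functions instead:
    on d <= |t| <= 1/d an even continuous nonlinearity is bounded and a positive one is bounded
    below, while outside this set F and Ftilde are small compared with |t|^(2+4s/N) + |t|^q, q =
    2N/(N-2s), whose integral is controlled by mass and seminorm. Integrating such pointwise
    inequalities gives constants that are uniform over the part of the manifold of bounded mass and
    energy, where a positive lower bound on the energy excludes vanishing. The exponents are
    dictated by scaling. Along a fiber the integral of |u|^(2+4s/N) is multiplied by c^(4s/N),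
    exactly as [u]^2; a rescaling that preserves the seminorm preserves the integral of |u|^q. As f
    is only continuous, the maximum on a fiber is obtained from a tangent line inequality for F,
    integrated over R^N, and the crossing of the manifold from the intermediate value theorem. *)

Lemma lebesgue_measure_scale r (A : set (measurableTypeR R)) : 0 < r ->
  measurable A ->
  lebesgue_measure A =
  (r%:E * pushforward lebesgue_measure
     ( *%R r : measurableTypeR R -> measurableTypeR R) A)%E.
Proof.
move=> r0 mA.
have mr : measurable_fun setT ( *%R r : measurableTypeR R -> measurableTypeR R).
  exact: mulrl_measurable.
pose h : {mfun measurableTypeR R >-> measurableTypeR R} :=
  HB.pack ( *%R r) (isMeasurableFun.Build _ _ _ _ _ mr).
pose m : {measure set (measurableTypeR R) -> \bar R} :=
  mscale (NngNum (ltW r0)) (pushforward lebesgue_measure h).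
(* Both sides are measures in [A], and Lebesgue measure is determined by its values on half-open
   intervals. *)
rewrite -[RHS]/(m mr A); apply: (@lebesgue_measure_unique _ (m mr)) => // _ [[a b]] _ <-.
rewrite /m /mscale /pushforward /=.
rewrite [X in _ = (_ * lebesgue_measure X)%E](_ : _ = `](r^-1 * a), (r^-1 * b)]%classic); last first.
  apply/seteqP; split=> x /=; rewrite !in_itv/= ![r^-1 * _]mulrC.
    by rewrite ltr_pdivrMr// ler_pdivlMr// !(mulrC x).
  by rewrite ltr_pdivrMr// ler_pdivlMr// !(mulrC x).
rewrite !lebesgue_measure_itv/= !lte_fin ltr_pM2l ?invr_gt0//.
case: ifP => ab; last by rewrite mule0.
by rewrite -EFinM -mulrBr mulrA divff ?gt_eqF// mul1r.
Qed.

Lemma ge0_integral_scale1 r (f : measurableTypeR R -> \bar R) : 0 < r ->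
  measurable_fun setT f -> (forall x, 0 <= f x)%E ->
  (\int[lebesgue_measure]_x f x =
   r%:E * \int[lebesgue_measure]_x f (r * x)%R)%E.
Proof.
move=> r0 mf f0.
have mr : measurable_fun setT ( *%R r : measurableTypeR R -> measurableTypeR R).
  exact: mulrl_measurable.
pose h : {mfun measurableTypeR R >-> measurableTypeR R} :=
  HB.pack ( *%R r) (isMeasurableFun.Build _ _ _ _ _ mr).
have /= := @ge0_integral_pushforward _ _ _ _ _ _ mr lebesgue_measure setT f
  measurableT mf (fun x _ => f0 x).
rewrite preimage_setT => <-.
pose mh : {measure set (measurableTypeR R) -> \bar R} :=
  pushforward lebesgue_measure h.
have /= <- := @ge0_integral_mscale _ _ _ (mh mr)
  setT measurableT (NngNum (ltW r0)) f mf (fun x _ => f0 x).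
by apply: eq_measure_integral => A mA _; exact: lebesgue_measure_scale.
Qed.

Definition scaleN n r (t : Rn R n) : Rn R n :=
  [tuple r * (tnth t i : R) | i < n].

Lemma measurable_scaleN n r : measurable_fun setT (@scaleN n r).
Proof.
apply/measurable_fun_tnthP => i.
rewrite (_ : _ \o _ = fun t => r * (tnth t i : R)).
  by apply: measurable_funM => //; exact: measurable_tnth.
by apply/funext => t /=; rewrite tnth_mktuple.
Qed.

Lemma scaleN_cons n r x (t : Rn R n) :
  scaleN r (tcons (x, t)) = tcons (r * x, scaleN r t).
Proof.
apply: eq_from_tnth => i; rewrite tnth_mktuple.
have [j ->|->] := unliftP ord0 i; last by [].
by rewrite !tnthS tnth_mktuple.
Qed.

Lemma scaleNA n r r' (t : Rn R n) : scaleN r (scaleN r' t) = scaleN (r * r') t.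
Proof. by apply: eq_from_tnth => i; rewrite !tnth_mktuple mulrA. Qed.

Lemma scaleN1 n (t : Rn R n) : scaleN 1 t = t.
Proof. by apply: eq_from_tnth => i; rewrite !tnth_mktuple mul1r. Qed.

Lemma ge0_integral_lebesgueN_cons n (f : Rn R n.+1 -> \bar R) :
  measurable_fun setT f -> (forall x, 0 <= f x)%E ->
  (\int[lebesgueN n.+1]_t f t =
   \int[lebesgue_measure]_x \int[lebesgueN n]_t f (tcons (x, t)))%E.
Proof.
move=> mf f0; rewrite /= /lebesgue_cons.
have /= -> := @ge0_integral_pushforward _ _ _ _ _ _ (@measurable_tcons R n)
  (lebesgue_measure \x lebesgueN n)%E setT f measurableT mf (fun x _ => f0 x).
rewrite preimage_setT fubini_tonelli1//.
by apply: measurableT_comp => //; exact: measurable_tcons.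
Qed.

(** Tonelli peels off one coordinate at a time, and each one-dimensional substitution contributes a
    factor [r]. *)
Lemma ge0_integral_scaleN n r (f : Rn R n -> \bar R) : 0 < r ->
  measurable_fun setT f -> (forall x, 0 <= f x)%E ->
  (\int[lebesgueN n]_t f t = (r ^+ n)%:E * \int[lebesgueN n]_t f (scaleN r t))%E.
Proof.
move=> r0; elim: n f => [|n IH] f mf f0.
  rewrite expr0 mul1e; apply: eq_integral => t _; congr f.
  by apply: eq_from_tnth; case.
rewrite ge0_integral_lebesgueN_cons// ge0_integral_lebesgueN_cons//; last first.
  by apply: measurableT_comp => //; exact: measurable_scaleN.
have mfc : measurable_fun setT (f \o @tcons R n).
  by apply: measurableT_comp => //; exact: measurable_tcons.
have mF : measurable_fun setT
    (fun x : measurableTypeR R => \int[lebesgueN n]_t f (tcons (x, t)))%E.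
  exact: (measurable_fun_fubini_tonelli_F (f \o @tcons R n) mfc (fun x => f0 _)).
rewrite (ge0_integral_scale1 r0 mF); last first.
  by move=> x; apply: integral_ge0.
rewrite exprS EFinM -muleA; congr (_ * _)%E.
rewrite -ge0_integralZl//.
- apply: eq_integral => x _; rewrite IH//.
    by congr (_ * _)%E; apply: eq_integral => t _; rewrite scaleN_cons.
  exact: (measurableT_comp mfc (pair1_measurable (r * x))).
- have -> : (fun x : measurableTypeR R =>
      \int[lebesgueN n]_t f (scaleN r (tcons (x, t))))%E =
      (fun x => \int[lebesgueN n]_t (f \o scaleN r \o @tcons R n) (x, t))%E by [].
  apply: (measurable_fun_fubini_tonelli_F (f \o scaleN r \o @tcons R n)); last first.
    by move=> x; exact: f0.
  apply: measurableT_comp; last exact: measurable_tcons.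
  by apply: measurableT_comp => //; exact: measurable_scaleN.
- by move=> x _; apply: integral_ge0.
- by rewrite lee_fin exprn_ge0// ltW.
Qed.

End lebesgue_scaling.

(** * Gagliardo-Nirenberg and Sobolev inequalities *)

Section integral_lower_bound.
Context d (T : measurableType d) (R : realType).
Variable mu : {measure set T -> \bar R}.

Lemma ge0_integral_ge_cst (D : set T) (f : T -> \bar R) (c : R) :
  measurable D -> measurable_fun setT f -> (forall x, 0 <= f x)%E ->
  0 <= c -> (forall x, D x -> (c%:E <= f x)%E) ->
  (c%:E * mu D <= \int[mu]_x f x)%E.
Proof.
move=> mD mf f0 c0 cf; rewrite -integral_cst//.
apply: (@le_trans _ _ (\int[mu]_(x in D) f x)%E).
  apply: ge0_le_integral => //; first exact: measurable_funTS.
exact: ge0_subset_integral.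
Qed.

End integral_lower_bound.

Section gagliardo.
Context {R : realType}.
Variable N : nat.
Implicit Types (x y : Rn R N) (u : Rn R N -> R) (r s : R).

Local Notation mu := (@lebesgueN R N).

Lemma eucl_dist_ge0 x y : 0 <= eucl_dist x y.
Proof. exact: sqrtr_ge0. Qed.

Lemma ler_tnth_eucl_dist x y i :
  `|(tnth x i : R) - (tnth y i : R)| <= eucl_dist x y.
Proof.
rewrite -(sqrtr_sqr ((tnth x i : R) - (tnth y i : R))) ler_wsqrtr//.
rewrite (bigD1 i)//= lerDl; apply: sumr_ge0 => j _; exact: sqr_ge0.
Qed.

Lemma eucl_dist_gt0 x y : x != y -> 0 < eucl_dist x y.
Proof.
move=> xy; rewrite lt_neqAle eucl_dist_ge0 andbT; apply: contra_neqN xy => /eqP e.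
apply: eq_from_tnth => i; have := ler_tnth_eucl_dist x y i.
by rewrite -e normr_le0 subr_eq0 => /eqP.
Qed.

Lemma eucl_dist_le x y r : 0 <= r ->
  (forall i, `|(tnth x i : R) - (tnth y i : R)| <= r) ->
  eucl_dist x y <= Num.sqrt N%:R * r.
Proof.
move=> r0 xyr; rewrite -{1}(ger0_norm r0) -sqrtr_sqr -sqrtrM ?ler0n// ler_wsqrtr//.
have -> : N%:R * r ^+ 2 = \sum_(i < N) r ^+ 2.
  by rewrite sumr_const card_ord mulr_natl.
apply: ler_sum => i _; by rewrite -[leLHS]real_normK ?num_real// lerXn2r ?nnegrE.
Qed.

Lemma eucl_dist_scaleN x y r : 0 <= r ->
  eucl_dist (scaleN r x) (scaleN r y) = r * eucl_dist x y.
Proof.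
move=> r0; rewrite /eucl_dist -[in RHS](ger0_norm r0) -sqrtr_sqr -sqrtrM ?sqr_ge0//.
congr Num.sqrt; rewrite mulr_sumr; apply: eq_bigr => i _.
by rewrite !tnth_mktuple -mulrBr exprMn.
Qed.

Lemma measurable_eucl_dist :
  measurable_fun setT (fun z : Rn R N * Rn R N => eucl_dist z.1 z.2).
Proof.
apply: (measurableT_comp (continuous_measurable_fun (@sqrt_continuous R))).
have h := @measurable_sum _ (Rn R N * Rn R N)%type R setT 'I_N (index_enum 'I_N)
  (fun i z => ((tnth z.1 i : R) - (tnth z.2 i : R)) ^+ 2).
apply: h => i; apply: (@measurable_funX _ _ _ setT (fun z : Rn R N * Rn R N =>
  (tnth z.1 i : R) - (tnth z.2 i : R))); apply: measurable_funB.
  exact: (measurableT_comp (measurable_tnth i) measurable_fst).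
exact: (measurableT_comp (measurable_tnth i) measurable_snd).
Qed.

Definition gkernel s u (z : Rn R N * Rn R N) : R :=
  `|u z.1 - u z.2| ^+ 2 / eucl_dist z.1 z.2 `^ (N%:R + 2 * s).

Lemma gkernel_ge0 s u z : 0 <= gkernel s u z.
Proof. by rewrite divr_ge0 ?exprn_ge0 ?powR_ge0. Qed.

Lemma measurable_gkernel s u : measurable_fun setT u ->
  measurable_fun setT (gkernel s u).
Proof.
move=> mu_; apply: measurable_funM.
  apply: measurable_funX; apply: measurableT_comp => //.
  apply: measurable_funB; exact: measurableT_comp.
apply: (@eq_measurable_fun _ _ _ _ setT
  (fun z => eucl_dist z.1 z.2 `^ (- (N%:R + 2 * s)))).
  by move=> z _; rewrite powRN.
apply: (@measurableT_comp _ _ _ _ _ _ (fun t : R => t `^ (- (N%:R + 2 * s)))).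
  exact: measurable_powR.
exact: measurable_eucl_dist.
Qed.

Lemma gagliardo2E s u : measurable_fun setT u ->
  gagliardo2 s u = (\int[mu]_x \int[mu]_y (gkernel s u (x, y))%:E)%E.
Proof.
move=> mu_; rewrite /gagliardo2 fubini_tonelli1//.
- by apply/measurable_EFinP; exact: measurable_gkernel.
- by move=> z; rewrite lee_fin; exact: gkernel_ge0.
Qed.

Lemma measurable_gkernel_section s u : measurable_fun setT u ->
  measurable_fun setT (fun x => \int[mu]_y (gkernel s u (x, y))%:E)%E.
Proof.
move=> mu_; apply: (measurable_fun_fubini_tonelli_F (EFin \o gkernel s u)).
  by apply/measurable_EFinP; exact: measurable_gkernel.
by move=> z; rewrite lee_fin; exact: gkernel_ge0.
Qed.

Lemma gagliardo2_ge0 s u : (0 <= gagliardo2 s u)%E.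
Proof. by apply: integral_ge0 => z _; rewrite lee_fin; exact: gkernel_ge0. Qed.

(** Closed balls of the sup norm: their measure comes from [lebesgueN_box], and they compare with
    Euclidean balls up to the factor sqrt N of [eucl_dist_le]. *)
Definition cube x r : set (Rn R N) :=
  [set y | forall i, (tnth y i : R) \in `[(tnth x i : R) - r, (tnth x i : R) + r]].

Lemma cubeP x r y :
  cube x r y <-> forall i, `|(tnth x i : R) - (tnth y i : R)| <= r.
Proof.
by split => h i; have := h i; rewrite in_itv/= -ler_distlC distrC.
Qed.

Lemma measurable_box (A : 'I_N -> set (measurableTypeR R)) :
  (forall i, measurable (A i)) ->
  measurable [set x : Rn R N | forall i, A i (tnth x i)].
Proof.
move=> mA; rewrite (_ : [set x | _] = \bigcap_i ((fun t : Rn R N => tnth t i) @^-1` A i)).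
  apply: fin_bigcap_measurable => // i _; rewrite -[X in measurable X]setTI.
  exact: measurable_tnth.
by apply/seteqP; split=> t /= At i => [_|]; exact: At.
Qed.

Lemma measurable_cube x r : measurable (cube x r).
Proof.
apply: (@measurable_box (fun i => `[(tnth x i : R) - r, (tnth x i : R) + r]%classic)).
by move=> i; exact: measurable_itv.
Qed.

Lemma lebesgueN_cube x r : 0 <= r -> mu (cube x r) = ((2 * r) ^+ N)%:E.
Proof.
move=> r0.
rewrite (lebesgueN_box (A := fun i => `[(tnth x i : R) - r, (tnth x i : R) + r]%classic)).
  transitivity (\prod_(i < N) (2 * r)%:E)%E.
    apply: eq_bigr => i _.
    rewrite lebesgue_measure_itv/= lte_fin; set t : R := tnth x i.
    case: ifPn => [_|]; first by rewrite -EFinB; congr EFin; ring.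
    rewrite -leNgt => h; have -> : r = 0 by lra.
    by rewrite mulr0.
  by rewrite prodEFin prodr_const card_ord.
by move=> i; exact: measurable_itv.
Qed.

End gagliardo.

Lemma gt0_powRD (R : realType) (x r s : R) : 0 < x ->
  x `^ (r + s) = x `^ r * x `^ s.
Proof. by move=> x0; rewrite powRD// (gt_eqF x0) implybT. Qed.

Section gagliardo_nirenberg.
Context {R : realType}.
Variables (N : nat) (s : R).
Hypotheses (s_gt0 : 0 < s) (N_gt0 : (0 < N)%N).
Implicit Types (x y : Rn R N) (u : Rn R N -> R) (r t K q : R).

Local Notation mu := (@lebesgueN R N).

Let N0 : 0 < N%:R :> R. Proof. by rewrite ltr0n. Qed.

Lemma measurable_normr_powR q u : measurable_fun setT u ->
  measurable_fun setT (fun x => `|u x| `^ q).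
Proof.
move=> mu_; apply: (measurableT_comp (measurable_powR q)).
exact: measurableT_comp.
Qed.

Lemma measurable_normr u : measurable_fun setT u ->
  measurable_fun setT (fun x => `|u x|).
Proof. by move=> mu_; exact: measurableT_comp. Qed.

Lemma chebyshev_powR q K t u : 0 < q -> 0 < K -> 0 < t -> measurable_fun setT u ->
  (\int[mu]_x (`|u x| `^ q)%:E <= K%:E)%E ->
  (mu [set x | (t <= `|u x|)%R] <= (K * t `^ (- q))%:E)%E.
Proof.
move=> q0 K0 t0 mu_ uK.
have mE : measurable [set x | t <= `|u x|].
  have := measurable_normr mu_ measurableT (measurable_itv `[t, +oo[).
  rewrite setTI; congr measurable.
  by apply/seteqP; split => x /=; rewrite in_itv/= andbT.
rewrite powRN EFinM lee_pdivlMr ?powR_gt0// muleC.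
apply: le_trans uK; apply: ge0_integral_ge_cst => //.
- by apply/measurable_EFinP; exact: measurable_normr_powR.
- exact: powR_ge0.
- by move=> x /= tx; rewrite lee_fin ge0_ler_powR// ?ltW// nnegrE ltW.
Qed.

(** The constant produced by [gkernel_section_ge]: 8 is 4, from the square of half the value, times
    2, from keeping half of the cube; the other factors come from the distance bound sqrt N * r and
    from the measure of the cube, where 2^(q+1) is twice the Chebyshev factor. *)
Definition GN_const q : R :=
  2 `^ (N%:R + 2 * s) / (8 * Num.sqrt N%:R `^ (N%:R + 2 * s)) *
  (2 `^ (q + 1)) `^ (- (2 * s / N%:R)).

Lemma GN_const_gt0 q : 0 < GN_const q.
Proof.
by rewrite mulr_gt0 ?powR_gt0// divr_gt0 ?powR_gt0 ?mulr_gt0 ?powR_gt0 ?sqrtr_gt0.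
Qed.

Lemma gkernel_section_ge q K u x : 0 < q -> 0 < K -> measurable_fun setT u ->
  (\int[mu]_x (`|u x| `^ q)%:E <= K%:E)%E ->
  ((GN_const q * (`|u x| `^ (2 + 2 * s * q / N%:R) * K `^ (- (2 * s / N%:R))))%:E
   <= \int[mu]_y (gkernel s u (x, y))%:E)%E.
Proof.
move=> q0 K0 mu_ uK.
have [ux0|ux0] := eqVneq (u x) 0.
  rewrite ux0 normr0 powR0 ?mul0r ?mulr0; last first.
    by rewrite gt_eqF// ltr_wpDr// divr_ge0 ?mulr_ge0// ltW.
  by apply: integral_ge0 => y _; rewrite lee_fin; exact: gkernel_ge0.
set t := `|u x|; have t0 : 0 < t by rewrite normr_gt0.
(* Chebyshev at height t/2 allows the measure K (t/2)^(-q) = 2^q K t^(-q); the cube gets twice as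
   much. *)
set V := 2 `^ (q + 1) * K * t `^ (- q).
have V0 : 0 < V by rewrite !mulr_gt0 ?powR_gt0.
set r := 2^-1 * V `^ N%:R^-1.
have r0 : 0 < r by rewrite mulr_gt0 ?powR_gt0.
have rV : (2 * r) ^+ N = V.
  rewrite /r mulrA divff// mul1r -powR_mulrn ?powR_ge0// -powRrM mulVf ?gt_eqF//.
  by rewrite powRr1// ltW.
set D := cube x r `&` [set y | `|u y| < t / 2].
have mu_lt : measurable [set y | `|u y| < t / 2].
  rewrite (_ : [set y | _] = (fun y => `|u y|) @^-1` `]-oo, (t / 2)[%classic).
    rewrite -[X in measurable X]setTI.
    exact: (measurable_normr mu_ measurableT (measurable_itv `]-oo, (t / 2)[)).
  by apply/seteqP; split => y /=; rewrite in_itv.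
have mD : measurable D by apply: measurableI => //; exact: measurable_cube.
have muD : ((V / 2)%:E <= mu D)%E.
  have E : cube x r `<=` D `|` [set y | t / 2 <= `|u y|].
    by move=> y xy; case: (ltP `|u y| (t / 2)) => h; [left|right].
  have mge : measurable [set y | t / 2 <= `|u y|].
    rewrite (_ : [set y | _] = ~` [set y | `|u y| < t / 2]); first exact: measurableC.
    by apply/seteqP; split => y /=; rewrite leNgt => /negP.
  have VD : (V%:E <= mu D + mu [set y | (t / 2 <= `|u y|)%R])%E.
    rewrite -rV -(lebesgueN_cube x (ltW r0)).
    have h := @measureU2 _ _ _ mu _ _ mD mge.
    apply: (le_trans _ h).
    by apply: le_measure E; rewrite inE; [exact: measurable_cube|exact: measurableU].
  have t20 : 0 < t / 2 by rewrite divr_gt0.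
  have := chebyshev_powR q0 K0 t20 mu_ uK.
  have -> : K * (t / 2) `^ (- q) = V / 2.
    have e1 : 2^-1 `^ (- q) = 2 `^ q :> R.
      by rewrite -powR_inv1// -powRrM mulN1r opprK.
    have e2 : 2 `^ (q + 1) = 2 `^ q * 2 :> R by rewrite gt0_powRD ?powRr1.
    by rewrite powRM ?invr_ge0 ?(ltW t0)// e1 /V e2; field.
  move=> /(leeD (lexx (mu D))) /(le_trans VD).
  by rewrite -leeBlDr// -EFinB; congr (_ <= _)%E; congr EFin; field.
set h := (t / 2) ^+ 2 / (Num.sqrt N%:R * r) `^ (N%:R + 2 * s).
have h0 : 0 <= h by rewrite divr_ge0 ?sqr_ge0 ?powR_ge0.
rewrite (_ : GN_const q * _ = h * (V / 2)); last first.
  rewrite /h powRM ?sqrtr_ge0 ?(ltW r0)// /r powRM ?powR_ge0//.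
  rewrite -powRrM (_ : N%:R^-1 * _ = 1 + 2 * s / N%:R); last first.
    by field; rewrite gt_eqF.
  rewrite (@gt0_powRD _ V)//.
  rewrite (powRr1 (ltW V0)) gt0_powRD//.
  have -> : 2^-1 `^ (N%:R + 2 * s) = (2 `^ (N%:R + 2 * s))^-1 :> R.
    by rewrite -powR_inv1// -powRrM mulN1r powRN.
  have EV : V `^ (2 * s / N%:R) = ((2 `^ (q + 1)) `^ (- (2 * s / N%:R)))^-1 *
      (K `^ (- (2 * s / N%:R)))^-1 * (t `^ (2 * s * q / N%:R))^-1.
    rewrite /V !powRM ?powR_ge0 ?mulr_ge0 ?powR_ge0 ?ltW//.
    rewrite -[t `^ _ `^ _]powRrM !powRN !invrK.
    by congr (_ * _); rewrite -powRN; congr (_ `^ _); ring.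
  rewrite EV /GN_const.
  rewrite (_ : t `^ 2 = t ^+ 2); last by rewrite -powR_mulrn// ltW.
  have gg (a b : R) : 0 < a -> a `^ b != 0 by move=> a0; rewrite gt_eqF// powR_gt0.
  by field; rewrite !gg ?gt_eqF ?powR_gt0 ?sqrtr_gt0//=.
apply: (@le_trans _ _ (h%:E * mu D)%E).
  by rewrite EFinM lee_wpmul2l ?lee_fin.
apply: ge0_integral_ge_cst => //.
- apply/measurable_EFinP.
  exact: (measurableT_comp (measurable_gkernel s mu_) (pair1_measurable x)).
- by move=> y; rewrite lee_fin; exact: gkernel_ge0.
- move=> y [/cubeP xy /= uy]; rewrite lee_fin /gkernel /h/=.
  (* On the diagonal the kernel takes the default value 0, so the lower bound holds only off it; the
     strict inequality defining [D] keeps [x] itself out. *)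
  have xNy : x != y by apply: contraTneq uy => <-; rewrite -/t -leNgt ler_pdivrMr//; lra.
  apply: ler_pM.
  + by rewrite exprn_ge0// divr_ge0// ltW.
  + by rewrite invr_ge0 powR_ge0.
  + rewrite lerXn2r ?nnegrE ?divr_ge0 ?(ltW t0)//.
    have := lerB_normD (u x) (- u y); rewrite normrN -/t; lra.
  + have Nr0 : 0 < Num.sqrt N%:R * r by rewrite mulr_gt0 ?sqrtr_gt0.
    rewrite lef_pV2 ?posrE ?powR_gt0 ?eucl_dist_gt0//.
    rewrite ge0_ler_powR ?nnegrE ?eucl_dist_ge0 ?(ltW Nr0)//.
      by rewrite addr_ge0 ?mulr_ge0 ?ler0n// ltW.
    by apply: eucl_dist_le => //; exact: ltW.
Qed.

(** Integration of the pointwise bound in x. Two exponents matter: q = 2 gives the mass-critical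
    exponent 2 + 4s/N, and q = 2N/(N-2s) is the fixed point of q |-> 2 + 2sq/N, which turns the
    inequality into Sobolev's. *)
Lemma gagliardo_nirenberg q K u : 0 < q -> 0 < K -> measurable_fun setT u ->
  (\int[mu]_x (`|u x| `^ q)%:E <= K%:E)%E ->
  (\int[mu]_x (`|u x| `^ (2 + 2 * s * q / N%:R))%:E <=
   ((GN_const q)^-1 * K `^ (2 * s / N%:R))%:E * gagliardo2 s u)%E.
Proof.
move=> q0 K0 mu_ uK.
set c := GN_const q * K `^ (- (2 * s / N%:R)).
have c0 : 0 < c by rewrite mulr_gt0 ?GN_const_gt0 ?powR_gt0.
have -> : (GN_const q)^-1 * K `^ (2 * s / N%:R) = c^-1.
  by rewrite [RHS]invfM [in RHS](powRN K) invrK.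
rewrite lee_pdivlMl ?invr_gt0// -ge0_integralZl//.
- rewrite gagliardo2E//; apply: ge0_le_integral => //.
  + by move=> x _; rewrite -EFinM lee_fin mulr_ge0 ?powR_ge0// ltW.
  + apply/measurable_EFinP; apply: measurable_funM => //.
    exact: measurable_normr_powR.
  + exact: measurable_gkernel_section.
  + move=> x _; apply: le_trans (gkernel_section_ge x q0 K0 mu_ uK).
    by rewrite -EFinM lee_fin /c mulrAC -mulrA.
- by apply/measurable_EFinP; exact: measurable_normr_powR.
- by rewrite lee_fin ltW.
Qed.

End gagliardo_nirenberg.

Lemma ler_dist_minl (R : realDomainType) (a b c : R) :
  `|Num.min a c - Num.min b c| <= `|a - b|.
Proof.
have := ler_norm (a - b); have := ler_norm (b - a); rewrite distrC.
by case: (leP a c); case: (leP b c) => *; rewrite ler_norml; apply/andP; split; lra.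
Qed.

Section fractional_sobolev.
Context {R : realType}.
Variables (N : nat) (s : R).
Hypotheses (s_gt0 : 0 < s) (N_gt0 : (0 < N)%N) (N_gt2s : 2 * s < N%:R).
Implicit Types (x y : Rn R N) (u : Rn R N -> R).

Local Notation mu := (@lebesgueN R N).
Local Notation q := (2 * N%:R / (N%:R - 2 * s)).

Let N0 : 0 < N%:R :> R. Proof. by rewrite ltr0n. Qed.
Let N2s0 : 0 < N%:R - 2 * s. Proof. by rewrite subr_gt0. Qed.

Lemma crit_exp_gt2 : 2 < q.
Proof. by rewrite ltr_pdivlMr// mulrBr gtrBl mulr_gt0// mulr_gt0. Qed.

Lemma crit_exp_gt0 : 0 < q.
Proof. exact: lt_trans crit_exp_gt2. Qed.

Definition truncation (n : nat) u x : R := Num.min `|u x| n%:R.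

Lemma truncation_ge0 n u x : 0 <= truncation n u x.
Proof. by rewrite le_min normr_ge0 ler0n. Qed.

Lemma measurable_truncation n u : measurable_fun setT u ->
  measurable_fun setT (truncation n u).
Proof.
by move=> mu_; apply: measurable_minr => //; exact: measurable_normr.
Qed.

Lemma gagliardo2_truncation n u : measurable_fun setT u ->
  (gagliardo2 s (truncation n u) <= gagliardo2 s u)%E.
Proof.
move=> mu_; apply: ge0_le_integral => //.
- by move=> z _; rewrite lee_fin; exact: gkernel_ge0.
- apply/measurable_EFinP; apply: measurable_gkernel.
  exact: measurable_truncation.
- by apply/measurable_EFinP; exact: measurable_gkernel.
- move=> z _; rewrite lee_fin ler_wpM2r ?invr_ge0 ?powR_ge0//.
  rewrite lerXn2r ?nnegrE//; apply: le_trans (ler_dist_dist _ _).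
  exact: ler_dist_minl.
Qed.

(** At the critical exponent [gagliardo_nirenberg] reads K <= C K^(2s/N) A with the same integral K
    on both sides; as 2s/N < 1, K can be absorbed once it is known to be finite. Truncations make it
    finite, being bounded and square integrable, and do not raise the seminorm; monotone convergence
    removes them. *)
Lemma sobolev u (A : R) : measurable_fun setT u ->
  (\int[mu]_x (`|u x| ^+ 2)%:E < +oo)%E -> 0 <= A ->
  (gagliardo2 s u <= A%:E)%E ->
  (\int[mu]_x (`|u x| `^ q)%:E <= (((GN_const N s q)^-1 * A) `^ (q / 2))%:E)%E.
Proof.
move=> mu_ u2 A0 uA; set C := (GN_const N s q)^-1.
have C0 : 0 < C by rewrite invr_gt0 GN_const_gt0.
have q0 := crit_exp_gt0.
have mt n : measurable_fun setT (fun x => (`|truncation n u x| `^ q)%:E).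
  apply/measurable_EFinP; apply: measurable_normr_powR.
  exact: measurable_truncation.
have bound n : (\int[mu]_x (`|truncation n u x| `^ q)%:E <= ((C * A) `^ (q / 2))%:E)%E.
  have K0 : (0 <= \int[mu]_x (`|truncation n u x| `^ q)%:E)%E.
    by apply: integral_ge0 => x _; rewrite lee_fin powR_ge0.
  have Kfin : (\int[mu]_x (`|truncation n u x| `^ q)%:E < +oo)%E.
    apply: (@le_lt_trans _ _ ((n%:R `^ (q - 2))%:E * \int[mu]_x (`|u x| ^+ 2)%:E)%E).
      rewrite -ge0_integralZl//.
      - apply: ge0_le_integral => //.
          apply/measurable_EFinP; apply: measurable_funM => //.
          apply: measurable_funX; exact: measurable_normr.
        move=> x _; rewrite -EFinM lee_fin ger0_norm ?truncation_ge0//.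
        have -> : q = (q - 2) + 2 by rewrite subrK.
        have [->|t0] := eqVneq (truncation n u x) 0.
          by rewrite powR0 ?subrK ?gt_eqF// mulr_ge0 ?powR_ge0 ?sqr_ge0.
        have {}t0 : 0 < truncation n u x by rewrite lt_neqAle eq_sym t0 truncation_ge0.
        rewrite gt0_powRD// addrK.
        apply: ler_pM; rewrite ?powR_ge0//.
          rewrite ge0_ler_powR ?nnegrE ?ler0n ?(ltW t0)//.
            by rewrite subr_ge0 ltW// crit_exp_gt2.
          by rewrite ge_min lexx orbT.
        rewrite powR_mulrn ?(ltW t0)// lerXn2r ?nnegrE ?(ltW t0)//.
        by rewrite ge_min lexx.
      - apply/measurable_EFinP; apply: measurable_funX; exact: measurable_normr.
    by rewrite lte_mul_pinfty// lee_fin powR_ge0.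
  have [K KE] : exists K : R, (\int[mu]_x (`|truncation n u x| `^ q)%:E = K%:E)%E.
    by exists (fine (\int[mu]_x (`|truncation n u x| `^ q)%:E)); rewrite fineK// ge0_fin_numE.
  move: K0; rewrite KE lee_fin le_eqVlt => /predU1P[<-|K0]; first by rewrite lee_fin powR_ge0.
  have := gagliardo_nirenberg s_gt0 N_gt0 q0 K0 (measurable_truncation n mu_).
  rewrite KE => /(_ (lexx _)).
  have -> : 2 + 2 * s * q / N%:R = q by field; rewrite !gt_eqF.
  rewrite KE => h.
  have {}h : K <= C * K `^ (2 * s / N%:R) * A.
    rewrite -lee_fin (EFinM (C * _)); apply: (le_trans h).
    rewrite lee_pmul2l ?fin_numE//; last by rewrite lte_fin mulr_gt0// powR_gt0.
    exact: le_trans (gagliardo2_truncation n mu_) uA.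
  rewrite lee_fin.
  have e1 : K `^ (1 - 2 * s / N%:R) <= C * A.
    rewrite gt0_powRD// powRr1 ?(ltW K0)// powRN ler_pdivrMr ?powR_gt0//.
    by rewrite mulrAC.
  have -> : K = (K `^ (1 - 2 * s / N%:R)) `^ (q / 2).
    rewrite -powRrM (_ : (1 - _) * _ = 1) ?powRr1 ?(ltW K0)//.
    by field; rewrite !gt_eqF.
  have q20 : 0 <= q / 2 by rewrite divr_ge0// ltW.
  by apply: ge0_ler_powR => //; rewrite nnegrE ?powR_ge0 ?mulr_ge0 ?(ltW C0).
have ndt x : nondecreasing_seq (fun n => (`|truncation n u x| `^ q)%:E).
  move=> m n mn; rewrite lee_fin ge0_ler_powR ?nnegrE ?(ltW q0)//.
  rewrite !ger0_norm ?truncation_ge0// le_min ge_min lexx/=.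
  by rewrite ge_min ler_nat mn orbT.
have lim x : limn (fun n => (`|truncation n u x| `^ q)%:E) = (`|u x| `^ q)%:E.
  apply: lim_near_cst => //.
  near=> n; rewrite /truncation.
  have /min_idPl -> : `|u x| <= n%:R.
    by near: n; exact: nbhs_infty_ger.
  by rewrite normr_id.
under eq_integral do rewrite -lim.
rewrite monotone_convergence//.
apply: lime_le; last by apply: nearW => n; exact: bound.
apply: ereal_nondecreasing_is_cvgn => m n mn; apply: ge0_le_integral => //.
by move=> x _; exact: ndt.
Unshelve. all: by end_near. Qed.

End fractional_sobolev.

(** * Functionals on H^s and their rescalings *)

Section Hs_functionals.
Context {R : realType}.
Variables (N : nat) (s : R).
Hypotheses (s_gt0 : 0 < s) (N_gt0 : (0 < N)%N) (N_gt2s : 2 * s < N%:R).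
Implicit Types (x y : Rn R N) (u : Rn R N -> R) (G : R -> R) (c r : R).

Local Notation mu := (@lebesgueN R N).
Local Notation q := (2 * N%:R / (N%:R - 2 * s)).

Let N0 : 0 < N%:R :> R. Proof. by rewrite ltr0n. Qed.
Let N2s0 : 0 < N%:R - 2 * s. Proof. by rewrite subr_gt0. Qed.

Lemma HsP u : Hs s u <-> [/\ measurable_fun setT u,
  (\int[mu]_x (`|u x| ^+ 2)%:E < +oo)%E & (gagliardo2 s u < +oo)%E].
Proof.
have e2 x : (`|u x| ^+ 2)%:E = (`|u x| `^ 2)%:E by rewrite powR_mulrn.
split=> [[u2 gu]|[mu_ u2 gu]]; split => //.
- by move: u2; rewrite inE => /andP[]; rewrite inE.
- have := Lfun_integrable (ler1n R 2) u2.
  move=> /integrableP[_]; apply: le_lt_trans.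
  apply: ge0_le_integral => //=.
  + apply/measurable_EFinP; apply: measurable_funX; apply: measurable_normr.
    by move: u2; rewrite inE => /andP[]; rewrite inE.
  + apply/measurable_EFinP; apply: measurableT_comp => //.
    apply: measurable_normr_powR.
    by move: u2; rewrite inE => /andP[]; rewrite inE.
  + by move=> x _; rewrite lee_fin -powR_mulrn// ler_norm.
- rewrite inE; apply/andP; split; rewrite inE//=.
  rewrite /finite_norm unlock /=; apply: poweR_lty.
  apply: le_lt_trans u2; rewrite le_eqVlt; apply/orP; left; apply/eqP.
  by apply: eq_integral => x _; rewrite e2 -poweR_EFin.
Qed.

Definition mass u : R := fine (\int[mu]_x (`|u x| ^+ 2)%:E)%E.
Definition seminorm2 u : R := fine (gagliardo2 s u).
Definition itg G u : R := Rintegral mu setT (G \o u).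

Lemma EFin_mass u : Hs s u -> (\int[mu]_x (`|u x| ^+ 2)%:E)%E = (mass u)%:E.
Proof.
move=> /HsP[_ u2 _]; rewrite /mass fineK// ge0_fin_numE//.
by apply: integral_ge0 => x _; rewrite lee_fin exprn_ge0.
Qed.

Lemma EFin_seminorm2 u : Hs s u -> gagliardo2 s u = (seminorm2 u)%:E.
Proof. by move=> /HsP[_ _ gu]; rewrite /seminorm2 fineK// ge0_fin_numE// gagliardo2_ge0. Qed.

Lemma seminorm2_ge0 u : 0 <= seminorm2 u.
Proof. by apply: fine_ge0; exact: gagliardo2_ge0. Qed.

(** The class of nonlinearities for which [itg G u] is a genuine integral on all of H^s, rather than
    a default value: the square is integrable by definition and the critical power by Sobolev's
    inequality. *)
Definition growth G := measurable_fun setT G /\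
  exists2 C : R, 0 <= C & forall t, `|G t| <= C * (`|t| ^+ 2 + `|t| `^ q).

Lemma measurable_growth G u : growth G -> measurable_fun setT u ->
  measurable_fun setT (fun x => G (u x)).
Proof. by move=> [mG _] mu_; exact: (measurableT_comp mG). Qed.

Lemma growth_integrable G u : Hs s u -> growth G ->
  mu.-integrable setT (EFin \o (G \o u)).
Proof.
move=> Hu gG; have [mG [C C0 GC]] := gG; have [mu_ u2 gu] := (HsP u).1 Hu.
have uq : (\int[mu]_x (`|u x| `^ q)%:E < +oo)%E.
  apply: le_lt_trans (sobolev s_gt0 N_gt0 N_gt2s mu_ u2 (seminorm2_ge0 u) _) _.
    by rewrite EFin_seminorm2.
  exact: ltry.
apply/integrableP; split.
  by apply/measurable_EFinP; exact: (measurableT_comp mG).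
apply: (@le_lt_trans _ _
  (C%:E * (\int[mu]_x (`|u x| ^+ 2)%:E + \int[mu]_x (`|u x| `^ q)%:E))%E).
  have m2 : measurable_fun setT (fun x => (`|u x| ^+ 2)%:E).
    by apply/measurable_EFinP; apply: measurable_funX; exact: measurable_normr.
  have mq : measurable_fun setT (fun x => (`|u x| `^ q)%:E).
    by apply/measurable_EFinP; exact: measurable_normr_powR.
  rewrite -ge0_integralD//.
  rewrite -ge0_integralZl//; last 2 first.
    exact: emeasurable_funD.
    by move=> x _; rewrite adde_ge0// lee_fin ?exprn_ge0 ?powR_ge0.
  apply: ge0_le_integral => //.
  - apply: measurableT_comp => //; apply/measurable_EFinP.
    exact: (measurableT_comp mG mu_).
  - by apply: measurable_funeM; exact: emeasurable_funD.
  - by move=> x _; rewrite -EFinD -EFinM lee_fin; exact: GC.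
by apply: lte_mul_pinfty => //; rewrite ?lee_fin// lte_add_pinfty.
Qed.

Lemma EFin_itg G u : Hs s u -> growth G ->
  (\int[mu]_x (G (u x))%:E)%E = (itg G u)%:E.
Proof.
move=> Hu gG; rewrite /itg /Rintegral fineK//.
exact: (integrable_fin_num _ (growth_integrable Hu gG)).
Qed.

Lemma growth_le C G1 G2 : measurable_fun setT G1 -> growth G2 ->
  (forall t, `|G1 t| <= C * `|G2 t|) -> growth G1.
Proof.
move=> m1 [m2 [D D0 GD]] GC; split => //.
exists (`|C| * D); first by rewrite mulr_ge0.
move=> t; rewrite -(mulrA `|C| D).
apply: (le_trans (GC t)); apply: (@le_trans _ _ (`|C| * `|G2 t|)); last first.
  by rewrite ler_wpM2l.
by rewrite ler_wpM2r// ler_norm.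
Qed.

Lemma growth_powR e : 2 <= e -> e <= q -> growth (fun t => `|t| `^ e).
Proof.
move=> e2 eq; split.
  apply: (measurableT_comp (measurable_powR e)); exact: normr_measurable.
exists 1 => // t; rewrite mul1r ger0_norm ?powR_ge0//.
have [t1|t1] := leP `|t| 1; last first.
  by rewrite (le_trans (ler_powR (ltW t1) eq))// lerDr exprn_ge0.
have [->|t0] := eqVneq t 0.
  by rewrite normr0 powR0 ?addr_ge0 ?exprn_ge0 ?powR_ge0// gt_eqF// (lt_le_trans _ e2).
rewrite -powR_mulrn// (le_trans (ger_powR _ e2)) ?normr_gt0 ?t0//.
by rewrite lerDl powR_ge0.
Qed.

Lemma growthD G1 G2 : growth G1 -> growth G2 -> growth (fun t => G1 t + G2 t).
Proof.
move=> [m1 [C C0 GC]] [m2 [D D0 GD]]; split; first exact: measurable_funD.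
exists (C + D); first exact: addr_ge0.
by move=> t; rewrite mulrDl (le_trans (ler_normD _ _))// lerD.
Qed.

Lemma growthZ c G : growth G -> growth (fun t => c * G t).
Proof.
move=> [m1 [C C0 GC]]; split; first exact: measurable_funM.
exists (`|c| * C); first exact: mulr_ge0.
by move=> t; rewrite normrM -(mulrA `|c| C) ler_wpM2l.
Qed.

Lemma growth_comp c G : growth G -> growth (fun t => G (c * t)).
Proof.
move=> [m1 [C C0 GC]]; split.
  by apply: (measurableT_comp m1); exact: mulrl_measurable.
exists (C * (`|c| ^+ 2 + `|c| `^ q)).
  by rewrite mulr_ge0// addr_ge0 ?exprn_ge0 ?powR_ge0.
move=> t; rewrite -(mulrA C) (le_trans (GC _))// ler_wpM2l// normrM.
rewrite powRM// exprMn.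
have := mulr_ge0 (exprn_ge0 2 (normr_ge0 c)) (powR_ge0 `|t| q).
have := mulr_ge0 (powR_ge0 `|c| q) (exprn_ge0 2 (normr_ge0 t)).
by lra.
Qed.

Lemma ler_itg G1 G2 u : Hs s u -> growth G1 -> growth G2 ->
  (forall t, G1 t <= G2 t) -> itg G1 u <= itg G2 u.
Proof.
move=> Hu g1 g2 G12; apply: le_Rintegral => //; exact: growth_integrable.
Qed.

Lemma itg_ge0 G u : (forall t, 0 <= G t) -> 0 <= itg G u.
Proof. by move=> G0; apply: Rintegral_ge0. Qed.

Lemma itgD G1 G2 u : Hs s u -> growth G1 -> growth G2 ->
  itg (fun t => G1 t + G2 t) u = itg G1 u + itg G2 u.
Proof. by move=> Hu g1 g2; apply: RintegralD => //; exact: growth_integrable. Qed.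

Lemma itgB G1 G2 u : Hs s u -> growth G1 -> growth G2 ->
  itg (fun t => G1 t - G2 t) u = itg G1 u - itg G2 u.
Proof. by move=> Hu g1 g2; apply: RintegralB => //; exact: growth_integrable. Qed.

Lemma itgZ c G u : Hs s u -> growth G -> itg (fun t => c * G t) u = c * itg G u.
Proof. by move=> Hu g; apply: RintegralZl => //; exact: growth_integrable. Qed.

Lemma itg_gt0 G u : Hs s u -> growth G -> (forall t, 0 <= G t) ->
  (forall t, t != 0 -> 0 < G t) -> 0 < mass u -> 0 < itg G u.
Proof.
move=> Hu gG G0 Gpos mu0; have [mu_ u2 gu] := (HsP u).1 Hu.
rewrite lt_neqAle itg_ge0// andbT; apply: contraTneq mu0 => G0'.
rewrite -leNgt /mass.
have mG : measurable_fun setT (fun x => (G (u x))%:E).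
  by apply/measurable_EFinP; exact: measurable_growth.
have : (\int[mu]_x `|(G (u x))%:E| = 0)%E.
  under eq_integral do rewrite gee0_abs ?lee_fin//.
  by rewrite (EFin_itg Hu gG) -G0'.
move=> /(ae_eq_integral_abs mu measurableT mG) Gae.
rewrite (ae_eq_integral (cst 0%E)) ?integral0//.
  by apply/measurable_EFinP; apply: measurable_funX; exact: measurable_normr.
apply: filterS Gae => x /(_ Logic.I) [] /eqP Gux _ /=.
have [->|ux] := eqVneq (u x) 0; first by rewrite normr0 expr0n.
by move: Gux; rewrite gt_eqF// Gpos.
Qed.

Lemma itg_crit_le u : Hs s u ->
  itg (fun t => `|t| `^ q) u <= ((GN_const N s q)^-1 * seminorm2 u) `^ (q / 2).
Proof.
move=> Hu; have [mu_ u2 gu] := (HsP u).1 Hu.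
rewrite -lee_fin -EFin_itg//; last first.
  by apply: growth_powR => //; rewrite ltW// crit_exp_gt2.
apply: sobolev => //; first exact: seminorm2_ge0.
by rewrite EFin_seminorm2.
Qed.

(** By Sobolev's inequality a vanishing seminorm kills the critical integral, which is positive when
    the mass is. *)
Lemma seminorm2_gt0 u : Hs s u -> 0 < mass u -> 0 < seminorm2 u.
Proof.
move=> Hu u0; rewrite lt_neqAle seminorm2_ge0 andbT.
have q2 := crit_exp_gt2 s_gt0 N_gt2s.
have gq : growth (fun t => `|t| `^ q) by apply: growth_powR => //; rewrite ltW.
have : 0 < itg (fun t => `|t| `^ q) u.
  apply: itg_gt0 => // t.
  by move=> t0; rewrite powR_gt0 ?normr_gt0.
apply: contraTneq => u20; rewrite -leNgt; have := itg_crit_le Hu.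
by rewrite -u20 mulr0 powR0// gt_eqF// divr_gt0// (lt_trans _ q2).
Qed.

Lemma itg_mass_le u : Hs s u -> 0 < mass u ->
  itg (fun t => `|t| `^ (2 + 4 * s / N%:R)) u <=
  (GN_const N s 2)^-1 * mass u `^ (2 * s / N%:R) * seminorm2 u.
Proof.
move=> Hu m0; have [mu_ u2 gu] := (HsP u).1 Hu.
have g2 : 2 + 4 * s / N%:R <= q.
  rewrite -subr_ge0 (_ : _ - _ = 8 * s ^+ 2 / (N%:R * (N%:R - 2 * s))).
    apply: divr_ge0; last exact: mulr_ge0 (ltW N0) (ltW N2s0).
    by rewrite mulr_ge0// sqr_ge0.
  by field; rewrite !gt_eqF.
rewrite -lee_fin -EFin_itg//; last first.
  apply: growth_powR => //; rewrite lerDl divr_ge0 ?mulr_ge0// ltW//.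
rewrite (EFinM (_ * _)) -EFin_seminorm2//.
have -> : 2 + 4 * s / N%:R = 2 + 2 * s * 2 / N%:R by congr (_ + _); ring.
apply: gagliardo_nirenberg => //.
under eq_integral => x _ do rewrite powR_mulrn//.
by rewrite EFin_mass.
Qed.

(** One two-parameter family contains the fibers, the dilations and the rescalings that preserve the
    seminorm, so that they compose by [rescale_comp]. *)
Definition rescale c r u : Rn R N -> R := fun x => c * u (scaleN r^-1 x).

Lemma rescale_comp c c' r r' u : rescale c r (rescale c' r' u) = rescale (c * c') (r * r') u.
Proof.
by apply/funext => x; rewrite /rescale scaleNA mulrA [r'^-1 * _]mulrC -invfM.
Qed.

Lemma rescale1 u : rescale 1 1 u = u.
Proof. by apply/funext => x; rewrite /rescale invr1 scaleN1 mul1r. Qed.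

Lemma measurable_rescale c r u : measurable_fun setT u ->
  measurable_fun setT (rescale c r u).
Proof.
move=> mu_; apply: measurable_funM => //.
by apply: measurableT_comp => //; exact: measurable_scaleN.
Qed.

Lemma ge0_integral_rescale G c r u : 0 < r -> measurable_fun setT G ->
  measurable_fun setT u -> (forall t, 0 <= G t) ->
  (\int[mu]_x (G (rescale c r u x))%:E =
   (r ^+ N)%:E * \int[mu]_x (G (c * u x))%:E)%E.
Proof.
move=> r0 mG mu_ G0; rewrite (ge0_integral_scaleN r0).
- congr (_ * _)%E; apply: eq_integral => x _.
  by rewrite /rescale scaleNA mulVf ?gt_eqF// scaleN1.
- apply/measurable_EFinP; apply: (measurableT_comp mG).
  exact: measurable_rescale.
- by move=> x; rewrite lee_fin.
Qed.

(** Each of the two changes of variables contributes r^N, and the kernel contributes r^(-(N+2s)). *)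
Lemma gagliardo2_rescale c r u : 0 < r -> measurable_fun setT u ->
  gagliardo2 s (rescale c r u) = ((c ^+ 2 * r `^ (N%:R - 2 * s))%:E * gagliardo2 s u)%E.
Proof.
move=> r0 mu_; have mv := measurable_rescale c r mu_.
set e := N%:R + 2 * s.
have gE x y : gkernel s (rescale c r u) (scaleN r x, scaleN r y) =
    c ^+ 2 * r `^ (- e) * gkernel s u (x, y).
  rewrite /gkernel /rescale /= !scaleNA mulVf ?gt_eqF// !scaleN1.
  rewrite eucl_dist_scaleN ?(ltW r0)// powRM ?(ltW r0) ?eucl_dist_ge0//.
  by rewrite -mulrBr normrM exprMn real_normK ?num_real// powRN invfM -/e; ring.
rewrite !gagliardo2E//.
rewrite (ge0_integral_scaleN r0); last 2 first.
  exact: measurable_gkernel_section.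
  by move=> x; apply: integral_ge0 => y _; rewrite lee_fin gkernel_ge0.
have k0 : 0 <= c ^+ 2 * r `^ (- e) by rewrite mulr_ge0 ?sqr_ge0 ?powR_ge0.
transitivity ((r ^+ N)%:E * \int[mu]_x
  (((r ^+ N) * (c ^+ 2 * r `^ (- e)))%:E * \int[mu]_y (gkernel s u (x, y))%:E))%E.
  congr (_ * _)%E; apply: eq_integral => x _.
  rewrite (ge0_integral_scaleN r0); last 2 first.
    apply/measurable_EFinP.
    exact: (measurableT_comp (measurable_gkernel s mv) (pair1_measurable _)).
    by move=> y; rewrite lee_fin gkernel_ge0.
  rewrite EFinM -muleA; congr (_ * _)%E; rewrite -ge0_integralZl//.
  - by apply: eq_integral => y _; rewrite gE EFinM.
  - apply/measurable_EFinP.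
    exact: (measurableT_comp (measurable_gkernel s mu_) (pair1_measurable _)).
  - by move=> y _; rewrite lee_fin gkernel_ge0.
rewrite ge0_integralZl//; last 3 first.
- exact: measurable_gkernel_section.
- by move=> x _; apply: integral_ge0 => y _; rewrite lee_fin gkernel_ge0.
- by rewrite lee_fin mulr_ge0// exprn_ge0// ltW.
rewrite muleA -EFinM; congr (_%:E * _)%E.
have -> : N%:R - 2 * s = N%:R + (N%:R + - e) by rewrite /e; ring.
by rewrite !gt0_powRD// powR_mulrn ?(ltW r0)//; ring.
Qed.

Lemma Hs_rescale c r u : 0 < r -> Hs s u -> Hs s (rescale c r u).
Proof.
move=> r0 Hu; have [mu_ u2 gu] := (HsP u).1 Hu; apply/HsP; split.
- exact: measurable_rescale.
- rewrite (ge0_integral_rescale (G := fun t => `|t| ^+ 2))//; last first.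
    by apply: measurable_funX; exact: normr_measurable.
  under eq_integral do rewrite normrM exprMn EFinM.
  rewrite ge0_integralZl//; last first.
    by apply/measurable_EFinP; apply: measurable_funX; exact: measurable_normr.
  by rewrite EFin_mass// -!EFinM ltry.
- by rewrite gagliardo2_rescale// EFin_seminorm2// -EFinM ltry.
Qed.

Lemma mass_rescale c r u : 0 < r -> Hs s u ->
  mass (rescale c r u) = c ^+ 2 * r ^+ N * mass u.
Proof.
move=> r0 Hu; have [mu_ u2 gu] := (HsP u).1 Hu; apply: EFin_inj.
rewrite -EFin_mass; last exact: Hs_rescale.
rewrite (ge0_integral_rescale (G := fun t => `|t| ^+ 2))//; last first.
  by apply: measurable_funX; exact: normr_measurable.
under eq_integral do rewrite normrM exprMn EFinM.
rewrite ge0_integralZl//; last first.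
  by apply/measurable_EFinP; apply: measurable_funX; exact: measurable_normr.
by rewrite EFin_mass// -!EFinM real_normK ?num_real//; congr EFin; ring.
Qed.

Lemma seminorm2_rescale c r u : 0 < r -> Hs s u ->
  seminorm2 (rescale c r u) = c ^+ 2 * r `^ (N%:R - 2 * s) * seminorm2 u.
Proof.
move=> r0 Hu; have [mu_ u2 gu] := (HsP u).1 Hu; apply: EFin_inj.
rewrite -EFin_seminorm2; last exact: Hs_rescale.
by rewrite gagliardo2_rescale// EFin_seminorm2// -EFinM.
Qed.

Lemma itg_rescale G c r u : 0 < r -> Hs s u -> growth G -> (forall t, 0 <= G t) ->
  itg G (rescale c r u) = r ^+ N * itg (fun t => G (c * t)) u.
Proof.
move=> r0 Hu gG G0; have [mu_ u2 gu] := (HsP u).1 Hu; apply: EFin_inj.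
rewrite -EFin_itg//; last exact: Hs_rescale.
rewrite (ge0_integral_rescale c r0 gG.1 mu_ G0).
by rewrite (EFin_itg (G := fun t => G (c * t)) Hu)//; exact: growth_comp.
Qed.

End Hs_functionals.

(** * A test function *)

Section geometric_bound.
Context d (T : measurableType d) (R : realType).
Variable mu : {measure set T -> \bar R}.

(** Dyadic summation. The sets [D k] may overlap: on [A] the function [g] lies below the sum of all
    the [c k] times the indicators of [D k], and this sum is integrated term by term. *)
Lemma integral_le_geometric (A : set T) (D : nat -> set T) (g : T -> R)
    (c : nat -> R) (a z : R) :
  measurable A -> (forall k, measurable (D k)) -> measurable_fun setT g ->
  (forall x, 0 <= g x) -> (forall k, 0 <= c k) -> 0 <= a -> 0 <= z < 1 ->
  (forall k, ((c k)%:E * mu (D k) <= (a * z ^+ k)%:E)%E) ->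
  (forall x, A x -> exists k, D k x /\ g x <= c k) ->
  (\int[mu]_(x in A) (g x)%:E <= (a / (1 - z))%:E)%E.
Proof.
move=> mA mD mg g0 c0 a0 /andP[z0 z1] cD gc.
have mI k : measurable_fun A (fun x => (c k * \1_(D k) x)%:E).
  by apply/measurable_EFinP; apply: measurable_funM.
have I0 k x : (0 <= (c k * \1_(D k) x)%:E)%E by rewrite lee_fin mulr_ge0.
apply: (@le_trans _ _ (\int[mu]_(x in A) \sum_(k <oo) (c k * \1_(D k) x)%:E)%E).
  apply: ge0_le_integral => //.
  - by move=> x _; rewrite lee_fin.
  - by apply/measurable_EFinP; exact: measurable_funTS.
  - by apply: ge0_emeasurable_sum.
  - move=> x /gc[k [Dk gk]]; apply: (@le_trans _ _ (c k * \1_(D k) x)%:E).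
      by rewrite indicE mem_set// mulr1 lee_fin.
    apply: (@le_trans _ _ (\sum_(0 <= i < k.+1) (c i * \1_(D i) x)%:E)%E).
      by rewrite big_nat_recr//= leeDr// sume_ge0.
    exact: nneseries_lim_ge.
rewrite integral_nneseries//.
apply: (@le_trans _ _ (\sum_(k <oo) (a * z ^+ k)%:E)%E).
  have ge0 k : (0 <= \int[mu]_(x in A) (c k * \1_(D k) x)%:E)%E.
    exact: integral_ge0.
  apply: lee_nneseries => // k _.
  under eq_integral do rewrite EFinM.
  rewrite ge0_integralZl//; last 2 first.
    by apply/measurable_EFinP; exact: measurable_indic.
    by rewrite lee_fin.
  rewrite integral_indic//; apply: le_trans (cD k); rewrite lee_wpmul2l ?lee_fin//.
  by apply: le_measure; rewrite ?inE//; exact: measurableI.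
apply: lime_le; first by apply: is_cvg_nneseries => k _ _; rewrite lee_fin mulr_ge0 ?exprn_ge0.
apply: nearW => n; rewrite sumEFin lee_fin.
have := @geometric_seriesE _ a z; rewrite lt_eqF// => /(_ isT) /(congr1 (fun h => h n)).
rewrite /series/= => ->; rewrite ler_pM2r ?invr_gt0 ?subr_gt0//.
by rewrite ler_piMr// gerBl exprn_ge0.
Qed.

End geometric_bound.

Lemma ex_dyadic_small {R : realType} (r : R) : 0 < r -> r <= 1 ->
  exists k, 2^-1 ^+ k / 2 < r /\ r <= 2^-1 ^+ k.
Proof.
move=> r0 r1.
have ex : exists k, 2^-1 ^+ k / 2 < r.
  have z1 : `|2^-1| < 1 :> R by rewrite ger0_norm// invf_lt1// ltr1n.
  have /cvgrPdist_lt /(_ r r0) [k _ /(_ k (leqnn k))] := cvg_geometric (2^-1) z1.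
  rewrite sub0r normrN ger0_norm; last by rewrite mulr_ge0 ?exprn_ge0.
  by rewrite /= mulrC => h; exists k.
exists (ex_minn ex); case: ex_minnP => -[|k] h min.
  by rewrite expr0; split => //; move: h; rewrite expr0.
split => //; rewrite leNgt; apply/negP => h2.
have hk : 2^-1 ^+ k / 2 < r by rewrite -exprSr.
by have := min k hk; rewrite ltnn.
Qed.

Lemma ex_dyadic_large {R : realType} (r : R) : 1 < r ->
  exists k, 2 ^+ k <= r /\ r <= 2 * 2 ^+ k.
Proof.
move=> r1; have r0 : 0 < r by rewrite (lt_trans ltr01).
have rV0 : 0 < r^-1 by rewrite invr_gt0.
have rV1 : r^-1 <= 1 by rewrite invf_le1// ltW.
have [k [k1 k2]] := ex_dyadic_small rV0 rV1; exists k; split.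
  by rewrite -[leRHS]invrK -[leLHS]invrK lef_pV2 ?posrE ?invr_gt0 ?exprn_gt0// -exprVn.
have : r < (2^-1 ^+ k / 2)^-1.
  by rewrite -[ltLHS]invrK ltf_pV2 ?posrE// divr_gt0// exprn_gt0// invr_gt0.
by rewrite invf_div exprVn invrK => /ltW.
Qed.

Section tent.
Context {R : realType}.
Variables (N : nat) (s : R).
Hypotheses (s_gt0 : 0 < s) (s_lt1 : s < 1) (N_gt0 : (0 < N)%N).
Implicit Types (x y : Rn R N).

Local Notation mu := (@lebesgueN R N).
Local Notation e := (N%:R + 2 * s).

Let N0 : 0 < N%:R :> R. Proof. by rewrite ltr0n. Qed.
Let e0 : 0 < e. Proof. by rewrite addr_gt0// mulr_gt0. Qed.

Definition l1norm x : R := \sum_(i < N) `|(tnth x i : R)|.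

(** A Lipschitz bump of values in [0, 1], supported in a cube. The bound by 1 makes c * tent
    uniformly small for small c, which is how the behavior of F at 0 enters the limit at
    infinity. *)
Definition tent x : R := Num.max 0 (1 - l1norm x).

Lemma tent_ge0 x : 0 <= tent x.
Proof. by rewrite le_max lexx. Qed.

Lemma tent_le1 x : tent x <= 1.
Proof. by rewrite ge_max ler01 gerBl sumr_ge0. Qed.

Definition origin : Rn R N := [tuple (0 : measurableTypeR R) | i < N].

Lemma tent_out x : ~ cube origin 1 x -> tent x = 0.
Proof.
move=> xQ; apply/max_idPl; rewrite subr_le0 leNgt; apply/negP => x1.
apply: xQ; apply/cubeP => i; rewrite tnth_mktuple sub0r normrN.
apply: le_trans (ltW x1); rewrite /l1norm (bigD1 i)//= lerDl.
exact: sumr_ge0.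
Qed.

Lemma measurable_tent : measurable_fun setT tent.
Proof.
apply: measurable_maxr; first exact: measurable_cst.
apply: measurable_funB; first exact: measurable_cst.
have h := @measurable_sum _ (Rn R N) R setT 'I_N (index_enum 'I_N)
  (fun i x => `|(tnth x i : R)|).
by apply: h => i; apply: measurableT_comp => //; exact: measurable_tnth.
Qed.

Lemma tent_dist_le1 x y : `|tent x - tent y| <= 1.
Proof.
have := tent_ge0 x; have := tent_ge0 y; have := tent_le1 x; have := tent_le1 y.
by move=> *; rewrite ler_norml; apply/andP; split; lra.
Qed.

Lemma tent_lipschitz x y : `|tent x - tent y| <= N%:R * eucl_dist x y.
Proof.
apply: (@le_trans _ _ `|l1norm x - l1norm y|).
  have h3 := ler_norm (l1norm x - l1norm y).
  have h4 := ler_norm (l1norm y - l1norm x); rewrite distrC in h4.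
  rewrite /tent; set n := `|_ - l1norm y| in h3 h4 *.
  by case: (leP 0 (1 - l1norm x)) => h1; case: (leP 0 (1 - l1norm y)) => h2;
    rewrite ler_norml; apply/andP; split; lra.
rewrite -sumrB; apply: le_trans (ler_norm_sum _ _ _) _.
have -> : N%:R * eucl_dist x y = \sum_(i < N) eucl_dist x y.
  by rewrite sumr_const card_ord mulr_natl.
apply: ler_sum => i _; apply: le_trans (ler_tnth_eucl_dist x y i).
exact: ler_dist_dist.
Qed.

Lemma cube_eucl_dist x y r : eucl_dist x y <= r -> cube x r y.
Proof. by move=> xyr; apply/cubeP => i; exact: le_trans (ler_tnth_eucl_dist x y i) xyr. Qed.

Lemma measurable_eucl_dist_section x :
  measurable_fun setT (fun y => eucl_dist x y).
Proof. exact: (measurableT_comp (@measurable_eucl_dist R N) (pair1_measurable x)). Qed.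

Lemma measurable_gkernel_tent x :
  measurable_fun setT (fun y => gkernel s tent (x, y)).
Proof.
exact: (measurableT_comp (measurable_gkernel s measurable_tent) (pair1_measurable x)).
Qed.

Lemma powR_exprn (z b : R) k : 0 <= z -> (z ^+ k) `^ b = (z `^ b) ^+ k.
Proof.
move=> z0; rewrite -(powR_mulrn k z0) -(powR_mulrn k (powR_ge0 z b)).
by rewrite -!powRrM mulrC.
Qed.

(** Near x the Lipschitz bound leaves |x-y|^(2-N-2s), integrable because s < 1; away from x the
    kernel is at most |x-y|^(-N-2s), integrable because s > 0. Neither bound depends on x. *)
Lemma tent_section_bound : exists2 K : R, 0 <= K &
  forall x, (\int[mu]_y (gkernel s tent (x, y))%:E <= K%:E)%E.
Proof.
(* With h the dyadic radius, [a1] collects the squared Lipschitz constant N^2, the factor 2^e from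
   the inner radius h/2 of the shell and 2^N from the cube of side 2h; [a2] comes from the cube of
   side 4h. The ratios [z1] and [z2] are below 1 for s < 1 and s > 0 respectively. *)
pose a1 : R := N%:R ^+ 2 * 2 `^ e * 2 ^+ N.
pose z1 : R := 2^-1 `^ (2 - 2 * s).
pose a2 : R := 4 ^+ N.
pose z2 : R := 2 `^ (- (2 * s)).
have a10 : 0 <= a1 by rewrite !mulr_ge0 ?powR_ge0 ?exprn_ge0.
have a20 : 0 <= a2 by rewrite exprn_ge0.
have z11 : 0 <= z1 < 1.
  rewrite powR_ge0/= /z1; have b0 : 0 < 2 - 2 * s by move: s_lt1; lra.
  have := @gt0_ltr_powR R _ b0 2^-1 1; rewrite powR1 !nnegrE => -> //.
  by rewrite invf_lt1// ltr1n.
have z21 : 0 <= z2 < 1.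
  rewrite powR_ge0/= /z2 powRN invf_lt1 ?powR_gt0//.
  have b0 : 0 < 2 * s by rewrite mulr_gt0.
  have := @gt0_ltr_powR R _ b0 1 2; rewrite powR1 !nnegrE => -> //.
  by rewrite ltr1n.
exists (a1 / (1 - z1) + a2 / (1 - z2)).
  case/andP: z11 => _ ?; case/andP: z21 => _ ?.
  by rewrite addr_ge0// divr_ge0// subr_ge0 ltW.
move=> x; pose A := [set y | eucl_dist x y <= 1].
have mA : measurable A.
  rewrite (_ : A = (fun y => eucl_dist x y) @^-1` `]-oo, 1]%classic).
    rewrite -[X in measurable X]setTI.
    exact: (measurable_eucl_dist_section x measurableT (measurable_itv `]-oo, 1])).
  by apply/seteqP; split => y /=; rewrite in_itv.
rewrite -(setvU A) setUC ge0_integral_setU//=; last 4 first.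
- exact: measurableC.
- rewrite setUv; apply/measurable_EFinP; exact: measurable_gkernel_tent.
- by move=> y _; rewrite lee_fin gkernel_ge0.
- by rewrite disj_set2E setICr.
rewrite EFinD; apply: leeD.
- pose c k : R := N%:R ^+ 2 * (2^-1 ^+ k) ^+ 2 / (2^-1 ^+ k / 2) `^ e.
  have c0 k : 0 <= c k by rewrite divr_ge0 ?powR_ge0// mulr_ge0 ?exprn_ge0 ?ler0n.
  have cD k : ((c k)%:E * mu (cube x (2^-1 ^+ k)) <= (a1 * z1 ^+ k)%:E)%E.
    rewrite /c; set h : R := 2^-1 ^+ k; have h0 : 0 < h by rewrite exprn_gt0// invr_gt0.
    rewrite lebesgueN_cube ?(ltW h0)// -EFinM lee_fin.
    rewrite /z1 -powR_exprn// -/h (_ : 2 - 2 * s = 2%:R + N%:R - e); last by ring.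
    rewrite (gt0_powRD _ _ h0) (gt0_powRD _ _ h0) powRN !powR_mulrn ?(ltW h0)//.
    have -> : (h / 2) `^ e = h `^ e / 2 `^ e.
      by rewrite powRM ?(ltW h0)// -(powR_inv1 (ltW (@ltr0n R 2)))//;
        rewrite -powRrM mulN1r powRN.
    rewrite exprMn /a1 le_eqVlt; apply/orP; left; apply/eqP; field.
    by rewrite !gt_eqF ?powR_gt0.
  have gc y : A y -> exists k, cube x (2^-1 ^+ k) y /\ gkernel s tent (x, y) <= c k.
    (* On the diagonal the kernel is 0, and any cube around x will do. *)
    move=> xy; have [<-|xNy] := eqVneq x y.
      exists 0%N; split; first by apply/cubeP => i; rewrite subrr normr0.
      by rewrite /gkernel/= subrr normr0 expr0n mul0r.
    have [k [k1 k2]] := ex_dyadic_small (eucl_dist_gt0 xNy) xy.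
    exists k; split; first exact: cube_eucl_dist.
    have hk0 : 0 < 2^-1 ^+ k :> R by rewrite exprn_gt0// invr_gt0.
    apply: ler_pM; rewrite ?exprn_ge0 ?invr_ge0 ?powR_ge0//.
      rewrite -exprMn lerXn2r ?nnegrE ?mulr_ge0 ?(ltW hk0)//.
      by apply: le_trans (tent_lipschitz x y) _; rewrite ler_pM2l.
    have hk2 : 0 < 2^-1 ^+ k / 2 :> R by rewrite divr_gt0.
    rewrite lef_pV2 ?posrE ?powR_gt0 ?eucl_dist_gt0//=.
    by rewrite ge0_ler_powR ?nnegrE ?eucl_dist_ge0 ?(ltW e0)// ltW.
  exact: (integral_le_geometric mA (fun k => measurable_cube x _)
    (measurable_gkernel_tent x) (fun y => gkernel_ge0 _ _ _) c0 a10 z11 cD gc).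
- pose c k : R := ((2 ^+ k) `^ e)^-1.
  have c0 k : 0 <= c k by rewrite invr_ge0 powR_ge0.
  have cD k : ((c k)%:E * mu (cube x (2 * 2 ^+ k)) <= (a2 * z2 ^+ k)%:E)%E.
    rewrite /c; set h : R := 2 ^+ k; have h0 : 0 < h by rewrite exprn_gt0.
    rewrite lebesgueN_cube ?mulr_ge0 ?(ltW h0)// -EFinM lee_fin.
    rewrite /z2 -powR_exprn// -/h (_ : - (2 * s) = N%:R - e); last by ring.
    rewrite (@gt0_powRD _ h N%:R (- e) h0) powRN !powR_mulrn ?(ltW h0)//.
    rewrite mulrA exprMn /a2 -natrM le_eqVlt; apply/orP; left; apply/eqP; field.
    by rewrite !gt_eqF ?powR_gt0.
  have gc y : (~` A) y -> exists k, cube x (2 * 2 ^+ k) y /\ gkernel s tent (x, y) <= c k.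
    move=> /negP; rewrite -ltNge => xy.
    have [k [k1 k2]] := ex_dyadic_large xy.
    exists k; split; first exact: cube_eucl_dist.
    have hk0 : 0 < 2 ^+ k :> R by rewrite exprn_gt0.
    have xy0 : 0 < eucl_dist x y by rewrite (lt_trans ltr01).
    rewrite /c -[leRHS]mul1r; apply: ler_pM; rewrite ?exprn_ge0 ?invr_ge0 ?powR_ge0//.
      by rewrite exprn_ile1// tent_dist_le1.
    rewrite lef_pV2 ?posrE ?powR_gt0//=.
    by rewrite ge0_ler_powR ?nnegrE ?(ltW e0) ?(ltW xy0) ?(ltW hk0).
  exact: (integral_le_geometric (measurableC mA) (fun k => measurable_cube x _)
    (measurable_gkernel_tent x) (fun y => gkernel_ge0 _ _ _) c0 a20 z21 cD gc).
Qed.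

Lemma gkernelC u x y : gkernel s u (x, y) = gkernel s u (y, x).
Proof.
rewrite /gkernel/= distrC; congr (_ / _ `^ _).
rewrite /eucl_dist; congr Num.sqrt; apply: eq_bigr => i _.
by rewrite -sqrrN opprB.
Qed.

Lemma integral_indic_cube1 : (\int[mu]_x (\1_(cube origin 1) x)%:E = (2 ^+ N)%:E)%E.
Proof.
rewrite integral_indic//; last exact: measurable_cube.
by rewrite setIT; have := lebesgueN_cube origin ler01; rewrite mulr1.
Qed.

(** The kernel vanishes unless one of the two points lies in the support cube [Q]. It is thus at
    most its restriction to x in [Q] plus the mirror image, and each part is at most the measure of
    [Q] times the uniform bound on sections. *)
Lemma gagliardo2_tent_lty : (gagliardo2 s tent < +oo)%E.
Proof.
have [K K0 KP] := tent_section_bound; have mt := measurable_tent.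
pose Q := cube origin 1; have mQ : measurable Q by exact: measurable_cube.
pose g z : \bar R := ((\1_Q z.1 * gkernel s tent z)%:E).
have mg : measurable_fun setT g.
  apply/measurable_EFinP; apply: measurable_funM; last exact: measurable_gkernel.
  by apply: (measurableT_comp (measurable_indic _)) => //.
have g0 z : (0 <= g z)%E by rewrite lee_fin mulr_ge0 ?gkernel_ge0.
have gQ : (\int[mu]_x \int[mu]_y g (x, y) <= (2 ^+ N * K)%:E)%E.
  apply: (@le_trans _ _ (\int[mu]_x (K * \1_Q x)%:E)%E).
    apply: ge0_le_integral => //.
    - by move=> x _; apply: integral_ge0.
    - exact: (measurable_fun_fubini_tonelli_F g).
    - apply/measurable_EFinP; apply: measurable_funM => //.
    - move=> x _; rewrite /g/= indicE; case: (x \in Q) => /=.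
        by under eq_integral do rewrite mul1r; rewrite mulr1.
      by under eq_integral do rewrite mul0r; rewrite integral0 mulr0.
  under eq_integral do rewrite EFinM.
  rewrite ge0_integralZl//; last 1 first.
    by apply/measurable_EFinP; exact: measurable_indic.
  by rewrite integral_indic_cube1 -EFinM lee_fin mulrC.
have msw : measurable_fun setT (fun z : Rn R N * Rn R N => g (z.2, z.1)).
  have sw := measurable_fun_pair (@measurable_snd _ _ (Rn R N) (Rn R N)) measurable_fst.
  exact: (measurableT_comp mg sw).
have -> : gagliardo2 s tent = (\int[mu \x mu]_z (gkernel s tent z)%:E)%E by [].
apply: (@le_lt_trans _ _ (\int[mu \x mu]_z (g z + g (z.2, z.1)))%E).
  apply: ge0_le_integral => //.
  - by move=> z _; rewrite lee_fin gkernel_ge0.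
  - by apply/measurable_EFinP; exact: measurable_gkernel.
  - exact: (emeasurable_funD mg msw).
  - move=> [x y] _; rewrite /g/= -EFinD lee_fin (gkernelC _ y x) -mulrDl.
    have [xQ|xQ] := pselect (Q x).
      by rewrite !indicE mem_set// ler_peMl ?gkernel_ge0// lerDl.
    have [yQ|yQ] := pselect (Q y).
      by rewrite !indicE (mem_set yQ) ler_peMl ?gkernel_ge0// lerDr.
    by rewrite /gkernel/= !tent_out// subrr normr0 expr0n !mul0r mulr0.
have -> : (\int[mu \x mu]_z (g z + g (z.2, z.1)) =
    \int[mu \x mu]_z g z + \int[mu \x mu]_z g (z.2, z.1))%E.
  exact: (ge0_integralD _ measurableT (fun z _ => g0 z) mg (fun z _ => g0 _) msw).
rewrite (fubini_tonelli1 g mg g0).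
rewrite (fubini_tonelli2 (fun z => g (z.2, z.1)) msw (fun z => g0 _)).
by rewrite lte_add_pinfty// (le_lt_trans gQ)// ltry.
Qed.

Lemma tent_Hs : Hs s tent.
Proof.
have mt := measurable_tent; apply/HsP; split => //; last exact: gagliardo2_tent_lty.
pose Q := cube origin 1; have mQ : measurable Q by exact: measurable_cube.
apply: (@le_lt_trans _ _ (\int[mu]_x (\1_Q x)%:E)%E).
  apply: ge0_le_integral => //.
  - apply/measurable_EFinP; apply: measurable_funX; exact: measurable_normr.
  - by apply/measurable_EFinP; exact: measurable_indic.
  - move=> x _; rewrite lee_fin indicE.
    have [xQ|xQ] := pselect (Q x).
      by rewrite mem_set// exprn_ile1// ger0_norm ?tent_ge0// tent_le1.
    by rewrite tent_out// normr0 expr0n.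
by rewrite integral_indic_cube1 ltry.
Qed.

Lemma mass_tent_gt0 : 0 < mass tent.
Proof.
rewrite -lte_fin -(EFin_mass tent_Hs).
(* On the cube of half-side 1/(2N) the l1 norm is at most 1/2, so that [tent] is at least 1/2. *)
pose r : R := (2 * N%:R)^-1; have r0 : 0 < r by rewrite invr_gt0 mulr_gt0.
apply: (@lt_le_trans _ _ ((2^-1 ^+ 2)%:E * mu (cube origin r))%E).
  by rewrite lebesgueN_cube ?(ltW r0)// -EFinM lte_fin mulr_gt0// exprn_gt0// mulr_gt0.
apply: ge0_integral_ge_cst => //; first exact: measurable_cube.
  apply/measurable_EFinP; apply: measurable_funX; apply: measurable_normr.
  exact: measurable_tent.
move=> x /cubeP xr; rewrite lee_fin lerXn2r ?nnegrE//.
rewrite ger0_norm ?tent_ge0// le_max; apply/orP; right.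
have : l1norm x <= \sum_(i < N) r.
  apply: ler_sum => i _; have := xr i.
  by rewrite tnth_mktuple sub0r normrN.
rewrite sumr_const card_ord.
have -> : r *+ N = 2^-1 by rewrite -mulr_natl /r; field; rewrite gt_eqF.
lra.
Qed.

End tent.

(** * The nonlinearity *)

Section calculus.
Context {R : realType}.

Lemma MVT_gt0 (g dg : R -> R) :
  (forall x : R, 0 < x -> is_derive x 1 g (dg x)) ->
  forall x y : R, 0 < x -> x < y ->
  exists2 c, x < c < y & g y - g x = dg c * (y - x).
Proof.
move=> gd x y x0 xy; have [|z|c] := @MVT R g dg x y xy.
- by move=> z; rewrite in_itv/= => /andP[xz _]; apply: gd; exact: lt_trans xz.
- apply: derivable_within_continuous => w; rewrite in_itv/= => /andP[xw _].
  by have := gd w (lt_le_trans x0 xw) => -[].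
- by rewrite in_itv/= => xcy E; exists c.
Qed.

Lemma dnbhs0P (P : R -> Prop) : (\forall t \near 0^', P t) ->
  exists2 d : R, 0 < d & forall t, t != 0 -> `|t| < d -> P t.
Proof.
move=> /nbhs_ballP[d /= d0 dP]; exists d => // t t0 td; apply: dP => //=.
by rewrite /ball/= sub0r normrN.
Qed.

Lemma pinftyP (P : R -> Prop) : (\forall t \near +oo, P t) ->
  exists2 M : R, 0 < M & forall t, M <= t -> P t.
Proof.
move=> [M [_ MP]]; exists (Num.max M 0 + 1).
  by rewrite ltr_wpDl// le_max lexx orbT.
move=> t Mt; apply: MP; apply: lt_le_trans Mt.
by rewrite ltr_pwDr// le_max lexx.
Qed.

End calculus.

Section nonlinearity.
Context {R : realType}.
Variables (f : R -> R) (a q q1 : R).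
Hypotheses (a_gt0 : 0 < a) (q_gt : 2 + a < q) (qE : q = 1 + q1).
Hypotheses (f_odd : forall t, f (- t) = - f t) (f_cont : continuous f)
  (f_at0 : f t / `|t| `^ (1 + a) @[t --> 0^'] --> 0)
  (f_atoo : f t / `|t| `^ q1 @[t --> +oo] --> 0)
  (F_atoo : primitive f t / `|t| `^ (2 + a) @[t --> +oo] --> +oo)
  (Ftilde_incr : forall t1 t2, 0 < t1 -> t1 < t2 ->
     Ftilde f t1 / `|t1| `^ (2 + a) < Ftilde f t2 / `|t2| `^ (2 + a))
  (f_lt_F : forall t, t != 0 -> f t * t < q * primitive f t)
  (tf_at0 : t * f t / `|t| `^ q @[t --> 0^'] --> +oo).
Implicit Types (t c d e k r x M : R).

Local Notation F := (primitive f).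
Local Notation H := (Ftilde f).
Local Notation leb := (@lebesgue_measure R).

Lemma primitive0 : F 0 = 0.
Proof. by rewrite /primitive lexx set_itv1 Rintegral_set1. Qed.

Lemma primitive_even t : F (- t) = F t.
Proof.
wlog t0 : t / 0 < t.
  move=> h; have [t0|t0|<-] := ltgtP 0 t; [exact: h| |by rewrite oppr0].
  by have := h (- t); rewrite oppr_gt0 opprK => /(_ t0) ->.
rewrite /primitive leNgt oppr_lt0 t0/= (ltW t0).
have fi : leb.-integrable `[0, t] (EFin \o f).
  apply: continuous_compact_integrable; first exact: segment_compact.
  exact: continuous_subspaceT.
have := integration_by_substitution_oppr (ltW t0) (continuous_subspaceT f_cont).
rewrite oppr0 => E.
have -> : \int[leb]_(x in `[(- t), 0]) f x = \int[leb]_(x in `[0, t]) (-1 * f x).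
  rewrite /Rintegral E; congr fine; apply: eq_integral => x _.
  by rewrite /= f_odd mulN1r.
by rewrite RintegralZl// mulN1r opprK.
Qed.

Lemma primitive_is_derive t : 0 < t -> is_derive t 1 F (f t).
Proof.
move=> t0.
have ft1 : leb.-integrable `[0, t + 1] (EFin \o f).
  apply: continuous_compact_integrable; first exact: segment_compact.
  exact: continuous_subspaceT.
have tt1 : t < t + 1 by rewrite ltrDl.
have [dF FE] := continuous_FTC1_closed tt1 ft1 t0 (@f_cont t).
have nF : {near t, (fun x => \int[leb]_(y in `[0, x]) f y) =1 F}.
  near=> x; rewrite /primitive ifT//.
  by apply: ltW; near: x; exact: lt_nbhsr.
apply: DeriveDef.
  by apply: near_eq_derivable dF.
by rewrite -(near_eq_derive _ nF) -derive1E.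
Unshelve. all: by end_near. Qed.

Lemma f_near0 e : 0 < e ->
  exists2 d, 0 < d & forall t, `|t| < d -> `|f t| <= e * `|t| `^ (1 + a).
Proof.
move=> e0; have /cvgrPdist_le /(_ e e0) /dnbhs0P[d d0 dP] := f_at0.
have f0 : f 0 = 0 by have := f_odd 0; rewrite oppr0; lra.
exists d => // t td; have [->|t0] := eqVneq t 0.
  by rewrite f0 normr0 mulr_ge0 ?powR_ge0// ltW.
have tp : 0 < `|t| `^ (1 + a) by rewrite powR_gt0 ?normr_gt0.
by have := dP t t0 td; rewrite sub0r normrN normrM normfV (gtr0_norm tp) ler_pdivrMr.
Qed.

Lemma f_near_oo e : 0 < e ->
  exists2 M, 0 < M & forall t, M <= `|t| -> `|f t| <= e * `|t| `^ q1.
Proof.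
move=> e0; have /cvgrPdist_le /(_ e e0) /pinftyP[M M0 MP] := f_atoo.
exists M => // t Mt; have -> : `|f t| = `|f `|t| |.
  by case: (ger0P t) => // _; rewrite f_odd normrN.
have tp : 0 < `|t| `^ q1 by rewrite powR_gt0// (lt_le_trans M0).
have := MP `|t| Mt; rewrite sub0r normrN normrM normfV normr_id (gtr0_norm tp).
by rewrite ler_pdivrMr.
Qed.

Lemma primitive_near0 e : 0 < e ->
  exists2 d, 0 < d & forall t, 0 < t -> t < d -> `|F t| <= e * t `^ (2 + a).
Proof.
move=> e0; have [d d0 dP] := f_near0 e0; exists d => // t t0 td.
rewrite /primitive (ltW t0).
have fi : leb.-integrable `[0, t] (EFin \o f).
  apply: continuous_compact_integrable; first exact: segment_compact.
  exact: continuous_subspaceT.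
have ci : leb.-integrable `[0, t] (EFin \o cst (e * t `^ (1 + a))).
  apply: continuous_compact_integrable; first exact: segment_compact.
  by apply: continuous_subspaceT => x; exact: cvg_cst.
apply: le_trans (le_normr_Rintegral _ fi) _ => //.
apply: (@le_trans _ _ (\int[leb]_(x in `[0, t]) (e * t `^ (1 + a)))).
  apply: le_Rintegral => //; first exact: (integrable_norm fi).
  move=> x /=; rewrite in_itv/= => /andP[x0 xt].
  apply: (le_trans (dP x _)); first by rewrite ger0_norm// (le_lt_trans xt).
  rewrite ler_wpM2l ?(ltW e0)// ger0_norm// ge0_ler_powR ?nnegrE ?(ltW t0)//.
  by rewrite addr_ge0// ltW.
rewrite Rintegral_cst//= lebesgue_measure_itv/= lte_fin t0 oppr0 adde0/=.
have -> : 2 + a = 1 + (1 + a) by ring.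
by rewrite (@gt0_powRD _ t 1 (1 + a))// powRr1 ?(ltW t0)// [t * _]mulrC mulrA.
Qed.

Lemma Ftilde_even t : H (- t) = H t.
Proof. by rewrite /Ftilde primitive_even f_odd mulrNN. Qed.

(** By [f_at0] the quotient of [H t] by t^(2+a) tends to 0 as t decreases to 0, and by [Ftilde_incr]
    it increases strictly. Passing through t/2 keeps the inequality strict in the limit. *)
Lemma Ftilde_gt0 t : t != 0 -> 0 < H t.
Proof.
wlog t0 : t / 0 < t.
  move=> h tn0; have [t0|t0|t0] := ltgtP 0 t; first exact: h.
    by rewrite -Ftilde_even h ?oppr_gt0// oppr_eq0.
  by rewrite -t0 eqxx in tn0.
move=> _; set g := fun t => H t / `|t| `^ (2 + a).
suff g_ge e : 0 < e -> - e <= g (t / 2).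
  have t20 : 0 < t / 2 by rewrite divr_gt0.
  have : 0 <= g (t / 2) by apply/ler_addgt0Pr => e /g_ge; lra.
  have := @Ftilde_incr (t / 2) t t20; rewrite -/(g _) -/(g _) => /(_ _) /=.
  have tt : t / 2 < t by lra.
  move=> /(_ tt) h1 h2; have := le_lt_trans h2 h1.
  by rewrite /g pmulr_lgt0// invr_gt0 powR_gt0// normr_gt0 gt_eqF.
move=> e0.
have e30 : 0 < e / 3 by rewrite divr_gt0.
have [d1 d10 d1P] := f_near0 e30; have [d2 d20 d2P] := primitive_near0 e30.
pose r := Num.min (t / 2) (Num.min (d1 / 2) (d2 / 2)).
have r0 : 0 < r by rewrite !lt_min !divr_gt0.
have rt : r <= t / 2 by rewrite ge_min lexx.
have rd1 : r < d1.
  by apply: le_lt_trans (_ : d1 / 2 < d1); [rewrite !ge_min lexx orbT|lra].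
have rd2 : r < d2.
  by apply: le_lt_trans (_ : d2 / 2 < d2); [rewrite !ge_min lexx !orbT|lra].
apply: (@le_trans _ _ (g r)); last first.
  move: rt; rewrite le_eqVlt => /predU1P[->//|rt].
  by apply: ltW; exact: Ftilde_incr.
have rp : 0 < r `^ (2 + a) by rewrite powR_gt0.
rewrite /g (gtr0_norm r0) ler_pdivlMr// /Ftilde.
have := d2P r r0 rd2; have := d1P r; rewrite (gtr0_norm r0) => /(_ rd1) h1 h2.
have {}h1 : `|f r * r| <= e / 3 * r `^ (2 + a).
  rewrite normrM (gtr0_norm r0) (_ : 2 + a = 1 + a + 1); last by ring.
  by rewrite (gt0_powRD (1 + a))// powRr1 ?(ltW r0)// mulrA ler_wpM2r ?(ltW r0).
move: h1 h2; rewrite !ler_norml => /andP[h1 _] /andP[_ h2].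
lra.
Qed.

Lemma primitive_gt0 t : t != 0 -> 0 < F t.
Proof.
move=> t0; have := Ftilde_gt0 t0; have := f_lt_F t0; rewrite /Ftilde => h1 h2.
have : 0 < (q - 2) * F t by lra.
have q2 : 0 < q - 2 by move: a_gt0 q_gt; lra.
by rewrite (pmulr_rgt0 _ q2).
Qed.

Lemma Ftilde0 : H 0 = 0.
Proof. by rewrite /Ftilde primitive0 !mulr0 subrr. Qed.

Lemma Ftilde_ge0 t : 0 <= H t.
Proof. by have [->|/Ftilde_gt0/ltW//] := eqVneq t 0; rewrite Ftilde0. Qed.

Lemma primitive_ge0 t : 0 <= F t.
Proof. by have [->|/primitive_gt0/ltW//] := eqVneq t 0; rewrite primitive0. Qed.

Lemma Ftilde_lt t : t != 0 -> H t < (q - 2) * F t.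
Proof. by move=> /f_lt_F; rewrite /Ftilde; lra. Qed.

Lemma Ftilde_le t : H t <= (q - 2) * F t.
Proof.
by have [->|/Ftilde_lt/ltW//] := eqVneq t 0; rewrite Ftilde0 primitive0 mulr0.
Qed.

(* F(r) / r^2 is a convex function of r^a, because its derivative is
   r^(a - 1) times the increasing function Ftilde(r) / r^(2 + a). *)
Lemma primitive_tangent t c : 0 < c ->
  F t + H t / a * (c `^ a - 1) <= F (c * t) / c ^+ 2.
Proof.
wlog t0 : t / 0 < t.
  move=> h c0; have [t0|t0|<-] := ltgtP 0 t; first exact: h.
    by have := h (- t); rewrite oppr_gt0 primitive_even Ftilde_even mulrN
      primitive_even => /(_ t0 c0).
  by rewrite mulr0 primitive0 Ftilde0 !mul0r addr0.
move=> c0; set k := H t / t `^ (2 + a).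
pose psi r := F r * r `^ (- 2) - k / a * r `^ a.
pose dpsi r := (H r - k * r `^ (2 + a)) * r `^ (- 3).
have psid (r : R) : 0 < r -> is_derive r 1 psi (dpsi r).
  move=> r0; have F' := primitive_is_derive r0.
  have p1 := is_derive1_powR (- 2) r0; have p2 := is_derive1_powR a r0.
  apply: (@is_derive_eq _ _ _ (F * (fun x => x `^ (- 2)) - (k / a) *: (fun x => x `^ a))).
  rewrite /dpsi /Ftilde /GRing.scale/=.
  have e3 : r `^ (-2) = r * r `^ (-3).
    transitivity (r `^ 1 * r `^ (-3)); last by rewrite powRr1// ltW.
    by rewrite -gt0_powRD//; congr (_ `^ _); ring.
  have e4 : r `^ (a - 1) = r `^ (2 + a) * r `^ (- 3).
    by rewrite -gt0_powRD//; congr (_ `^ _); ring.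
  have e5 : r `^ (- 2 - 1) = r `^ (- 3) by congr (_ `^ _); ring.
  by rewrite e4 e5 e3; field; rewrite gt_eqF.
have psi_min (r : R) : 0 < r -> psi t <= psi r.
  move=> r0; have [tr|rt|<-//] := ltgtP t r.
  - have [z /andP[tz _] E] := MVT_gt0 psid t0 tr.
    rewrite -subr_ge0 E mulr_ge0 ?subr_ge0 ?(ltW tr)// mulr_ge0 ?powR_ge0// subr_ge0.
    have z0 := lt_trans t0 tz.
    rewrite -ler_pdivlMr ?powR_gt0//; have := Ftilde_incr t0 tz.
    by rewrite (gtr0_norm t0) (gtr0_norm z0) => /ltW.
  - have [z /andP[rz zt] E] := MVT_gt0 psid r0 rt.
    rewrite -subr_le0 E; apply: mulr_le0_ge0; last by rewrite subr_ge0 ltW.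
    have z0 := lt_trans r0 rz.
    apply: mulr_le0_ge0; last exact: powR_ge0.
    rewrite subr_le0 -ler_pdivrMr ?powR_gt0//; have := Ftilde_incr z0 zt.
    by rewrite (gtr0_norm t0) (gtr0_norm z0) => /ltW.
have := psi_min (c * t) (mulr_gt0 c0 t0); rewrite /psi.
rewrite !powRM ?(ltW c0) ?(ltW t0)//.
have pm2 (x : R) : 0 < x -> x `^ (- 2) = (x ^+ 2)^-1 by move=> x0; rewrite powRN powR_mulrn// ltW.
rewrite !pm2// => h.
have kt : k * t ^+ 2 * t `^ a = H t.
  rewrite /k gt0_powRD// -(powR_mulrn 2 (ltW t0)); field.
  by rewrite !gt_eqF ?powR_gt0.
rewrite -kt -subr_ge0.
rewrite (_ : _ - _ = t ^+ 2 * (F (c * t) * ((c ^+ 2)^-1 / t ^+ 2) - k / a * (c `^ a * t `^ a)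
  - (F t / t ^+ 2 - k / a * t `^ a))).
  by rewrite mulr_ge0 ?sqr_ge0// subr_ge0.
by field; rewrite !gt_eqF.
Qed.

(** The limit of [primitive_tangent] as c tends to 0, where F(ct)/c^2 tends to 0 because F is small
    compared with |t|^(2+a). *)
Lemma primitive_le_Ftilde t : F t <= H t / a.
Proof.
wlog t0 : t / 0 < t.
  move=> h; have [t0|t0|<-] := ltgtP 0 t; first exact: h.
    by have := h (- t); rewrite oppr_gt0 primitive_even Ftilde_even => /(_ t0).
  by rewrite primitive0 Ftilde0 mul0r.
apply/ler_addgt0Pr => e e0.
have [d d0 dP] := primitive_near0 (@ltr01 R).
have tp0 : 0 < t `^ (2 + a) by rewrite powR_gt0.
have [x x0 xa] : exists2 x, 0 < x & x `^ a = e / t `^ (2 + a).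
  exists ((e / t `^ (2 + a)) `^ a^-1); first by rewrite powR_gt0// divr_gt0.
  by rewrite -powRrM mulVf ?gt_eqF// powRr1// ltW// divr_gt0.
have [c [c0 cx ctd]] : exists c, [/\ 0 < c, c <= x & c * t < d].
  have dt0 : 0 < d / t / 2 by rewrite !divr_gt0.
  exists (Num.min x (d / t / 2)); split; first by rewrite lt_min x0 dt0.
    by rewrite ge_min lexx.
  rewrite -ltr_pdivlMr//; apply: (@le_lt_trans _ _ (d / t / 2)); last by lra.
  by rewrite ge_min lexx orbT.
have ca : c `^ a <= e / t `^ (2 + a).
  by rewrite -xa; apply: (ge0_ler_powR (ltW a_gt0)); rewrite ?nnegrE//; exact: ltW.
have := primitive_tangent t c0.
have := dP _ (mulr_gt0 c0 t0) ctd; rewrite mul1r => /(le_trans (ler_norm _)) Fct.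
have {}Fct : F (c * t) / c ^+ 2 <= e.
  apply: (@le_trans _ _ (c `^ a * t `^ (2 + a))); last by rewrite -ler_pdivlMr.
  rewrite ler_pdivrMr ?exprn_gt0//; apply: (le_trans Fct).
  rewrite powRM ?(ltW c0) ?(ltW t0)// gt0_powRD// -(powR_mulrn 2 (ltW c0)).
  by rewrite (mulrC (c `^ 2)) mulrAC.
have : 0 <= H t / a * c `^ a by rewrite mulr_ge0 ?powR_ge0// divr_ge0 ?Ftilde_ge0// ltW.
lra.
Qed.

(** In [primitive_tangent] the slope [H t / a] may be lowered to [F t], which leaves c^a F(t) <=
    F(ct)/c^2. In other words F(r)/r^(2+a) is nondecreasing for r > 0. *)
Lemma primitive_scale_ge c t : 1 <= c -> c `^ (2 + a) * F t <= F (c * t).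
Proof.
move=> c1; have c0 : 0 < c by rewrite (lt_le_trans ltr01).
have := primitive_tangent t c0.
have ca : 0 <= c `^ a - 1 by rewrite subr_ge0 -[leLHS](powRr0 c) ler_powR// ltW.
have := ler_wpM2r ca (primitive_le_Ftilde t).
rewrite gt0_powRD// powR_mulrn ?(ltW c0)// => h1 h2.
by rewrite -mulrA -ler_pdivlMl ?exprn_gt0// mulrC; lra.
Qed.

(** [f_lt_F] says that F(r) r^(-q) has negative derivative. This is the source of the strict
    monotonicity in the mass. *)
Lemma primitive_scale_lt k t : 1 < k -> t != 0 -> F (k * t) < k `^ q * F t.
Proof.
wlog t0 : t / 0 < t.
  move=> h k1 tn0; have [t0|t0|t0] := ltgtP 0 t; first exact: h.
    have := h (- t); rewrite oppr_gt0 primitive_even mulrN primitive_even oppr_eq0.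
    exact.
  by rewrite -t0 eqxx in tn0.
move=> k1 _; have k0 : 0 < k by rewrite (lt_trans ltr01).
pose psi r := F r * r `^ (- q).
pose dpsi r := (f r * r - q * F r) * r `^ (- q - 1).
have psid (r : R) : 0 < r -> is_derive r 1 psi (dpsi r).
  move=> r0; have F' := primitive_is_derive r0.
  have p1 := is_derive1_powR (- q) r0.
  apply: (@is_derive_eq _ _ _ (F * (fun x => x `^ (- q)))).
  rewrite /dpsi /GRing.scale/=.
  have -> : r `^ (- q) = r * r `^ (- q - 1).
    transitivity (r `^ 1 * r `^ (- q - 1)); last by rewrite powRr1// ltW.
    by rewrite -gt0_powRD//; congr (_ `^ _); ring.
  by ring.
have tkt : t < k * t by rewrite ltr_pMl.
have [z /andP[tz _] E] := MVT_gt0 psid t0 tkt.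
have z0 := lt_trans t0 tz.
have : psi (k * t) < psi t.
  rewrite -subr_lt0 E nmulr_rlt0 ?subr_gt0// nmulr_rlt0 ?powR_gt0//.
  by rewrite subr_lt0 f_lt_F// gt_eqF.
rewrite /psi !powRN powRM ?(ltW k0) ?(ltW t0)// invfM mulrA ltr_pM2r ?invr_gt0 ?powR_gt0//.
by rewrite ltr_pdivrMr ?powR_gt0// [F t * _]mulrC.
Qed.

(** The limit [tf_at0] is used at level q M, because [f_lt_F] costs a factor q in passing from t
    f(t) to F. *)
Lemma primitive_near0_ge M : exists2 d, 0 < d &
  forall t, `|t| < d -> M * `|t| `^ q <= F t.
Proof.
have q0 : 0 < q by move: a_gt0 q_gt; lra.
have /cvgryPge /(_ (q * M)) /dnbhs0P[d d0 dP] := tf_at0.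
exists d => // t td; have [->|t0] := eqVneq t 0.
  by rewrite normr0 powR0 ?gt_eqF// mulr0 primitive0.
have := dP t t0 td; rewrite ler_pdivlMr ?powR_gt0 ?normr_gt0// => h.
have := f_lt_F t0; rewrite mulrC => /(le_lt_trans h).
by rewrite -mulrA ltr_pM2l// => /ltW.
Qed.

Lemma primitive_near_oo_ge M : exists2 T, 0 < T &
  forall t, T <= `|t| -> M * `|t| `^ (2 + a) <= F t.
Proof.
have /cvgryPge /(_ M) /pinftyP[T T0 TP] := F_atoo.
exists T => // t Tt.
have -> : F t = F `|t| by case: (ger0P t) => // _; rewrite primitive_even.
have t0 := lt_le_trans T0 Tt.
by have := TP _ Tt; rewrite normr_id ler_pdivlMr// powR_gt0.
Qed.

(** An upper bound by a small multiple of the mass-critical and Sobolev-critical powers, both near 0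
    and near infinity. A single d < 1 serves both ends, so that the remaining values of |t| lie in
    the nonempty compact interval [d, 1/d]. *)
Definition small_at_ends (G : R -> R) := forall e, 0 < e ->
  exists2 d, 0 < d < 1 & forall t, `|t| <= d \/ d^-1 <= `|t| ->
    G t <= e * (`|t| `^ (2 + a) + `|t| `^ q).

Lemma small_at_ends_le (G1 G2 : R -> R) : (forall t, G1 t <= G2 t) ->
  small_at_ends G2 -> small_at_ends G1.
Proof.
move=> G12 s2 e /s2[d d01 dP]; exists d => // t /dP; exact: le_trans.
Qed.

Lemma small_at_ends_tf : small_at_ends (fun t => f t * t).
Proof.
move=> e e0; have [d1 d10 d1P] := f_near0 e0; have [M M0 MP] := f_near_oo e0.
pose d := Num.min (2^-1) (Num.min (d1 / 2) M^-1).
have d0 : 0 < d by rewrite !lt_min !invr_gt0 M0 ltr0n divr_gt0.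
have d1' : d < 1 by rewrite gt_min; apply/orP; left; lra.
exists d; first by rewrite d0 d1'.
move=> t [td|td].
- apply: (le_trans (ler_norm _)); rewrite normrM.
  have td1 : `|t| < d1.
    apply: (le_lt_trans td); apply: (@le_lt_trans _ _ (d1 / 2)); last by lra.
    by rewrite !ge_min lexx orbT.
  apply: (le_trans (ler_wpM2r (normr_ge0 t) (d1P t td1))).
  rewrite -mulrA ler_wpM2l ?(ltW e0)//.
  have -> : 2 + a = 1 + a + 1 by ring.
  have [->|t0] := eqVneq t 0; first by rewrite normr0 mulr0 addr_ge0 ?powR_ge0.
  by rewrite (gt0_powRD (1 + a)) ?normr_gt0// powRr1// lerDl powR_ge0.
- apply: (le_trans (ler_norm _)); rewrite normrM.
  have tM : M <= `|t|.
    apply: le_trans td; rewrite -[leLHS]invrK lef_pV2 ?posrE ?invr_gt0//.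
    by rewrite !ge_min lexx !orbT.
  apply: (le_trans (ler_wpM2r (normr_ge0 t) (MP t tM))).
  rewrite -mulrA ler_wpM2l ?(ltW e0)// qE [1 + q1]addrC.
  by rewrite (gt0_powRD q1) ?(lt_le_trans M0)// powRr1// lerDr powR_ge0.
Qed.

Lemma small_at_ends_primitive : small_at_ends F.
Proof.
apply: small_at_ends_le small_at_ends_tf => t.
by have := Ftilde_ge0 t; have := primitive_ge0 t; rewrite /Ftilde; lra.
Qed.

Lemma small_at_ends_Ftilde : small_at_ends H.
Proof.
apply: small_at_ends_le small_at_ends_tf => t.
by have := primitive_ge0 t; rewrite /Ftilde; lra.
Qed.

(** The scalar substitute for compactness: on [d, 1/d] the maximum of [G] is divided by the minimum
    of [W], which is positive. For [W] a power of |t| this gives growth bounds; for [W] the gain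
    density of [ground_energy_gap] it shows that a small gain forces the integral of Ftilde to be
    small. *)
Lemma small_at_ends_bound (G W : R -> R) e : continuous G -> continuous W ->
  (forall t, G (- t) = G t) -> (forall t, W (- t) = W t) ->
  (forall t, 0 <= W t) -> (forall t, t != 0 -> 0 < W t) ->
  small_at_ends G -> 0 < e ->
  exists2 C, 0 <= C & forall t, G t <= e * (`|t| `^ (2 + a) + `|t| `^ q) + C * W t.
Proof.
move=> Gc Wc Ge We W0 Wp Gs e0; have [d /andP[d0 d1] dP] := Gs e e0.
have dd : d <= d^-1 by rewrite (le_trans (ltW d1))// invf_ge1// ltW.
have [x _ xP] := EVT_max dd (continuous_subspaceT Gc).
have [y yd yP] := EVT_min dd (continuous_subspaceT Wc).
have y0 : 0 < W y.
  by apply: Wp; move: yd; rewrite in_itv/= => /andP[dy _]; rewrite gt_eqF// (lt_le_trans d0).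
exists (`|G x| / W y); first by rewrite divr_ge0// ltW.
move=> t; have [td|td] := leP `|t| d.
  by rewrite (le_trans (dP t (or_introl td)))// lerDl mulr_ge0// divr_ge0// ltW.
have [td2|td2] := leP d^-1 `|t|.
  by rewrite (le_trans (dP t (or_intror td2)))// lerDl mulr_ge0// divr_ge0// ltW.
have absE (K : R -> R) : (forall t, K (- t) = K t) -> K `|t| = K t.
  by move=> Ke; case: (ger0P t).
have tin : `|t| \in `[d, d^-1] by rewrite in_itv/= !ltW.
rewrite -(absE G)// -(absE W)//.
apply: (@le_trans _ _ (`|G x| / W y * W `|t|)).
  apply: (@le_trans _ _ `|G x|).
    exact: le_trans (xP _ tin) (ler_norm _).
  by rewrite -mulrA ler_peMr// ler_pdivlMl// mulr1 yP.
by rewrite lerDr mulr_ge0 ?(ltW e0)// addr_ge0 ?powR_ge0.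
Qed.

Lemma continuous_primitive : continuous F.
Proof.
move=> t; have pos (r : R) : 0 < r -> {for r, continuous F}.
  move=> r0; have [dF _] := primitive_is_derive r0.
  exact/differentiable_continuous/derivable1_diffP.
have [t0|t0|<-] := ltgtP 0 t; first exact: pos.
- have -> : F = F \o -%R by apply/funext => x; rewrite /= primitive_even.
  apply: continuous_comp; first exact: opp_continuous.
  by apply: pos; rewrite oppr_gt0.
- apply/cvgrPdist_le => e e0; rewrite primitive0.
  have [d d0 dP] := primitive_near0 (@ltr01 R).
  apply/nbhs_ballP; exists (Num.min d (Num.min 1 e)) => /=.
    by rewrite !lt_min d0 ltr01.
  move=> x; rewrite /ball/= !sub0r !normrN !lt_min => /and3P[xd /ltW x1 /ltW xe].
  have [->|x0] := eqVneq x 0; first by rewrite primitive0 normr0 ltW.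
  have -> : F x = F `|x| by case: (ger0P x) => // _; rewrite primitive_even.
  have xp : 0 < `|x| by rewrite normr_gt0.
  apply: (le_trans (dP _ xp xd)); rewrite mul1r; apply: le_trans xe.
  by apply: ge1r_powR; rewrite ?xp//; move: a_gt0; lra.
Qed.

Lemma continuous_Ftilde : continuous H.
Proof.
move=> t; apply: cvgB; first by apply: cvgM; [exact: f_cont|exact: cvg_id].
by apply: cvgM; [exact: cvg_cst|exact: continuous_primitive].
Qed.

(* On d <= |t| <= 1 / d the left-hand side is comparable with |t|^p, while
   c^-p F(c t) / |t|^p tends to +oo with c. *)
Lemma primitive_superlinear e k : 0 < e -> 0 < k ->
  exists2 c0, 1 <= c0 & forall c t, c0 <= c ->
    F t <= e * (`|t| `^ (2 + a) + `|t| `^ q) + k * (c `^ (- (2 + a)) * F (c * t)).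
Proof.
move=> e0 k0; have [d /andP[d0 d1] dP] := small_at_ends_primitive e0.
pose Z := F d^-1 / d^-1 `^ (2 + a).
have dV0 : 0 < d^-1 by rewrite invr_gt0.
have Z0 : 0 <= Z by rewrite divr_ge0 ?powR_ge0 ?primitive_ge0.
have [T T0 TP] := primitive_near_oo_ge (Z / k).
exists (Num.max 1 (T / d)); first by rewrite le_max lexx.
move=> c t; rewrite ge_max => /andP[c1 cT]; have c0 : 0 < c by rewrite (lt_le_trans ltr01).
have r0 : 0 <= k * (c `^ (- (2 + a)) * F (c * t)).
  by rewrite mulr_ge0 ?(ltW k0)// mulr_ge0 ?powR_ge0 ?primitive_ge0.
have [td|td] := leP `|t| d.
  by rewrite (le_trans (dP t (or_introl td)))// lerDl.
have [td2|td2] := leP d^-1 `|t|.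
  by rewrite (le_trans (dP t (or_intror td2)))// lerDl.
have tp : 0 < `|t| by rewrite (lt_trans d0).
have tpp : 0 < `|t| `^ (2 + a) by rewrite powR_gt0.
have FZ : F t <= Z * `|t| `^ (2 + a).
  have -> : F t = F `|t| by case: (ger0P t) => // _; rewrite primitive_even.
  have := @primitive_scale_ge (d^-1 / `|t|) `|t|.
  rewrite divfK ?gt_eqF// ler_pdivlMr// mul1r => /(_ (ltW td2)).
  rewrite powRM ?(ltW dV0) ?invr_ge0// -[`|t|^-1]powR_inv1// -powRrM mulN1r powRN => h.
  rewrite /Z mulrAC ler_pdivlMr ?powR_gt0// -ler_pdivrMr//.
  by apply: le_trans h; rewrite le_eqVlt; apply/orP; left; apply/eqP; field; rewrite gt_eqF.
have FT : Z / k * (c `^ (2 + a) * `|t| `^ (2 + a)) <= F (c * t).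
  rewrite -powRM ?(ltW c0)// -{1}(gtr0_norm c0) -normrM; apply: TP.
  rewrite normrM (gtr0_norm c0); apply: (@le_trans _ _ (c * d)).
    by rewrite -ler_pdivrMr.
  by rewrite ler_pM2l// ltW.
apply: (le_trans FZ); apply: (@le_trans _ _ (k * (c `^ (- (2 + a)) * F (c * t)))).
  rewrite -ler_pdivrMl// powRN ler_pdivlMl ?powR_gt0//.
  by apply: le_trans FT; rewrite le_eqVlt; apply/orP; left; apply/eqP; ring.
by rewrite lerDr mulr_ge0 ?(ltW e0)// addr_ge0 ?powR_ge0.
Qed.

End nonlinearity.

(** * Variational argument *)

Lemma continuous_normr_powR (R : realType) (e : R) : 0 < e ->
  continuous (fun t : R => `|t| `^ e).
Proof.
move=> e0 t; have [->|t0] := eqVneq t 0.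
  apply/cvgrPdist_le => d d0; rewrite normr0 powR0 ?gt_eqF//.
  apply/nbhs_ballP; exists (d `^ e^-1) => /=; first exact: powR_gt0.
  move=> x; rewrite /ball/= !sub0r !normrN => xd.
  rewrite ger0_norm ?powR_ge0// -[leRHS]powRr1 ?(ltW d0)// -(mulVf (lt0r_neq0 e0)) powRrM.
  by rewrite ge0_ler_powR ?nnegrE ?(ltW e0) ?powR_ge0// ltW.
have t1 : 0 < `|t| by rewrite normr_gt0.
apply: (@continuous_comp _ _ _ (fun t : R => `|t|) (fun x => x `^ e)).
  exact: norm_continuous.
apply/differentiable_continuous/derivable1_diffP.
by apply: derivable_powR; rewrite in_itv/= t1.
Qed.

Lemma powR_normr_gt0 (R : realType) (e t : R) : t != 0 -> 0 < `|t| `^ e.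
Proof. by move=> t0; rewrite powR_gt0// normr_gt0. Qed.

Lemma small_at_ends_bound_powR (R : realType) (a q b e : R) (G : R -> R) : 0 < b ->
  continuous G -> (forall t, G (- t) = G t) -> small_at_ends a q G -> 0 < e ->
  exists2 C, 0 <= C &
    forall t, G t <= e * (`|t| `^ (2 + a) + `|t| `^ q) + C * `|t| `^ b.
Proof.
move=> b0 Gc Ge Gs e0.
apply: (small_at_ends_bound Gc (continuous_normr_powR b0) Ge _ _
  (@powR_normr_gt0 R b) Gs e0) => t; [by rewrite normrN|exact: powR_ge0].
Qed.

(* Meant for F and Ftilde, with a = 4s/N and q = 2N/(N-2s). *)
Record energy_pair (R : realType) (a q : R) (F H : R -> R) : Prop := EnergyPair {
  ep_Fcont : continuous F;
  ep_Hcont : continuous H;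
  ep_Feven : forall t, F (- t) = F t;
  ep_Heven : forall t, H (- t) = H t;
  ep_F0 : F 0 = 0;
  ep_H0 : H 0 = 0;
  ep_Fgt0 : forall t, t != 0 -> 0 < F t;
  ep_Hgt0 : forall t, t != 0 -> 0 < H t;
  ep_tangent : forall t c : R, 0 < c ->
    F t + H t / a * (c `^ a - 1) <= F (c * t) / c ^+ 2;
  ep_F_le_H : forall t, F t <= H t / a;
  ep_H_le_F : forall t, H t <= (q - 2) * F t;
  ep_scale_ge : forall c t : R, 1 <= c -> c `^ (2 + a) * F t <= F (c * t);
  ep_scale_lt : forall k t : R, 1 < k -> t != 0 -> F (k * t) < k `^ q * F t;
  ep_near0 : forall M : R, exists2 d : R, 0 < d &
    forall t, `|t| < d -> M * `|t| `^ q <= F t;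
  ep_superlinear : forall e k : R, 0 < e -> 0 < k ->
    exists2 c0 : R, 1 <= c0 & forall c t : R, c0 <= c ->
    F t <= e * (`|t| `^ (2 + a) + `|t| `^ q) + k * (c `^ (- (2 + a)) * F (c * t));
  ep_Fends : small_at_ends a q F;
  ep_Hends : small_at_ends a q H }.

Section fibers.
Context {R : realType}.
Variables (N : nat) (s : R) (F H : R -> R).
Hypotheses (s_gt0 : 0 < s) (N_gt0 : (0 < N)%N) (N_gt2s : 2 * s < N%:R).
Implicit Types (u v w : Rn R N -> R) (c k m M K X : R) (G W : R -> R).

Local Notation q := (2 * N%:R / (N%:R - 2 * s)).
Local Notation a := (4 * s / N%:R).
Local Notation A := (seminorm2 s).

Hypothesis FH : energy_pair a q F H.

Let N0 : 0 < N%:R :> R. Proof. by rewrite ltr0n. Qed.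
Let N2s0 : 0 < N%:R - 2 * s. Proof. by rewrite subr_gt0. Qed.

Lemma mass_exp_gt0 : 0 < a.
Proof. by rewrite divr_gt0// mulr_gt0. Qed.

Lemma mass_exp_lt_crit : 2 + a < q.
Proof.
rewrite -subr_gt0 (_ : _ - _ = 8 * s ^+ 2 / (N%:R * (N%:R - 2 * s))).
  by rewrite divr_gt0 ?mulr_gt0 ?exprn_gt0.
by field; rewrite !gt_eqF.
Qed.

Let a0 := mass_exp_gt0.
Let aq := mass_exp_lt_crit.

Let q0 : 0 < q. Proof. exact: crit_exp_gt0. Qed.
Let q2 : 2 < q. Proof. exact: crit_exp_gt2. Qed.

Lemma ep_Fge0 t : 0 <= F t.
Proof. by have [->|/(ep_Fgt0 FH)/ltW//] := eqVneq t 0; rewrite (ep_F0 FH). Qed.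

Lemma ep_Hge0 t : 0 <= H t.
Proof. by have [->|/(ep_Hgt0 FH)/ltW//] := eqVneq t 0; rewrite (ep_H0 FH). Qed.

Lemma growth_p : growth N s (fun t => `|t| `^ (2 + a)).
Proof. by apply: growth_powR; [rewrite lerDl ltW|exact: ltW]. Qed.

Lemma growth_q : growth N s (fun t => `|t| `^ q).
Proof. by apply: growth_powR => //; exact: ltW. Qed.

Lemma small_at_ends_growth G : continuous G -> (forall t, G (- t) = G t) ->
  (forall t, 0 <= G t) -> small_at_ends a q G -> growth N s G.
Proof.
move=> Gc Ge G0 Gs.
have [C C0 GC] := small_at_ends_bound_powR q0 Gc Ge Gs ltr01.
apply: (@growth_le _ _ _ 1 G
  (fun t => 1 * (`|t| `^ (2 + a) + `|t| `^ q) + C * `|t| `^ q)).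
- exact: continuous_measurable_fun.
- apply: growthD; last exact: growthZ growth_q.
  by apply: growthZ; apply: growthD; [exact: growth_p|exact: growth_q].
- by move=> t; rewrite mul1r ger0_norm// (le_trans (GC t))// ler_norm.
Qed.

Lemma growth_F : growth N s F.
Proof.
apply: small_at_ends_growth; [exact: (ep_Fcont FH)|exact: (ep_Feven FH)|
  exact: ep_Fge0|exact: (ep_Fends FH)].
Qed.

Lemma growth_H : growth N s H.
Proof.
apply: small_at_ends_growth; [exact: (ep_Hcont FH)|exact: (ep_Heven FH)|
  exact: ep_Hge0|exact: (ep_Hends FH)].
Qed.

(** * Mass-preserving fibers and the Pohozaev manifold *)

Definition fiber c u : Rn R N -> R := rescale c (c `^ (- (2 / N%:R))) u.

Let r_gt0 c : 0 < c -> 0 < c `^ (- (2 / N%:R)).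
Proof. exact: powR_gt0. Qed.

Let rN c : 0 < c -> (c `^ (- (2 / N%:R))) ^+ N = (c ^+ 2)^-1.
Proof.
move=> c0; rewrite -powR_mulrn ?powR_ge0// -powRrM -[c ^+ 2](powR_mulrn 2 (ltW c0)).
by rewrite -powRN; congr (_ `^ _); field; rewrite gt_eqF.
Qed.

Lemma Hs_fiber c u : 0 < c -> Hs s u -> Hs s (fiber c u).
Proof. by move=> c0; apply: Hs_rescale; exact: r_gt0. Qed.

Lemma mass_fiber c u : 0 < c -> Hs s u -> mass (fiber c u) = mass u.
Proof.
move=> c0 Hu; rewrite (mass_rescale _ (r_gt0 c0) Hu) rN// divff ?mul1r//.
by rewrite expf_eq0/= gt_eqF.
Qed.

Lemma seminorm2_fiber c u : 0 < c -> Hs s u -> A (fiber c u) = c `^ a * A u.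
Proof.
move=> c0 Hu; rewrite (seminorm2_rescale _ (r_gt0 c0) Hu); congr (_ * _).
rewrite -powRrM -[c ^+ 2](powR_mulrn 2 (ltW c0)) -gt0_powRD//.
by congr (_ `^ _); field; rewrite gt_eqF.
Qed.

Lemma itg_fiber G c u : 0 < c -> Hs s u -> growth N s G -> (forall t, 0 <= G t) ->
  itg G (fiber c u) = (c ^+ 2)^-1 * itg (fun t => G (c * t)) u.
Proof.
by move=> c0 Hu gG G0; rewrite (itg_rescale s_gt0 N_gt0 N_gt2s _ (r_gt0 c0) Hu gG G0) rN.
Qed.

Lemma fiber_comp c c' u : 0 < c -> 0 < c' -> fiber c (fiber c' u) = fiber (c * c') u.
Proof.
by move=> c0 c'0; rewrite /fiber rescale_comp -powRM ?(ltW c0)// ltW.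
Qed.

Lemma fiber1 u : fiber 1 u = u.
Proof. by rewrite /fiber powR1 rescale1. Qed.

Definition en u : R := A u / 2 - itg F u.

(** The coefficient [2 / a] is N/(2s), because a = 4s/N. *)
Definition on_manifold m u := [/\ Hs s u, mass u = m & A u = 2 / a * itg H u].

Lemma en_fiber c u : 0 < c -> Hs s u ->
  en (fiber c u) = c `^ a * A u / 2 - (c ^+ 2)^-1 * itg (fun t => F (c * t)) u.
Proof.
move=> c0 Hu; rewrite /en seminorm2_fiber// itg_fiber//; first exact: growth_F.
exact: ep_Fge0.
Qed.

Lemma itg_tangent c u : 0 < c -> Hs s u ->
  itg F u + itg H u / a * (c `^ a - 1) <= itg F (fiber c u).
Proof.
move=> c0 Hu; rewrite itg_fiber//; [|exact: growth_F|exact: ep_Fge0].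
have gFc := growth_comp c growth_F.
rewrite -(itgZ s_gt0 N_gt0 N_gt2s _ Hu gFc).
rewrite [X in _ + X](_ : _ = (c `^ a - 1) / a * itg H u); last by ring.
rewrite -(itgZ s_gt0 N_gt0 N_gt2s _ Hu growth_H).
have gH := growthZ ((c `^ a - 1) / a) growth_H.
rewrite -(itgD s_gt0 N_gt0 N_gt2s Hu growth_F gH).
apply: (ler_itg s_gt0 N_gt0 N_gt2s Hu).
- exact: growthD growth_F gH.
- exact: growthZ gFc.
- move=> t /=; have := ep_tangent FH t c0; rewrite [F (c * t) / _]mulrC.
  by apply: le_trans; rewrite le_eqVlt; apply/orP; left; apply/eqP; ring.
Qed.

(** On the manifold the slope [itg H u / a] of the tangent line equals [A u / 2], the coefficient of
    c^a in the kinetic term, so the two contributions cancel and only [en u] remains. *)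
Lemma en_fiber_le m c u : 0 < c -> on_manifold m u -> en (fiber c u) <= en u.
Proof.
move=> c0 [Hu _ uP]; have := itg_tangent c0 Hu; rewrite /en seminorm2_fiber//.
have -> : itg H u / a = A u / 2 by rewrite uP; field; rewrite !gt_eqF.
lra.
Qed.

Lemma itg_le_add G G1 W e C u : Hs s u -> growth N s G -> growth N s G1 ->
  growth N s W -> (forall t, G t <= e * G1 t + C * W t) ->
  itg G u <= e * itg G1 u + C * itg W u.
Proof.
move=> Hu gG g1 gW h; have g1e := growthZ e g1; have gWC := growthZ C gW.
rewrite -(itgZ s_gt0 N_gt0 N_gt2s e Hu g1) -(itgZ s_gt0 N_gt0 N_gt2s C Hu gW).
rewrite -(itgD s_gt0 N_gt0 N_gt2s Hu g1e gWC).
exact: (ler_itg s_gt0 N_gt0 N_gt2s Hu gG (growthD g1e gWC)).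
Qed.

Definition sobolev_bound M r : R :=
  (GN_const N s 2)^-1 * M `^ (2 * s / N%:R) * r +
  ((GN_const N s q)^-1 * r) `^ (q / 2).

Local Notation pq := (fun t : R => `|t| `^ (2 + a) + `|t| `^ q).

Lemma growth_pq : growth N s pq.
Proof. exact: growthD growth_p growth_q. Qed.

Lemma itg_pq_le M r u : Hs s u -> 0 < mass u <= M -> A u <= r ->
  itg pq u <= sobolev_bound M r.
Proof.
move=> Hu /andP[u0 uM] Ar; rewrite (itgD s_gt0 N_gt0 N_gt2s Hu growth_p growth_q).
have g2 : 0 < (GN_const N s 2)^-1 by rewrite invr_gt0 GN_const_gt0.
have gq : 0 < (GN_const N s q)^-1 by rewrite invr_gt0 GN_const_gt0.
have A0 := seminorm2_ge0 s u.
have r0 := le_trans A0 Ar.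
have h1 := itg_mass_le s_gt0 N_gt0 N_gt2s Hu u0.
have h2 := itg_crit_le s_gt0 N_gt0 N_gt2s Hu.
have b0 : 0 <= 2 * s / N%:R by rewrite divr_ge0// mulr_ge0// ltW.
have q20 : 0 <= q / 2 by rewrite divr_ge0// ltW.
have mM : mass u `^ (2 * s / N%:R) <= M `^ (2 * s / N%:R).
  apply: (ge0_ler_powR b0) => //; rewrite nnegrE ?(ltW u0)//.
  exact: le_trans (ltW u0) uM.
apply: lerD.
  apply: (le_trans h1); apply: (ler_pM _ A0 (ler_wpM2l (ltW g2) mM) Ar).
  exact: (mulr_ge0 (ltW g2) (powR_ge0 _ _)).
apply: (le_trans h2); apply: (ge0_ler_powR q20 _ _ (ler_wpM2l (ltW gq) Ar)).
- by rewrite nnegrE; exact: (mulr_ge0 (ltW gq) A0).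
- by rewrite nnegrE; exact: (mulr_ge0 (ltW gq) r0).
Qed.

(** As [en (fiber c w)] is c^a times [A w / 2] minus the quantity bounded here, large c makes the
    energy negative uniformly in [w]. The hypothesis [k <= itg F w] excludes spreading functions. In
    [ep_superlinear] the first term is tuned to cost at most k/2; the second then carries the other
    half, whence the coefficient k/2/X. *)
Lemma superlinear_itg M r k X : 0 < k -> 0 < X ->
  exists2 c0 : R, 1 <= c0 & forall w c, Hs s w -> 0 < mass w <= M -> A w <= r ->
    k <= itg F w -> c0 <= c ->
    X <= c `^ (- (2 + a)) * itg (fun t => F (c * t)) w.
Proof.
move=> k0 X0; pose B := `|sobolev_bound M r| + 1.
have B0 : 0 < B by rewrite ltr_pwDr.
have e0 : 0 < k / 2 / B by rewrite !divr_gt0.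
have kX0 : 0 < k / 2 / X by rewrite !divr_gt0.
have [c0 c01 c0P] := ep_superlinear FH e0 kX0.
exists c0 => // w c Hw wM wr kw cc0.
have gFc := growth_comp c growth_F.
have gW := growthZ (c `^ (- (2 + a))) gFc.
have := itg_le_add Hw growth_F growth_pq gW (c0P c ^~ cc0).
rewrite (itgZ s_gt0 N_gt0 N_gt2s _ Hw gFc); set Y := (c `^ _ * _) => h.
have h2 : k / 2 / B * itg pq w <= k / 2.
  rewrite -mulrA ler_piMr ?divr_ge0 ?(ltW k0)// ler_pdivrMl// mulr1.
  rewrite (le_trans (itg_pq_le Hw wM wr))// (le_trans (ler_norm _))// lerDl.
  exact: ler01.
have {h h2} h := le_trans kw (le_trans h (lerD h2 (lexx _))).
have : k / 2 <= k / 2 / X * Y by lra.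
by rewrite -mulrA ler_pMr ?divr_gt0// ler_pdivlMl// mulr1.
Qed.

(** Dominated convergence on ]0, c + 1[: the growth bound of [H], taken at the scale T = c + 1, is
    an integrable majorant. *)
Lemma itg_dilation_continuous u : Hs s u ->
  forall c, 0 < c -> {for c, continuous (fun c => itg (fun t => H (c * t)) u)}.
Proof.
move=> Hu c c0; have [_ [C C0 HC]] := growth_H; have [mu_ _ _] := (HsP s u).1 Hu.
pose T := c + 1; pose g (t : R) := C * (T ^+ 2 * `|t| `^ 2 + T `^ q * `|t| `^ q).
have T0 : 0 < T by rewrite addr_gt0.
have gg : growth N s g.
  apply: growthZ; apply: growthD; apply: growthZ; last exact: growth_q.
  by apply: growth_powR => //; exact: ltW.
have int_f (x : R) : `]0, T[%classic x ->
    (lebesgueN N).-integrable setT (EFin \o (fun y => H (x * u y))).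
  move=> _; exact: (growth_integrable s_gt0 N_gt0 N_gt2s Hu (growth_comp x growth_H)).
have ig : (lebesgueN N).-integrable setT (EFin \o (fun y => g (u y))).
  exact: (growth_integrable s_gt0 N_gt0 N_gt2s Hu gg).
have cf : {ae lebesgueN N, forall y, setT y ->
    {in `]0, T[%classic, continuous ((fun x y => H (x * u y)) ^~ y)}}.
  apply: aeW => y _ x _; apply: continuous_comp; last exact: (ep_Hcont FH).
  exact: mulrr_continuous.
have g_ub (x : R) : `]0, T[%classic x ->
    {ae lebesgueN N, forall y, setT y -> `|H (x * u y)| <= g (u y)}.
  rewrite /= in_itv/= => /andP[x0 xT]; apply: aeW => y _.
  apply: (le_trans (HC _)); rewrite /g ler_wpM2l// normrM (gtr0_norm x0).
  rewrite exprMn powRM ?(ltW x0)// powR_mulrn//; apply: lerD.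
    by rewrite ler_wpM2r ?exprn_ge0// lerXn2r ?nnegrE ?(ltW x0) ?(ltW T0) ?(ltW xT).
  rewrite ler_wpM2r ?powR_ge0// ge0_ler_powR ?nnegrE ?(ltW q0) ?(ltW x0) ?(ltW T0)//.
  exact: ltW.
have := continuity_under_integral measurableT int_f cf ig g_ub.
by apply; rewrite inE/= in_itv/= c0 ltrDl ltr01.
Qed.

(** Intermediate value theorem for [D], which is c^(-a) times the Pohozaev functional of
    [fiber c u]. For large c it is nonpositive by superlinearity and [ep_F_le_H]; for small c it is
    nonnegative because [H] is small compared with |t|^(2+a) near 0. *)
Lemma exists_fiber_manifold u : Hs s u -> 0 < mass u ->
  exists2 c, 0 < c & on_manifold (mass u) (fiber c u).
Proof.
move=> Hu u0.
have Au : 0 < A u by exact: seminorm2_gt0.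
have Fu : 0 < itg F u.
  apply: (itg_gt0 s_gt0 N_gt0 N_gt2s Hu growth_F) => //; first exact: ep_Fge0.
  exact: (ep_Fgt0 FH).
pose D c := A u - 2 / a * (c `^ (- (2 + a)) * itg (fun t => H (c * t)) u).
suff [c c0 Dc] : exists2 c, 0 < c & D c = 0.
  exists c => //; split; [exact: Hs_fiber|exact: mass_fiber|].
  rewrite seminorm2_fiber// itg_fiber//; [|exact: growth_H|exact: ep_Hge0].
  have -> : A u = 2 / a * (c `^ (- (2 + a)) * itg (fun t => H (c * t)) u).
    exact: subr0_eq.
  rewrite powRN (gt0_powRD _ _ c0) powR_mulrn ?(ltW c0)//.
  by field; rewrite !gt_eqF ?powR_gt0.
have [T T1 TP] := superlinear_itg (mass u) (A u) Fu Au.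
have DT : D T <= 0.
  have T0 : 0 < T by rewrite (lt_le_trans ltr01).
  have := TP u T Hu; rewrite u0 lexx => /(_ isT (lexx _) (lexx _) (lexx _)) h.
  have : itg (fun t => F (T * t)) u <= a^-1 * itg (fun t => H (T * t)) u.
    rewrite -(itgZ s_gt0 N_gt0 N_gt2s _ Hu (growth_comp T growth_H)).
    apply: (ler_itg s_gt0 N_gt0 N_gt2s Hu (growth_comp T growth_F)).
      exact: growthZ (growth_comp T growth_H).
    by move=> t; rewrite [leRHS]mulrC; exact: (ep_F_le_H FH).
  move/(ler_wpM2l (powR_ge0 T (- (2 + a)))) => /(le_trans h); rewrite /D.
  set I := itg _ u; set p := T `^ _; rewrite mulrCA => h2.
  have -> : 2 / a * (p * I) = 2 * (a^-1 * (p * I)) by ring.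
  by move: (a^-1 * (p * I)) h2 => z; lra.
(* The two error terms in [small] each get the budget [A u * a / 8], so that 2/a times their sum
   stays below [A u]. *)
pose e : R := A u * a / 8 / (itg pq u + 1).
have pq0 : 0 <= itg pq u by apply: itg_ge0 => t; rewrite addr_ge0 ?powR_ge0.
have pq1 : 0 < itg pq u + 1 by rewrite ltr_pwDr.
have e0 : 0 < e by rewrite divr_gt0// divr_gt0// mulr_gt0.
have [C C0 HC] := small_at_ends_bound_powR q0 (ep_Hcont FH) (ep_Heven FH)
  (ep_Hends FH) e0.
have small c : 0 < c -> c <= 1 ->
    c `^ (- (2 + a)) * itg (fun t => H (c * t)) u <=
    e * itg pq u + C * c `^ (q - (2 + a)) * itg (fun t => `|t| `^ q) u.
  move=> c0 c1; rewrite -(itgZ s_gt0 N_gt0 N_gt2s _ Hu (growth_comp c growth_H)).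
  apply: (itg_le_add Hu _ growth_pq growth_q).
    exact: growthZ (growth_comp c growth_H).
  move=> t; rewrite powRN ler_pdivrMl ?powR_gt0//; apply: (le_trans (HC _)).
  rewrite normrM (gtr0_norm c0) !powRM ?(ltW c0)//.
  have cq : c `^ q = c `^ (2 + a) * c `^ (q - (2 + a)).
    by rewrite -gt0_powRD//; congr (_ `^ _); ring.
  have cq1 : c `^ (q - (2 + a)) <= 1.
    rewrite -[leRHS](powRr0 c); apply: ger_powR; first by rewrite c0.
    by rewrite subr_ge0 ltW.
  rewrite cq; move: (powR_ge0 c (2 + a)) (powR_ge0 `|t| q) cq1.
  move: (c `^ (2 + a)) (c `^ (q - (2 + a))) (`|t| `^ q) (`|t| `^ (2 + a)) => x y z w x0 z0 y1.
  rewrite -subr_ge0 (_ : _ - _ = x * (e * z * (1 - y))); last by ring.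
  apply: (mulr_ge0 x0 (mulr_ge0 (mulr_ge0 (ltW e0) z0) _)).
  by rewrite subr_ge0.
pose Q := itg (fun t => `|t| `^ q) u.
have Q0 : 0 <= Q by apply: itg_ge0 => t; exact: powR_ge0.
pose d : R := A u * a / 8 / (C * Q + 1).
have CQ1 : 0 < C * Q + 1 by rewrite ltr_pwDr// mulr_ge0.
have d0 : 0 < d by rewrite divr_gt0// divr_gt0// mulr_gt0.
have qp0 : 0 < q - (2 + a) by rewrite subr_gt0.
have [c1 c10 [c11 c1d]] : exists2 c1 : R, 0 < c1 & c1 <= 1 /\ c1 `^ (q - (2 + a)) <= d.
  exists (Num.min 1 (d `^ (q - (2 + a))^-1)); first by rewrite lt_min ltr01 powR_gt0.
  split; first by rewrite ge_min lexx.
  have dE : d = (d `^ (q - (2 + a))^-1) `^ (q - (2 + a)).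
    by rewrite -powRrM mulVf ?gt_eqF// powRr1// ltW.
  rewrite [leRHS]dE; apply: (ge0_ler_powR (ltW qp0)).
  - by rewrite nnegrE le_min ler01 powR_ge0.
  - by rewrite nnegrE powR_ge0.
  - by rewrite ge_min lexx orbT.
have D1 : 0 <= D c1.
  have := small c1 c10 c11.
  have h1 : e * itg pq u <= A u * a / 8.
    by rewrite /e -mulrA ler_piMr ?ler_pdivrMl ?mulr1 ?lerDl// ltW// divr_gt0// mulr_gt0.
  have h2 : C * c1 `^ (q - (2 + a)) * Q <= A u * a / 8.
    rewrite mulrAC; apply: le_trans (ler_wpM2l _ c1d) _; first by rewrite mulr_ge0.
    rewrite /d mulrCA ler_piMr//; first by rewrite ltW// divr_gt0// mulr_gt0.
    by rewrite ler_pdivrMr// mul1r lerDl.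
  rewrite /D -/Q; move: (_ * itg (fun t => H (c1 * t)) u) => z h3.
  have z4 : z <= A u * a / 4.
    by move: (A u * a) h1 h2 h3 => *; lra.
  have z2 : 2 * z <= A u * a.
    by move: (A u * a) (mulr_gt0 Au a0) z4 => *; lra.
  by rewrite subr_ge0 (_ : 2 / a * z = 2 * z / a) ?ler_pdivrMr// mulrAC.
have c1T : c1 <= T by exact: le_trans c11 T1.
have Dcont : {within `[c1, T], continuous D}.
  apply: continuous_in_subspaceT => c; rewrite inE/= in_itv/= => /andP[c1c _].
  have c0 : 0 < c := lt_le_trans c10 c1c.
  have cp : {for c, continuous (fun x : R => x `^ (- (2 + a)))}.
    apply/differentiable_continuous/derivable1_diffP.
    by apply: derivable_powR; rewrite in_itv/= c0.
  apply: cvgB; first exact: cvg_cst.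
  apply: cvgM; first exact: cvg_cst.
  by apply: cvgM; [exact: cp|exact: itg_dilation_continuous].
have Dmm : Num.min (D c1) (D T) <= 0 <= Num.max (D c1) (D T).
  by rewrite ge_min DT orbT le_max D1.
have [c] := IVT c1T Dcont Dmm; rewrite in_itv/= => /andP[c1c _] Dc.
by exists c => //; exact: lt_le_trans c1c.
Qed.

(** Comparison on the values of [u] only, since the bound of [ep_near0] is available for small
    arguments alone. *)
Lemma ler_itg_pointwise G1 G2 u : Hs s u -> growth N s G1 -> growth N s G2 ->
  (forall x, G1 (u x) <= G2 (u x)) -> itg G1 u <= itg G2 u.
Proof.
by move=> Hu g1 g2 G12; apply: le_Rintegral => //;
  exact: (growth_integrable s_gt0 N_gt0 N_gt2s).
Qed.

(** * Dilations and the infimum of the energy *)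

Definition dilation k u : Rn R N -> R := rescale 1 (k `^ N%:R^-1) u.

Let dN k : 0 < k -> (k `^ N%:R^-1) ^+ N = k.
Proof.
move=> k0; rewrite -powR_mulrn ?powR_ge0// -powRrM mulVf ?powRr1 ?(ltW k0)//.
by rewrite gt_eqF.
Qed.

Lemma Hs_dilation k u : 0 < k -> Hs s u -> Hs s (dilation k u).
Proof. by move=> k0; apply: Hs_rescale; exact: powR_gt0. Qed.

Lemma mass_dilation k u : 0 < k -> Hs s u -> mass (dilation k u) = k * mass u.
Proof.
move=> k0 Hu; rewrite (mass_rescale _ (powR_gt0 _ k0) Hu) dN//.
by rewrite expr1n mul1r.
Qed.

(** The factor k, common to mass and potential energy, is kept apart from k^(-2s/N): the latter is
    close to 1 when the mass changes little and tends to 0 as k grows. These two regimes give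
    continuity and the limit at infinity. *)
Lemma seminorm2_dilation k u : 0 < k -> Hs s u ->
  A (dilation k u) = k * k `^ (- (2 * s / N%:R)) * A u.
Proof.
move=> k0 Hu; rewrite (seminorm2_rescale _ (powR_gt0 _ k0) Hu) expr1n mul1r.
congr (_ * _); rewrite -powRrM -{2}(powRr1 (ltW k0)) -gt0_powRD//.
by congr (_ `^ _); field; rewrite gt_eqF.
Qed.

Lemma itg_dilation G k u : 0 < k -> Hs s u -> growth N s G -> (forall t, 0 <= G t) ->
  itg G (dilation k u) = k * itg G u.
Proof.
move=> k0 Hu gG G0.
rewrite (itg_rescale s_gt0 N_gt0 N_gt2s _ (powR_gt0 _ k0) Hu gG G0) dN//.
by congr (_ * itg _ _); apply/funext => t; rewrite mul1r.
Qed.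

Definition ground_energy m : \bar R :=
  ereal_inf [set (en u)%:E | u in on_manifold m].
Local Notation E := ground_energy.

Lemma ground_energy_le m u : on_manifold m u -> (E m <= (en u)%:E)%E.
Proof. by move=> um; apply: ereal_inf_lbound; exists u. Qed.

Lemma ground_energy_ge m K : (forall u, on_manifold m u -> K <= en u) ->
  (K%:E <= E m)%E.
Proof. by move=> h; apply: le_ereal_inf_tmp => _ [u um <-]; rewrite lee_fin; exact: h. Qed.

(** The upper half of the minimax characterization: a competitor off the manifold is handled by
    bounding the energy along its whole fiber, wherever the fiber crosses the manifold. *)
Lemma ground_energy_le_fibers m u K : 0 < m -> Hs s u -> mass u = m ->
  (forall c, 0 < c -> en (fiber c u) <= K) -> (E m <= K%:E)%E.
Proof.
move=> m0 Hu um h; have u0 : 0 < mass u by rewrite um.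
have [c c0 cu] := exists_fiber_manifold Hu u0.
rewrite um in cu; apply: (le_trans (ground_energy_le cu)).
by rewrite lee_fin h.
Qed.

(** * Lower bounds for the energy on the manifold *)

Lemma exists_fiber_seminorm2 u r : Hs s u -> 0 < mass u -> 0 < r ->
  exists2 c, 0 < c & A (fiber c u) = r.
Proof.
move=> Hu u0 r0; have Au := seminorm2_gt0 s_gt0 N_gt0 N_gt2s Hu u0.
have rA : 0 < r / A u by rewrite divr_gt0.
exists ((r / A u) `^ a^-1); first exact: powR_gt0.
rewrite seminorm2_fiber ?powR_gt0// -powRrM mulVf ?gt_eqF// powRr1 ?(ltW rA)//.
by rewrite divfK// gt_eqF.
Qed.

(** By [en_fiber_le], moving u along its fiber cannot raise the energy, so the seminorm may be set
    to any chosen value r before the two inequalities are applied. The bound then depends on u only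
    through its mass. *)
Lemma en_ge m u al be r : 0 < m -> 0 <= al -> 0 <= be -> 0 < r ->
  (forall t, F t <= al * `|t| `^ (2 + a) + be * `|t| `^ q) ->
  on_manifold m u ->
  r / 2 - (al * ((GN_const N s 2)^-1 * m `^ (2 * s / N%:R) * r) +
           be * ((GN_const N s q)^-1 * r) `^ (q / 2)) <= en u.
Proof.
move=> m0 al0 be0 r0 Fab um; have [Hu mu_ _] := um.
have u0 : 0 < mass u by rewrite mu_.
have [c c0 cr] := exists_fiber_seminorm2 Hu u0 r0.
apply: le_trans (en_fiber_le c0 um); set w := fiber c u.
have Hw : Hs s w by exact: Hs_fiber.
have mw : mass w = m by rewrite mass_fiber.
have w0 : 0 < mass w by rewrite mw.
have := itg_le_add Hw growth_F growth_p growth_q Fab.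
have := ler_wpM2l al0 (itg_mass_le s_gt0 N_gt0 N_gt2s Hw w0).
have := ler_wpM2l be0 (itg_crit_le s_gt0 N_gt0 N_gt2s Hw).
rewrite /en cr mw.
set x1 := al * (_ * r); set x2 := be * _ `^ (q / 2).
by set y1 := al * _; set y2 := be * _; lra.
Qed.

(** The small coefficient sits on the mass-critical power here, which serves bounded masses, and on
    the Sobolev-critical power in [F_bound_q], which serves small masses. *)
Lemma F_bound_p e : 0 < e -> exists2 C, 0 < C &
  forall t, F t <= e * `|t| `^ (2 + a) + C * `|t| `^ q.
Proof.
move=> e0; have [C C0 h] := small_at_ends_bound_powR q0 (ep_Fcont FH) (ep_Feven FH)
  (ep_Fends FH) e0.
exists (e + C); first by rewrite ltr_pwDl.
move=> t; apply: (le_trans (h t)); rewrite le_eqVlt; apply/orP; left; apply/eqP; ring.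
Qed.

Lemma F_bound_q e : 0 < e -> exists2 C, 0 < C &
  forall t, F t <= C * `|t| `^ (2 + a) + e * `|t| `^ q.
Proof.
move=> e0; have p0 : 0 < 2 + a by rewrite addr_gt0.
have [C C0 h] := small_at_ends_bound_powR p0 (ep_Fcont FH) (ep_Feven FH)
  (ep_Fends FH) e0.
exists (e + C); first by rewrite ltr_pwDl.
move=> t; apply: (le_trans (h t)); rewrite le_eqVlt; apply/orP; left; apply/eqP; ring.
Qed.

Let g2 : 0 < (GN_const N s 2)^-1. Proof. by rewrite invr_gt0 GN_const_gt0. Qed.
Let gq : 0 < (GN_const N s q)^-1. Proof. by rewrite invr_gt0 GN_const_gt0. Qed.
Let b0 : 0 < 2 * s / N%:R. Proof. by rewrite divr_gt0// mulr_gt0. Qed.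

Lemma exists_small_powR k e : 0 < k -> 0 < e ->
  exists2 m : R, 0 < m & forall x : R, 0 < x -> x <= m -> x `^ k <= e.
Proof.
move=> k0 e0; exists (e `^ k^-1); first exact: powR_gt0.
move=> x x0 xm; rewrite -[leRHS]powRr1 ?(ltW e0)// -(mulVf (lt0r_neq0 k0)) powRrM.
by apply: (ge0_ler_powR (ltW k0)) => //; rewrite nnegrE ?powR_ge0// ltW.
Qed.

(** With r = 4K the kinetic part is 2K and each error may cost K/2. The Sobolev term ignores the
    mass, so its coefficient is made small first; the other term carries m^(2s/N), which tends to
    0. *)
Lemma en_ge_small_mass K : 0 < K -> exists2 m0, 0 < m0 &
  forall m u, 0 < m -> m <= m0 -> on_manifold m u -> K <= en u.
Proof.
move=> K0; pose r := 4 * K; have r0 : 0 < r by rewrite mulr_gt0.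
pose S := ((GN_const N s q)^-1 * r) `^ (q / 2).
have S0 : 0 < S by apply: powR_gt0; exact: (mulr_gt0 gq r0).
have be0 : 0 < K / 2 / S by rewrite !divr_gt0.
have [al al0 Fab] := F_bound_q be0.
have g20 : 0 < al * (GN_const N s 2)^-1 * r := mulr_gt0 (mulr_gt0 al0 g2) r0.
have e0 : 0 < K / 2 / (al * (GN_const N s 2)^-1 * r) by rewrite divr_gt0// divr_gt0.
have [m0 m00 m0P] := exists_small_powR b0 e0.
exists m0 => // m u mgt mm0 um.
have := en_ge mgt (ltW al0) (ltW be0) r0 Fab um.
rewrite -/S divfK ?gt_eqF//; apply: le_trans.
have := m0P m mgt mm0; rewrite ler_pdivlMr//.
rewrite mulrC (_ : _ * _ `^ _ = al * ((GN_const N s 2)^-1 * m `^ (2 * s / N%:R) * r)); last by ring.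
by rewrite /r; set z := al * _; lra.
Qed.

(** For masses up to [M] the mass-critical term is linear in r and is made at most r/8 by its
    coefficient; the Sobolev term is of order r^(q/2) with q/2 > 1 and falls below r/8 for small r.
    What remains of r/2 is r/4. *)
Lemma en_ge_pos M : 0 < M -> exists2 x0, 0 < x0 &
  forall m u, 0 < m -> m <= M -> on_manifold m u -> x0 <= en u.
Proof.
move=> M0; have Mb : 0 < (GN_const N s 2)^-1 * M `^ (2 * s / N%:R).
  exact: (mulr_gt0 g2 (powR_gt0 _ M0)).
have al0 : 0 < 8^-1 / ((GN_const N s 2)^-1 * M `^ (2 * s / N%:R)).
  by rewrite divr_gt0// invr_gt0.
have [be be0 Fab] := F_bound_p al0.
have q20 : 0 < q / 2 - 1 by rewrite subr_gt0 ltr_pdivlMr// mul1r.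
pose Q := (GN_const N s q)^-1 `^ (q / 2).
have Q0 : 0 < Q by apply: powR_gt0.
have e0 : 0 < 8^-1 / (be * Q) by rewrite divr_gt0 ?invr_gt0// mulr_gt0.
have [r r0 rP] := exists_small_powR q20 e0.
exists (r / 4); first by rewrite divr_gt0.
move=> m u m0 mM um.
have := en_ge m0 (ltW al0) (ltW be0) r0 Fab um; apply: le_trans.
have h1 : be * ((GN_const N s q)^-1 * r) `^ (q / 2) <= r / 8.
  rewrite (powRM _ (ltW gq) (ltW r0)) -/Q.
  have -> : r `^ (q / 2) = r `^ (q / 2 - 1) * r.
    transitivity (r `^ (q / 2 - 1) * r `^ 1); last by rewrite powRr1// ltW.
    by rewrite -gt0_powRD//; congr (_ `^ _); ring.
  have h := rP r r0 (lexx _).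
  rewrite (_ : be * _ = r `^ (q / 2 - 1) * (be * Q) * r); last by ring.
  rewrite [leRHS]mulrC; apply: (ler_wpM2r (ltW r0)).
  by rewrite -ler_pdivlMr// mulr_gt0.
have h2 : 8^-1 / ((GN_const N s 2)^-1 * M `^ (2 * s / N%:R)) *
    ((GN_const N s 2)^-1 * m `^ (2 * s / N%:R) * r) <= r / 8.
  rewrite mulrA [leRHS]mulrC; apply: (ler_wpM2r (ltW r0)).
  rewrite -mulrA ler_piMr ?invr_ge0// ler_pdivrMl// mulr1.
  apply: (ler_wpM2l (ltW g2)); apply: (ge0_ler_powR (ltW b0)) => //.
    by rewrite nnegrE ltW.
  by rewrite nnegrE ltW.
lra.
Qed.

Lemma seminorm2_ge_en m u : on_manifold m u -> 2 * en u <= A u.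
Proof.
move=> [Hu _ _]; have : 0 <= itg F u by apply: itg_ge0 => t; exact: ep_Fge0.
by rewrite /en; lra.
Qed.

(* A function of large seminorm on the manifold is a strongly concentrated
   rescaling of one of seminorm 4K: the superlinearity of F would make its
   energy negative. *)
Lemma seminorm2_le_of_en M K : 0 < M -> 0 < K -> exists2 L, 0 < L &
  forall m u, 0 < m -> m <= M -> on_manifold m u -> en u <= K -> A u <= L.
Proof.
move=> M0 K0; pose r := 4 * K; have r0 : 0 < r by rewrite mulr_gt0.
have [T T1 TP] := superlinear_itg M r K0 r0.
have [x0 x00 x0P] := en_ge_pos M0.
have T0 : 0 < T := lt_le_trans ltr01 T1.
have Ta1 : 1 <= T `^ a by rewrite -[leLHS](powRr0 T) ler_powR// ltW.
exists (T `^ a * r); first by rewrite mulr_gt0// powR_gt0.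
move=> m u m0 mM um uK; have [Hu mu_ _] := um.
have u0 : 0 < mass u by rewrite mu_.
have [c c0 cr] := exists_fiber_seminorm2 Hu u0 r0.
set w := fiber c u in cr; have Hw : Hs s w by exact: Hs_fiber.
have mw : mass w = m by rewrite mass_fiber.
have wF : K <= itg F w.
  by have := le_trans (en_fiber_le c0 um) uK; rewrite -/w /en cr /r; lra.
have cV0 : 0 < c^-1 by rewrite invr_gt0.
have uw : u = fiber c^-1 w by rewrite fiber_comp// mulVf ?gt_eqF// fiber1.
have Auw : A u = c^-1 `^ a * r by rewrite uw seminorm2_fiber// cr.
have [Tc|cT] := leP T c^-1; last first.
  rewrite Auw ler_pM2r//; apply: (ge0_ler_powR (ltW a0)); last exact: ltW.
    by rewrite nnegrE ltW.
  by rewrite nnegrE ltW.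
have /(_ _)/= := TP w c^-1 Hw; rewrite mw m0 mM cr => /(_ isT (lexx _) wF Tc) h.
have : en u < 0.
  rewrite uw en_fiber// cr.
  have -> : (c^-1 ^+ 2)^-1 = c^-1 `^ a * c^-1 `^ (- (2 + a)).
    rewrite -gt0_powRD// -[c^-1 ^+ 2](powR_mulrn 2 (ltW cV0)) -powRN.
    by congr (_ `^ _); ring.
  have := ler_wpM2l (powR_ge0 c^-1 a) h; set I := itg _ w.
  rewrite -(mulrA (c^-1 `^ a) _ I).
  have := mulr_gt0 (powR_gt0 a cV0) r0; set y := c^-1 `^ a * r.
  by set z := c^-1 `^ a * (_ * I); lra.
by have := x0P m u m0 mM um; lra.
Qed.

Lemma exists_manifold m : (exists2 u0 : Rn R N -> R, Hs s u0 & 0 < mass u0) -> 0 < m ->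
  exists u, on_manifold m u.
Proof.
move=> [u0 Hu0 u00] m0; have k0 : 0 < m / mass u0 by rewrite divr_gt0.
have mk : mass (dilation (m / mass u0) u0) = m.
  by rewrite mass_dilation// divfK// gt_eqF.
have [|c c0 h] := exists_fiber_manifold (Hs_dilation k0 Hu0); first by rewrite mk.
by exists (fiber c (dilation (m / mass u0) u0)); rewrite -[X in on_manifold X]mk.
Qed.

(* Among the rescalings x |-> k v(x / r) that keep the seminorm fixed, the one
   with k > 1 lowers the mass and raises the energy, because F(t) / |t|^q is
   decreasing. *)
Lemma en_mass_gain m1 m2 u : 0 < m1 -> m1 < m2 -> on_manifold m1 u ->
  exists2 v, on_manifold m2 v &
  en v + itg (fun t => F t - ((m2 / m1) `^ ((N%:R - 2 * s) / (4 * s))) `^ (- q) *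
    F ((m2 / m1) `^ ((N%:R - 2 * s) / (4 * s)) * t)) v <= en u.
Proof.
move=> m10 m12 um; have [Hu mu_ _] := um.
set th := m2 / m1; have m20 := lt_trans m10 m12.
have th0 : 0 < th by rewrite divr_gt0.
set k := th `^ _; have k0 : 0 < k by rewrite powR_gt0.
have mth : mass (dilation th u) = m2 by rewrite mass_dilation// mu_ divfK// gt_eqF.
have [|c c0] := exists_fiber_manifold (Hs_dilation th0 Hu); first by rewrite mth.
rewrite mth; set v := fiber c _ => vm; exists v => //.
have Hv : Hs s v by have [] := vm.
pose r : R := th `^ (- (2 * s)^-1); have r0 : 0 < r by rewrite powR_gt0.
have s2 : 2 * s != 0 by rewrite gt_eqF// mulr_gt0.
have Nr : N%:R != 0 :> R by rewrite gt_eqF.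
have sn : s != 0 by rewrite gt_eqF.
(* [v] lies on the fiber of a dilate of [u]; the rescaling by (k, r) undoes the dilation up to a
   fiber parameter and lands on the fiber of [u], where [en_fiber_le] applies. *)
have Eu : rescale k r v = fiber (k * c) u.
  have rk2 : r * th `^ N%:R^-1 = k `^ (- (2 / N%:R)).
    rewrite /r /k -gt0_powRD// -powRrM; congr (_ `^ _).
    by field; rewrite Nr sn.
  rewrite /v /fiber /dilation !rescale_comp mulr1.
  rewrite (_ : r * _ * _ = (k * c) `^ (- (2 / N%:R)))//.
  by rewrite powRM ?(ltW k0) ?(ltW c0)// -rk2 mulrAC.
have Ak : A (rescale k r v) = A v.
  rewrite (seminorm2_rescale _ r0 Hv) -[k ^+ 2](powR_mulrn 2 (ltW k0)).
  have e0 : (N%:R - 2 * s) / (4 * s) * 2 + - (2 * s)^-1 * (N%:R - 2 * s) = 0.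
    by field; rewrite sn.
  by rewrite /k /r -!powRrM -gt0_powRD// e0 powRr0 mul1r.
have rk : r ^+ N = k `^ (- q).
  rewrite -(powR_mulrn N (ltW r0)) /r /k -(powRrM th (- (2 * s)^-1)).
  rewrite -(powRrM th ((N%:R - 2 * s) / (4 * s))); congr (_ `^ _).
  by field; rewrite sn gt_eqF.
have gFk := growth_comp k growth_F.
have := en_fiber_le (mulr_gt0 k0 c0) um; rewrite -Eu; apply: le_trans.
rewrite (itgB s_gt0 N_gt0 N_gt2s Hv growth_F (growthZ _ gFk)).
rewrite (itgZ s_gt0 N_gt0 N_gt2s _ Hv gFk) /en Ak.
rewrite (itg_rescale s_gt0 N_gt0 N_gt2s _ r0 Hv growth_F ep_Fge0) rk.
by set x := itg F v; set y := _ * itg _ v; lra.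
Qed.

Lemma ground_energy_gap m1 m2 K : 0 < m1 -> m1 < m2 -> 0 < K ->
  exists2 d, 0 < d & forall u, on_manifold m1 u -> en u <= K ->
  exists2 v, on_manifold m2 v & en v + d <= en u.
Proof.
move=> m10 m12 K0; have m20 := lt_trans m10 m12.
(* The exponent is chosen so that the rescaling x |-> k v(x/r) with k^2 r^(N-2s) = 1 divides the
   mass by m2/m1, that is k^2 r^N = m1/m2. *)
set k := (m2 / m1) `^ ((N%:R - 2 * s) / (4 * s)).
have k1 : 1 < k.
  have e0 : 0 < (N%:R - 2 * s) / (4 * s) by rewrite divr_gt0// mulr_gt0.
  have := @gt0_ltr_powR R _ e0 1 (m2 / m1); rewrite powR1 !nnegrE; apply => //.
    by rewrite divr_ge0// ltW.
  by rewrite ltr_pdivlMr// mul1r.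
have k0 : 0 < k := lt_trans ltr01 k1.
pose D (t : R) := F t - k `^ (- q) * F (k * t).
have Dpos t : t != 0 -> 0 < D t.
  move=> t0; rewrite subr_gt0 powRN ltr_pdivrMl; first exact: (ep_scale_lt FH k1 t0).
  exact: (powR_gt0 q k0).
have D0 : forall t, 0 <= D t.
  move=> t; have [->|/Dpos/ltW//] := eqVneq t 0.
  by rewrite /D mulr0 (ep_F0 FH) mulr0 subrr.
have Deven : forall t, D (- t) = D t by move=> t; rewrite /D mulrN !(ep_Feven FH).
have Dcont : continuous D.
  move=> t; apply: cvgB; first exact: (ep_Fcont FH).
  apply: cvgM; first exact: cvg_cst.
  apply: (@continuous_comp _ _ _ (fun t => k * t) F); last exact: (ep_Fcont FH).
  exact: mulrl_continuous.
have gFk := growth_comp k growth_F.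
have gD : growth N s D.
  apply: (growth_le (C := 1) (continuous_measurable_fun Dcont) growth_F) => t.
  rewrite mul1r !ger0_norm ?ep_Fge0// gerBl mulr_ge0 ?powR_ge0//.
  exact: ep_Fge0.
have [L L0 LP] := seminorm2_le_of_en m20 K0.
have [x0 x00 xP] := en_ge_pos m20.
pose B := `|sobolev_bound m2 L| + 1.
have B0 : 0 < B by rewrite ltr_pwDr.
(* On the manifold the integral of [H] is a/2 times the seminorm, hence at least [x0 * a]. The error
   term is allowed half of this, and the other half must come from the gain [itg D v]. *)
have e0 : 0 < x0 * a / 2 / B by rewrite divr_gt0// divr_gt0// mulr_gt0.
have [C C0 HC] := small_at_ends_bound (ep_Hcont FH) Dcont (ep_Heven FH) Deven D0 Dpos
  (ep_Hends FH) e0.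
have C1 : 0 < C + 1 by rewrite ltr_pwDr.
exists (x0 * a / 2 / (C + 1)); first by rewrite divr_gt0// divr_gt0// mulr_gt0.
move=> u um uK; have [v vm vu] := en_mass_gain m10 m12 um.
rewrite -/k -/D in vu; exists v => //; apply: (le_trans _ vu); rewrite lerD2l.
have Dv0 : 0 <= itg D v by exact: itg_ge0.
have vK : en v <= K by apply: (le_trans _ uK); apply: (le_trans _ vu); rewrite lerDl.
have Av := LP _ _ m20 (lexx _) vm vK.
have xv := xP _ _ m20 (lexx _) vm.
have [Hv mv Pv] := vm.
have h1 := itg_le_add Hv growth_H growth_pq gD HC.
have mv2 : 0 < mass v <= m2 by rewrite mv m20 lexx.
have h2 : x0 * a / 2 / B * itg pq v <= x0 * a / 2.
  rewrite -mulrA ler_piMr//; first by rewrite ltW// divr_gt0// mulr_gt0.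
  rewrite ler_pdivrMl// mulr1 (le_trans (itg_pq_le Hv mv2 Av))//.
  by rewrite (le_trans (ler_norm _))// lerDl.
have h3 : x0 * a <= itg H v.
  have := seminorm2_ge_en vm; rewrite Pv => h.
  rewrite -ler_pdivlMr//.
  have e1 : 2 / a * itg H v = 2 * (itg H v / a) by rewrite mulrCA mulrA mulrC mulrA.
  by rewrite e1 in h; move: (itg H v / a) h => z h; lra.
rewrite ler_pdivrMr//.
have : C * itg D v <= itg D v * (C + 1) by rewrite mulrDr mulr1 mulrC lerDl.
have h4 := le_trans h3 (le_trans h1 (lerD h2 (lexx _))).
by move: (C * itg D v) (itg D v * _) h4 => x y; move: (x0 * a) => z; lra.
Qed.

(** With be = k^(-2s/N), the dilate of v has fiber energies k times those of v plus the excess (be -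
    1) c^a A(v)/2. For c up to T the excess is bounded through T; for c beyond T superlinearity
    makes the bracket nonpositive. One T serves all v of bounded energy, which yields a uniform
    modulus of continuity. *)
Lemma ground_energy_modulus m1 m2 K : 0 < m1 -> m1 <= m2 -> 0 < K ->
  exists2 X, 0 <= X & forall m k v, m1 <= m -> m <= m2 -> 0 < k -> k < 1 ->
    k `^ (- (2 * s / N%:R)) <= 2 -> on_manifold m v -> en v <= K ->
    (E (k * m) <= (en v + (k `^ (- (2 * s / N%:R)) - 1) * X)%:E)%E.
Proof.
move=> m10 m12 K0; have m20 := lt_le_trans m10 m12.
have [L L0 LP] := seminorm2_le_of_en m20 K0.
have [x0 x00 xP] := en_ge_pos m20.
have q20 : 0 < q - 2 by rewrite subr_gt0.
(* A lower bound for [itg F v]: the integral of [H] is at least [x0 * a] on the manifold, and H <=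
   (q - 2) F. *)
pose l : R := x0 * a / (q - 2).
have l0 : 0 < l by rewrite divr_gt0// mulr_gt0.
have [T T1 TP] := superlinear_itg m2 L l0 L0.
have T0 : 0 < T := lt_le_trans ltr01 T1.
exists (T `^ a * L / 2); first by rewrite !mulr_ge0 ?powR_ge0 ?(ltW L0).
move=> m k v m1m mm2 k0 k1 kb vm vK; have m0 := lt_le_trans m10 m1m.
have [Hv mv Pv] := vm.
have vL := LP m v m0 mm2 vm vK.
have xv := xP m v m0 mm2 vm.
have mv2 : 0 < mass v <= m2 by rewrite mv m0.
have A0 := seminorm2_ge0 s v.
have lF : l <= itg F v.
  have h1 : itg H v <= (q - 2) * itg F v.
    rewrite -(itgZ s_gt0 N_gt0 N_gt2s _ Hv growth_F).
    apply: (ler_itg s_gt0 N_gt0 N_gt2s Hv growth_H (growthZ _ growth_F)).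
    exact: (ep_H_le_F FH).
  have h := seminorm2_ge_en vm.
  have h2 : x0 * a <= itg H v.
    rewrite -ler_pdivlMr//.
    have e1 : 2 / a * itg H v = 2 * (itg H v / a) by rewrite mulrCA mulrA mulrC mulrA.
    by rewrite Pv e1 in h; move: (itg H v / a) h => z h; lra.
  by rewrite /l ler_pdivrMr// [itg F v * _]mulrC; exact: le_trans h2 h1.
set be := k `^ (- (2 * s / N%:R)).
have be1 : 1 <= be.
  rewrite /be powRN invf_ge1 ?powR_gt0//.
  have := @ge0_ler_powR R _ (ltW b0) k 1; rewrite powR1 !nnegrE => -> //; exact: ltW.
have mk : mass (dilation k v) = k * m by rewrite mass_dilation// mv.
apply: (ground_energy_le_fibers _ (Hs_dilation k0 Hv) mk); first exact: mulr_gt0.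
move=> c c0; rewrite en_fiber//; last exact: Hs_dilation.
rewrite seminorm2_dilation// (itg_dilation k0 Hv (growth_comp c growth_F)); last first.
  by move=> t; exact: ep_Fge0.
rewrite -/be; set I := itg (fun t => F (c * t)) v.
have ca0 : 0 < c `^ a by rewrite powR_gt0.
have RHS0 : 0 <= en v + (be - 1) * (T `^ a * L / 2).
  apply: addr_ge0; first exact: (le_trans (ltW x00) xv).
  rewrite mulr_ge0 ?subr_ge0//.
  by rewrite !mulr_ge0 ?powR_ge0 ?(ltW L0).
set J := c `^ a * A v / 2 - (c ^+ 2)^-1 * I + (be - 1) * (c `^ a * A v / 2).
have -> : c `^ a * (k * be * A v) / 2 - (c ^+ 2)^-1 * (k * I) = k * J.
  by rewrite /J; ring.
suff JR : J <= en v + (be - 1) * (T `^ a * L / 2).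
  have [J0|J0] := leP 0 J.
    by apply: le_trans JR; rewrite ler_piMl// ltW.
  by apply: le_trans RHS0; rewrite ltW// pmulr_rlt0.
have [cT|Tc] := leP c T.
  have h1 : c `^ a * A v / 2 - (c ^+ 2)^-1 * I <= en v.
    by have := en_fiber_le c0 vm; rewrite en_fiber.
  have h2 : c `^ a * A v / 2 <= T `^ a * L / 2.
    rewrite ler_pM2r ?invr_gt0//; apply: ler_pM => //; first exact: powR_ge0.
    by apply: (ge0_ler_powR (ltW a0)) => //; rewrite nnegrE ltW.
  apply: (lerD h1); apply: (ler_wpM2l _ h2).
  by rewrite subr_ge0.
(* Beyond T the potential term is at least c^a A(v). Kinetic term and excess together are at most
   c^a A(v), because be <= 2. *)
apply: le_trans RHS0; have := TP v c Hv mv2 vL lF (ltW Tc); rewrite -/I => h.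
have e1 : (c ^+ 2)^-1 * I = c `^ a * (c `^ (- (2 + a)) * I).
  rewrite mulrA -gt0_powRD// -[c ^+ 2](powR_mulrn 2 (ltW c0)) -powRN.
  by congr (_ `^ _ * _); ring.
have h3 : c `^ a * A v <= (c ^+ 2)^-1 * I.
  by rewrite e1; apply: (ler_wpM2l (ltW ca0)); exact: le_trans vL h.
have h4 : (be - 1) * (c `^ a * A v / 2) <= c `^ a * A v / 2.
  rewrite ler_piMl ?divr_ge0 ?mulr_ge0 ?(ltW ca0)//.
  by rewrite lerBlDr; apply: (le_trans kb); rewrite le_eqVlt; apply/orP; left; apply/eqP; ring.
rewrite /J; set z1 := (c ^+ 2)^-1 * I in h3 *; set z2 := c `^ a * A v in h3 h4 *.
by set z3 := (be - 1) * _ in h4 *; lra.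
Qed.

(** Along the fiber of a dilate of [u0] there are two regimes. For c <= dl the values c u0(x) stay
    where F(t) >= M |t|^q, and the energy is at most A(u0) x/2 - M Q x^(q/2) for the scale-invariant
    variable x = k^(1-2s/N) c^a, small at its maximum when M is large. For c > dl the growth of F
    beats the kinetic term, whose relative weight k^(-2s/N) tends to 0 with growing mass. *)
Lemma ground_energy_small (u0 : Rn R N -> R) K : Hs s u0 -> 0 < mass u0 ->
  (forall x, `|u0 x| <= 1) -> 0 < K ->
  exists2 m0, 0 < m0 & forall m, m0 <= m -> (E m <= K%:E)%E.
Proof.
move=> Hu u00 u01 K0.
pose Q := itg (fun t => `|t| `^ q) u0.
have Q0 : 0 < Q.
  by apply: (itg_gt0 s_gt0 N_gt0 N_gt2s Hu growth_q _ (@powR_normr_gt0 R q)) => // t; exact: powR_ge0.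
have Au := seminorm2_gt0 s_gt0 N_gt0 N_gt2s Hu u00.
have q20 : 0 < q / 2 - 1 by rewrite subr_gt0 ltr_pdivlMr// mul1r.
pose y : R := 2 * K / A u0; have y0 : 0 < y by rewrite divr_gt0// mulr_gt0.
have Qy : 0 < Q * y `^ (q / 2 - 1) by rewrite mulr_gt0// powR_gt0.
(* With this [M] the expression A(u0) x/2 - M Q x^(q/2) vanishes at x = y and is nonpositive beyond;
   up to y its linear part is at most A(u0) y/2 = K. *)
pose M : R := A u0 / 2 / (Q * y `^ (q / 2 - 1)).
have M0 : 0 < M by rewrite divr_gt0// divr_gt0.
have [d d0 dP] := ep_near0 FH M.
pose dl : R := d / 2; have dl0 : 0 < dl by rewrite divr_gt0.
have dld : dl < d by rewrite /dl; lra.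
have Fdl : 0 < itg (fun t => F (dl * t)) u0.
  apply: (itg_gt0 s_gt0 N_gt0 N_gt2s Hu (growth_comp dl growth_F)) => //.
    by move=> t; exact: ep_Fge0.
  by move=> t t0; apply: (ep_Fgt0 FH); rewrite mulf_neq0// gt_eqF.
pose Y : R := dl `^ (- (2 + a)) * itg (fun t => F (dl * t)) u0.
have Y0 : 0 < Y by rewrite mulr_gt0// powR_gt0.
have eY : 0 < 2 * Y / A u0 by rewrite divr_gt0// mulr_gt0.
(* For k >= 1/z the factor k^(-2s/N) is at most 2Y/A(u0), just enough for the kinetic term to stay
   below c^a Y when c > dl. *)
have [z z0 zP] := exists_small_powR b0 eY.
exists (z^-1 * mass u0); first by rewrite mulr_gt0// invr_gt0.
move=> m zm; pose k : R := m / mass u0.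
have kz : z^-1 <= k by rewrite ler_pdivlMr.
have k0 : 0 < k by apply: lt_le_trans kz; rewrite invr_gt0.
have m0 : 0 < m by rewrite -(pmulr_lgt0 _ (_ : 0 < (mass u0)^-1))// invr_gt0.
have mk : mass (dilation k u0) = m by rewrite mass_dilation// /k divfK// gt_eqF.
apply: (ground_energy_le_fibers m0 (Hs_dilation k0 Hu) mk) => c c0.
rewrite en_fiber//; last exact: Hs_dilation.
rewrite seminorm2_dilation// (itg_dilation k0 Hu (growth_comp c growth_F)); last first.
  by move=> t; exact: ep_Fge0.
set be := k `^ (- (2 * s / N%:R)); set I := itg (fun t => F (c * t)) u0.
have be0 : 0 < be by rewrite powR_gt0.
have ca0 : 0 < c `^ a by rewrite powR_gt0.
have [cd|dc] := leP c dl.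
  have FI : M * c `^ q * Q <= I.
    have g1 := growthZ (M * c `^ q) growth_q.
    rewrite -(itgZ s_gt0 N_gt0 N_gt2s _ Hu growth_q).
    apply: (ler_itg_pointwise Hu g1 (growth_comp c growth_F)) => x.
    have cx : `|c * u0 x| < d.
      rewrite normrM (gtr0_norm c0); apply: le_lt_trans dld; apply: le_trans cd.
      by rewrite ler_piMr// ltW.
    have := dP _ cx; rewrite normrM (gtr0_norm c0) powRM ?(ltW c0)//.
    by rewrite mulrA.
  pose x : R := k * be * c `^ a; have x0 : 0 < x := mulr_gt0 (mulr_gt0 k0 be0) ca0.
  (* Scale invariance of Sobolev's inequality: the critical integral changes like the power q/2 of
     the squared seminorm, so k and c enter only through x. *)
  have xq : k * ((c ^+ 2)^-1 * c `^ q) = x `^ (q / 2).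
    rewrite /x powRM ?(ltW ca0) ?(ltW (mulr_gt0 k0 be0))// /be.
    rewrite -{2}(powRr1 (ltW k0)) -(gt0_powRD _ _ k0) -!powRrM.
    rewrite -[c ^+ 2](powR_mulrn 2 (ltW c0)) -powRN -gt0_powRD//.
    have -> : (1 + - (2 * s / N%:R)) * (q / 2) = 1 by field; rewrite !gt_eqF.
    rewrite (powRr1 (ltW k0)); congr (_ * _ `^ _).
    by field; rewrite !gt_eqF.
  have h1 : M * x `^ (q / 2) * Q <= k * ((c ^+ 2)^-1 * I).
    rewrite -xq (_ : _ * Q = k * ((c ^+ 2)^-1 * (M * c `^ q * Q))); last by ring.
    apply: (ler_wpM2l (ltW k0)); apply: ler_wpM2l FI.
    by rewrite invr_ge0 exprn_ge0// ltW.
  have -> : c `^ a * (k * be * A u0) / 2 - (c ^+ 2)^-1 * (k * I) =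
      A u0 / 2 * x - k * ((c ^+ 2)^-1 * I) by rewrite /x; ring.
  apply: (@le_trans _ _ (A u0 / 2 * x - M * x `^ (q / 2) * Q)).
    by rewrite lerD2l lerN2.
  have [xy|yx] := leP x y.
    rewrite lerBlDr; apply: (@le_trans _ _ (A u0 / 2 * y)).
      by rewrite ler_pM2l// divr_gt0.
    have -> : A u0 / 2 * y = K by rewrite /y; field; rewrite gt_eqF.
    rewrite lerDl.
    exact: (mulr_ge0 (mulr_ge0 (ltW M0) (powR_ge0 _ _)) (ltW Q0)).
  apply: le_trans (ltW K0); rewrite subr_le0.
  have xyq : y `^ (q / 2 - 1) <= x `^ (q / 2 - 1).
    by apply: (ge0_ler_powR (ltW q20) _ _ (ltW yx)); rewrite nnegrE ltW.
  have -> : M * x `^ (q / 2) * Q = M * (Q * x `^ (q / 2 - 1)) * x.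
    have -> : x `^ (q / 2) = x `^ (q / 2 - 1) * x.
      transitivity (x `^ (q / 2 - 1) * x `^ 1); last by rewrite powRr1// ltW.
      by rewrite -gt0_powRD//; congr (_ `^ _); ring.
    by ring.
  rewrite ler_pM2r//; have -> : A u0 / 2 = M * (Q * y `^ (q / 2 - 1)).
    by rewrite /M divfK// gt_eqF.
  by apply: (ler_wpM2l (ltW M0)); apply: (ler_wpM2l (ltW Q0)).
have cdl : 1 <= c / dl by rewrite ler_pdivlMr// mul1r ltW.
have h1 : c `^ a * Y <= (c ^+ 2)^-1 * I.
  have gd := growthZ ((c / dl) `^ (2 + a)) (growth_comp dl growth_F).
  have h2 : (c / dl) `^ (2 + a) * itg (fun t => F (dl * t)) u0 <= I.
    rewrite -(itgZ s_gt0 N_gt0 N_gt2s _ Hu (growth_comp dl growth_F)).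
    apply: (ler_itg s_gt0 N_gt0 N_gt2s Hu gd (growth_comp c growth_F)) => t.
    by have := ep_scale_ge FH (dl * t) cdl; rewrite mulrA divfK// gt_eqF.
  rewrite ler_pdivlMl ?exprn_gt0//; apply: le_trans h2.
  rewrite powRM ?invr_ge0 ?(ltW c0) ?(ltW dl0)// (gt0_powRD _ _ c0) powR_mulrn ?(ltW c0)//.
  have -> : dl^-1 `^ (2 + a) = dl `^ (- (2 + a)).
    by rewrite -(powR_inv1 (ltW dl0)) -powRrM mulN1r.
  by rewrite /Y le_eqVlt; apply/orP; left; apply/eqP; ring.
apply: le_trans (ltW K0).
have -> : c `^ a * (k * be * A u0) / 2 - (c ^+ 2)^-1 * (k * I) =
   k * (c `^ a * (be * A u0 / 2) - (c ^+ 2)^-1 * I) by ring.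
rewrite pmulr_rle0// subr_le0; apply: le_trans h1; rewrite ler_pM2l//.
have kV : k^-1 <= z by rewrite -[leRHS]invrK lef_pV2 ?posrE ?invr_gt0.
have kV0 : 0 < k^-1 by rewrite invr_gt0.
have beE : be = k^-1 `^ (2 * s / N%:R).
  by rewrite -(powR_inv1 (ltW k0)) -powRrM mulN1r.
have := zP _ kV0 kV; rewrite -beE ler_pdivlMr// => h.
by set w := be * A u0 in h *; lra.
Qed.

(** * Properties of the infimum, given a bounded test function of positive mass *)

Section test_function.
Variable u0 : Rn R N -> R.
Hypotheses (Hu0 : Hs s u0) (mass_u0 : 0 < mass u0) (u0_le1 : forall x, `|u0 x| <= 1).

Lemma ground_energy_bounds m : 0 < m -> (0 < E m < +oo)%E.
Proof.
move=> m0; have [x0 x00 xP] := en_ge_pos m0.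
have [u um] := exists_manifold (ex_intro2 _ _ u0 Hu0 mass_u0) m0.
apply/andP; split; last exact: le_lt_trans (ground_energy_le um) (ltry _).
apply: (@lt_le_trans _ _ x0%:E); first by rewrite lte_fin.
by apply: ground_energy_ge => v vm; exact: xP vm.
Qed.

Lemma EFin_ground_energy m : 0 < m -> E m = (fine (E m))%:E.
Proof.
move=> /ground_energy_bounds/andP[E0 Ey]; rewrite fineK//.
by rewrite ge0_fin_numE// ltW.
Qed.

Lemma ground_energy_decreasing m1 m2 : 0 < m1 -> m1 < m2 -> (E m2 < E m1)%E.
Proof.
move=> m10 m12; have m20 := lt_trans m10 m12.
have e1 := EFin_ground_energy m10; have e2 := EFin_ground_energy m20.
have /andP[E1 _] := ground_energy_bounds m10.
set x1 := fine (E m1) in e1; set x2 := fine (E m2) in e2.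
have x10 : 0 < x1 by rewrite -lte_fin -e1.
have K0 : 0 < x1 + 1 by rewrite addr_gt0.
have [d d0 dP] := ground_energy_gap m10 m12 K0.
(* The gap is available only for energies up to x1 + 1; elements above that level are at distance 1
   from the infimum anyway, hence the minimum. *)
have : ((Num.min (x2 + d) (x1 + 1))%:E <= E m1)%E.
  apply: ground_energy_ge => u um; rewrite ge_min.
  have [uK|Ku] := leP (en u) (x1 + 1); last by rewrite (ltW Ku) orbT.
  have [v vm vu] := dP u um uK; rewrite (le_trans _ vu)// lerD2r.
  by rewrite -lee_fin -e2; exact: ground_energy_le.
rewrite e1 e2 lee_fin lte_fin ge_min => /orP[|]; last by lra.
by lra.
Qed.

Lemma ground_energy_nonincreasing m1 m2 : 0 < m1 -> m1 <= m2 ->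
  fine (E m2) <= fine (E m1).
Proof.
move=> m10; rewrite le_eqVlt => /predU1P[->//|m12].
have m20 := lt_trans m10 m12; have := ground_energy_decreasing m10 m12.
by rewrite (EFin_ground_energy m10) (EFin_ground_energy m20) lte_fin => /ltW.
Qed.

Lemma powRN_near1 (b e : R) : 0 < b -> 0 < e ->
  exists2 y, 2^-1 <= y < 1 & forall k, y <= k -> k < 1 -> k `^ (- b) <= 1 + e.
Proof.
move=> b_gt0 e0; have e1 : 1 < 1 + e by rewrite ltrDl.
have e10 : 0 < 1 + e := lt_trans ltr01 e1.
pose y := (1 + e) `^ (- b^-1); have y0 : 0 < y by exact: powR_gt0.
have y1 : y < 1.
  rewrite /y powRN invf_lt1 ?powR_gt0//.
  have bV0 : 0 < b^-1 by rewrite invr_gt0.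
  have := @gt0_ltr_powR R _ bV0 1 (1 + e); rewrite powR1 !nnegrE => -> //.
  exact: ltW.
have yb : y `^ (- b) = 1 + e.
  by rewrite /y -powRrM mulrNN mulVf ?gt_eqF// powRr1// ltW.
(* The lower bound 1/2 keeps all masses within [m/2, 2m] in the proof of continuity. *)
exists (Num.max 2^-1 y).
  by rewrite le_max lexx/= gt_max y1 andbT; lra.
move=> k; rewrite ge_max => /andP[_ yk] _; rewrite -yb !powRN.
have k0 := lt_le_trans y0 yk.
rewrite lef_pV2 ?posrE ?powR_gt0//; apply: (ge0_ler_powR (ltW b_gt0)) => //.
  by rewrite nnegrE ltW.
by rewrite nnegrE ltW.
Qed.

(** As the infimum is nonincreasing, continuity amounts to bounding its value at the smaller mass by
    its value at the larger one plus a small error: a near-minimizer at the larger mass is dilated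
    down with [ground_energy_modulus]. *)
Lemma fine_ground_energy_continuous m : 0 < m ->
  {for m, continuous (fun m => fine (E m))}.
Proof.
move=> m0; have m20 : 0 < m / 2 by rewrite divr_gt0.
(* By monotonicity, a common energy bound for near-minimizers at every mass at least m/2. *)
pose K := fine (E (m / 2)) + 1.
have /andP[E0 _] := ground_energy_bounds m20.
have K0 : 0 < K by rewrite ltr_pwDr// -lee_fin -EFin_ground_energy// ltW.
have m22 : m / 2 <= 2 * m by lra.
have [X X0 XP] := ground_energy_modulus m20 m22 K0.
apply/cvgrPdist_le => e e0.
have X1 : 0 < X + 1 by rewrite ltr_pwDr.
pose e1 := Num.min 1 (e / 2 / (X + 1)).
have e10 : 0 < e1 by rewrite lt_min ltr01 !divr_gt0.
have [y /andP[y2 y1] yP] := powRN_near1 b0 e10.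
have y0 : 0 < y by apply: lt_le_trans y2; rewrite invr_gt0.
have key m1 m2 : m / 2 <= m1 -> m1 < m2 -> m2 <= 2 * m -> y * m2 <= m1 ->
    `|fine (E m1) - fine (E m2)| <= e.
  move=> hm1 m12 hm2 ym; have m1_gt0 := lt_le_trans m20 hm1.
  have m2_gt0 := lt_trans m1_gt0 m12.
  have mono := ground_energy_nonincreasing m1_gt0 (ltW m12).
  rewrite ger0_norm ?subr_ge0//.
  pose k := m1 / m2; have k0 : 0 < k by rewrite divr_gt0.
  have k1 : k < 1 by rewrite ltr_pdivrMr// mul1r.
  have yk : y <= k by rewrite ler_pdivlMr.
  have kb := yP k yk k1.
  have kb2 : k `^ (- (2 * s / N%:R)) <= 2.
    apply: (le_trans kb); rewrite (_ : 2 = 1 + 1) // lerD2l.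
    by rewrite ge_min lexx.
  have km : k * m2 = m1 by rewrite divfK// gt_eqF.
  pose h := Num.min 1 (e / 2); have h0 : 0 < h by rewrite lt_min ltr01 divr_gt0.
  have : (E m2 < (fine (E m2) + h)%:E)%E.
    by rewrite (EFin_ground_energy m2_gt0)/= lte_fin ltrDl.
  move=> /ereal_inf_lt[_ [v vm <-]]; rewrite lte_fin => vh.
  have vK : en v <= K.
    apply: (le_trans (ltW vh)); apply: lerD; last by rewrite ge_min lexx.
    exact: (ground_energy_nonincreasing m20 (le_trans hm1 (ltW m12))).
  have hm12 := le_trans hm1 (ltW m12).
  have := XP m2 k v hm12 hm2 k0 k1 kb2 vm vK.
  rewrite km (EFin_ground_energy m1_gt0) lee_fin => E1.
  have h2 : h <= e / 2 by rewrite ge_min lexx orbT.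
  have h3 : (k `^ (- (2 * s / N%:R)) - 1) * X <= e / 2.
    apply: (@le_trans _ _ (e1 * X)).
      by apply: ler_wpM2r => //; rewrite lerBlDl.
    apply: (@le_trans _ _ (e / 2 / (X + 1) * X)).
      by apply: ler_wpM2r => //; rewrite ge_min lexx orbT.
    rewrite -mulrA ler_piMr ?divr_ge0 ?(ltW e0)// ler_pdivrMl// mulr1.
    by rewrite lerDl.
  move: E1 h3; set z := (_ - 1) * X; lra.
apply/nbhs_ballP; exists (Num.min (m * (1 - y)) (m * (y^-1 - 1))) => /=.
  by rewrite lt_min !mulr_gt0// subr_gt0// invf_gt1.
move=> x; rewrite /ball/= lt_min => /andP[b1 b2].
have ymm : m / 2 <= m * y by rewrite ler_pM2l.
have ymm2 : m / y <= 2 * m.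
  by rewrite mulrC ler_pM2r// -[leRHS]invrK lef_pV2 ?posrE ?invr_gt0.
move: b1 b2; rewrite !mulrBr mulr1 !ltr_norml => /andP[b1 b1'] /andP[b2 b2'].
have [xm|mx|->] := ltgtP x m; last by rewrite subrr normr0 ltW.
  rewrite distrC; apply: key => //; [lra|lra|].
  by rewrite mulrC; lra.
apply: key => //; [lra|lra|].
have : x <= m / y by lra.
by rewrite ler_pdivlMr// mulrC.
Qed.

Lemma ground_energy_cvg m : 0 < m -> E x @[x --> m] --> E m.
Proof.
move=> m0; rewrite (EFin_ground_energy m0); apply/fine_cvgP; split.
  near=> x; have x0 : 0 < x by near: x; exact: lt_nbhsr.
  by rewrite (EFin_ground_energy x0).
exact: fine_ground_energy_continuous.
Unshelve. all: by end_near. Qed.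

Lemma ground_energy_within_continuous : {within `]0, +oo[, continuous E}.
Proof.
apply: continuous_in_subspaceT => m; rewrite inE/= in_itv/= andbT.
exact: ground_energy_cvg.
Qed.

Lemma ground_energy_cvg0 : E m @[m --> 0^'+] --> +oo%E.
Proof.
apply/cvgeyPge => K; have K0 : 0 < `|K| + 1 by rewrite ltr_pwDr.
have [m0 m00 mP] := en_ge_small_mass K0.
apply: filterS2 (nbhs_right_gt 0) (nbhs_right_le m00) => m mgt mle.
apply: (@le_trans _ _ (`|K| + 1)%:E).
  by rewrite lee_fin (le_trans (ler_norm K))// lerDl.
by apply: ground_energy_ge => u um; exact: (mP m u).
Qed.

Lemma ground_energy_cvgy : E m @[m --> +oo] --> 0%E.
Proof.
apply/fine_cvgP; split.
  apply: filterS (nbhs_pinfty_gt (num_real 0)) => m m0.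
  by rewrite (EFin_ground_energy m0).
apply/cvgrPdist_le => e e0.
have [m0 m00 mP] := ground_energy_small Hu0 mass_u0 u0_le1 e0.
apply: filterS (nbhs_pinfty_ge (num_real m0)) => m mm.
have mgt := lt_le_trans m00 mm.
have := mP m mm; have /andP[E0 _] := ground_energy_bounds mgt.
rewrite sub0r normrN /=; move: E0; rewrite (EFin_ground_energy mgt) lte_fin lee_fin/=.
by move=> /gtr0_norm ->.
Qed.

End test_function.

End fibers.

Theorem theorem1p4 (R : realType) (N : nat) (s : R) (f : R -> R)
  (s_gt0 : 0 < s) (s_lt1 : s < 1) (N_ge1 : (1 <= N)%N) (N_gt2s : 2 * s < N%:R)
  (f_odd : forall t, f (- t) = - f t)
  (f_cont : continuous f)
  (f_at0 : f t / `|t| `^ (1 + 4 * s / N%:R) @[t --> 0^'] --> 0)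
  (f_atoo : f t / `|t| `^ ((N%:R + 2 * s) / (N%:R - 2 * s)) @[t --> +oo] --> 0)
  (F_atoo : primitive f t / `|t| `^ (2 + 4 * s / N%:R) @[t --> +oo] --> +oo)
  (Ftilde_decr : forall t1 t2, t1 < t2 -> t2 < 0 ->
     Ftilde f t2 / `|t2| `^ (2 + 4 * s / N%:R)
     < Ftilde f t1 / `|t1| `^ (2 + 4 * s / N%:R))
  (Ftilde_incr : forall t1 t2, 0 < t1 -> t1 < t2 ->
     Ftilde f t1 / `|t1| `^ (2 + 4 * s / N%:R)
     < Ftilde f t2 / `|t2| `^ (2 + 4 * s / N%:R))
  (f_lt_F : forall t, t != 0 ->
     f t * t < 2 * N%:R / (N%:R - 2 * s) * primitive f t)
  (tf_at0 : t * f t / `|t| `^ (2 * N%:R / (N%:R - 2 * s)) @[t --> 0^'] --> +oo) :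
  [/\ forall m, 0 < m -> (0 < least_energy N s f m < +oo)%E,
      {within `]0, +oo[, continuous (least_energy N s f)},
      forall m1 m2, 0 < m1 -> m1 < m2 ->
        (least_energy N s f m2 < least_energy N s f m1)%E,
      least_energy N s f m @[m --> 0^'+] --> +oo%E
    & least_energy N s f m @[m --> +oo] --> 0%E].
Proof.
have a0 := mass_exp_gt0 s_gt0 N_ge1.
have aq := mass_exp_lt_crit s_gt0 N_ge1 N_gt2s.
have qE : 2 * N%:R / (N%:R - 2 * s) = 1 + (N%:R + 2 * s) / (N%:R - 2 * s).
  by field; rewrite gt_eqF// subr_gt0.
have FH : energy_pair (4 * s / N%:R) (2 * N%:R / (N%:R - 2 * s)) (primitive f) (Ftilde f).
  split.
  - exact: (continuous_primitive a0 f_odd f_cont f_at0).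
  - exact: (continuous_Ftilde a0 f_odd f_cont f_at0).
  - exact: (primitive_even f_odd f_cont).
  - exact: (Ftilde_even f_odd f_cont).
  - exact: primitive0.
  - exact: Ftilde0.
  - exact: (primitive_gt0 a0 aq f_odd f_cont f_at0 Ftilde_incr f_lt_F).
  - exact: (Ftilde_gt0 a0 f_odd f_cont f_at0 Ftilde_incr).
  - exact: (primitive_tangent a0 f_odd f_cont Ftilde_incr).
  - exact: (primitive_le_Ftilde a0 f_odd f_cont f_at0 Ftilde_incr).
  - exact: (Ftilde_le f_lt_F).
  - exact: (primitive_scale_ge a0 f_odd f_cont f_at0 Ftilde_incr).
  - exact: (primitive_scale_lt f_odd f_cont f_lt_F).
  - exact: (primitive_near0_ge a0 aq f_lt_F tf_at0).
  - exact: (primitive_superlinear a0 aq qE f_odd f_cont f_at0 f_atoo F_atoo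
      Ftilde_incr f_lt_F).
  - exact: (small_at_ends_primitive a0 aq qE f_odd f_cont f_at0 f_atoo
      Ftilde_incr f_lt_F).
  - exact: (small_at_ends_Ftilde a0 aq qE f_odd f_cont f_at0 f_atoo
      Ftilde_incr f_lt_F).
have manifoldE (m : R) (u : Rn R N -> R) : pohozaev_manifold s f m u <->
    on_manifold s (Ftilde f) m u.
  have gH := growth_H s_gt0 N_ge1 N_gt2s FH.
  have aE : N%:R / (2 * s) = 2 / (4 * s / N%:R).
    by field; rewrite !gt_eqF// ltr0n.
  split=> [[[Hu um] uP]|[Hu um uP]].
    split => //; first by apply: EFin_inj; rewrite -(EFin_mass Hu).
    move: uP; rewrite /pohozaev (EFin_itg s_gt0 N_ge1 N_gt2s Hu gH).
    by rewrite EFin_seminorm2// -EFinM -EFinB => -[/subr0_eq ->]; congr (_ * _).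
  split; first by split => //; rewrite (EFin_mass Hu) um.
  rewrite /pohozaev (EFin_itg s_gt0 N_ge1 N_gt2s Hu gH) EFin_seminorm2//.
  rewrite -EFinM -EFinB uP; congr EFin; apply/eqP; rewrite subr_eq0; apply/eqP.
  by congr (_ * _).
(* On H^s the growth bounds make all the integrals finite, so the infimum in the extended reals runs
   over real energies. *)
have -> : least_energy N s f = @ground_energy R N s (primitive f) (Ftilde f).
  apply/funext => m; rewrite /least_energy /ground_energy; congr ereal_inf.
  have gF := growth_F s_gt0 N_ge1 N_gt2s FH.
  have enE (u : Rn R N -> R) : Hs s u ->
      energy s f u = (en s (primitive f) u)%:E.
    move=> Hu; rewrite /energy (EFin_itg s_gt0 N_ge1 N_gt2s Hu gF).
    by rewrite EFin_seminorm2// -EFinM -EFinB /en mulrC.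
  apply/seteqP; split=> _ [u um <-]; exists u => //.
  - by apply/manifoldE.
  - by rewrite enE//; have [[]] := um.
  - by apply/manifoldE.
  - by rewrite enE//; have [] := um.
have Ht := tent_Hs s_gt0 s_lt1 N_ge1.
have mt := mass_tent_gt0 s_gt0 s_lt1 N_ge1.
have t1 (x : Rn R N) : `|tent x| <= 1 by rewrite ger0_norm ?tent_ge0// tent_le1.
split.
- exact: (ground_energy_bounds s_gt0 N_ge1 N_gt2s FH Ht mt).
- exact: (ground_energy_within_continuous s_gt0 N_ge1 N_gt2s FH Ht mt).
- exact: (ground_energy_decreasing s_gt0 N_ge1 N_gt2s FH Ht mt).
- exact: (ground_energy_cvg0 s_gt0 N_ge1 N_gt2s FH).
- exact: (ground_energy_cvgy s_gt0 N_ge1 N_gt2s FH Ht mt t1).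
Qed.
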